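(* Let $\mathcal G$ be a core input-output network with homeostasis pattern network $\mathcal P$ and appendage pattern network $\mathcal P_{\mathcal A}$. An appendage component $\widetilde{\mathcal A}_i\in\mathcal P_{\mathcal A}$ induces an appendage component $\widetilde{\mathcal A}_j\in\mathcal P_{\mathcal A}$ if and only if $\widetilde{\mathcal A}_i$ is strictly upstream from $\widetilde{\mathcal A}_j$ and every path from $\widetilde{\mathcal A}_i$ to $\widetilde{\mathcal A}_j$ in $\mathcal P$ contains a super-simple node $\rho$ satisfying $\mathcal V_{max}(\widetilde{\mathcal A}_i)\preceq\rho\preceq\mathcal V_{min}(\widetilde{\mathcal A}_j)$.
   Context: NETWORKS. An input-output network $\mathcal G$ is a finite directed graph with two distinct distinguished nodes, the input node $\iota$ and the output node $o$. It is core if every node is downstream from $\iota$ (there is a directed path from $\iota$ to it) and upstream from $o$. INDUCTION. Each node $j$ carries a variable $x_j\in\mathbb R$. An admissible system is $\dot X=f(X,\mathcal I)$ with $f$ smooth, where the real parameter $\mathcal I$ appears only in $f_\iota$, and $f_j$ depends only on $x_j$ and on those $x_\ell$ with an arrow $\ell\to j$. Write $f_{j,\ell}=\partial f_j/\partial x_\ell$; for $j\ne\ell$, $f_{j,\ell}\equiv 0$ precisely when there is no arrow $\ell\to j$. If $X_0$ is a hyperbolic equilibrium at $\mathcal I_0$, there is a unique family of equilibria $X(\mathcal I)$ near $\mathcal I_0$ with $X(\mathcal I_0)=X_0$; a node $\kappa$ is homeostatic at $(X_0,\mathcal I_0)$ if $x_\kappa'(\mathcal I_0)=0$. The homeostasis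 matrix $H$ is the Jacobian $J=(f_{j,\ell})$ with the row of $\iota$ and the column of $o$ deleted. There are permutation matrices $P,Q$ such that $PHQ$ is block upper triangular with square diagonal blocks $B_1,\dots,B_m$ that cannot be further block triangularized (entries $f_{j,\ell}$ regarded as independent indeterminates); these are the homeostasis blocks. The homeostasis subnetwork $\mathcal K_\eta$ of $B_\eta$ has as nodes all $p,q$ such that $f_{p,q}$ is a nonzero entry of $B_\eta$, and as arrows the corresponding $q\to p$ with $p\ne q$. $\mathcal K_\eta$ is homeostasis inducing at $(X_0,\mathcal I_0)$ if $\det B_\eta=0$ there. $\mathcal K\Rightarrow\kappa$ ($\mathcal K$ induces node $\kappa$) means: generically for admissible $f$, $\kappa$ is homeostatic whenever $\mathcal K$ is homeostasis inducing. Here ''generically'' means: except when the partial derivatives at $(X_0,\mathcal I_0)$ satisfy an additional polynomial equation not vanishing identically on the set where the determinant of the block of $\mathcal K$ is zero. For a set $\mathcal N$ of nodes (or a subnetwork), $\mathcal K\Rightarrow\mathcal N$ means $\mathcal K\Rightarrow\kappa$ for every $\kappa\in\mathcal N$. SIMPLE NODES. A simple path visits each of its nodes once; $\kappa_1\rightsquigarrow\kappa_2$ denotes a simple path from $\kappa_1$ to $\kappa_2$. An $\iota o$-simple path is a simple path from $\iota$ to $o$. A node is simple if it lies on some $\iota o$-simple path, appendage otherwise, and super-simple if it lies on every $\iota o$-simple path. The super-simple nodes are totally ordered, $\iota=\rho_0\prec\rho_1\prec\dots\prec\rho_{q+1}=o$, by order of appearance on any $\iota o$-simple path. If there are a super-simple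 $\rho$ and an $\iota o$-simple path $\iota\rightsquigarrow\sigma_1\rightsquigarrow\rho\rightsquigarrow\sigma_2\rightsquigarrow o$, then $\sigma_1\prec\rho$, $\rho\prec\sigma_2$, $\sigma_1\prec\sigma_2$. A transitive component is a strongly connected component. For an $\iota o$-simple path $S$, the complementary subnetwork $C_S$ consists of all nodes not in $S$ and all arrows between them. An appendage node $\tau$ is super-appendage if for each $C_S$ containing $\tau$, the transitive component of $\tau$ in $C_S$ consists only of appendage nodes. SUBNETWORKS. For $1\le j\le q+1$: the simple subnetwork $\mathcal L_j''$ consists of the simple nodes $\sigma$ with $\rho_{j-1}\prec\sigma\prec\rho_j$ (possibly none); $T_j$ is the set of appendage, non-super-appendage nodes $\tau$ linked to $\mathcal L_j''$, i.e. such that for some $C_S$ the transitive component of $\tau$ in $C_S$ is the union of $\tau$, (at least one) nodes of $\mathcal L_j''$, and non-super-appendage nodes; the augmented simple subnetwork is $\mathcal L_j'=\mathcal L_j''\cup T_j$; the structural subnetwork is $\mathcal L_j=\{\rho_{j-1}\}\cup\mathcal L_j'\cup\{\rho_j\}$, each with all arrows between its nodes. An appendage subnetwork $\mathcal A$ is a transitive component of the subnetwork of super-appendage nodes. It is known that the homeostasis subnetworks of $\mathcal G$ are the structural and the appendage subnetworks. PATTERN NETWORK. The structural pattern network $\mathcal P_{\mathcal S}$ is the chain $\iota=\rho_0\to\widetilde{\mathcal L}_1\to\rho_1\to\dots\to\widetilde{\mathcal L}_{q+1}\to\rho_{q+1}=o$, whose nodes are the super-simple nodes and the backbone nodes $\widetilde{\mathcal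 L}_j$ (representing $\mathcal L_j'$ as a single node, even if empty). $\mathcal P_{\mathcal A}$ has one node $\widetilde{\mathcal A}$ (appendage component) for each appendage subnetwork $\mathcal A$, and an arrow $\widetilde{\mathcal A}_1\to\widetilde{\mathcal A}_2$ between distinct nodes iff $\tau_1\to\tau_2$ in $\mathcal G$ for some $\tau_1\in\mathcal A_1,\tau_2\in\mathcal A_2$. An appendage path is a simple path containing an appendage node, all of whose nodes except perhaps the endpoints are appendage. $\mathcal V_{max}(\widetilde{\mathcal A})$ is the most downstream node $\mathcal V$ of $\mathcal P_{\mathcal S}$ such that there is an appendage path from some $\tau\in\mathcal A$ to some simple node $\sigma\in\mathcal V$; $\mathcal V_{min}(\widetilde{\mathcal A})$ is the most upstream node $\mathcal V$ of $\mathcal P_{\mathcal S}$ such that there is an appendage path from some simple node $\sigma\in\mathcal V$ to some $\tau\in\mathcal A$. The homeostasis pattern network $\mathcal P$ consists of the nodes and arrows of $\mathcal P_{\mathcal S}$ and $\mathcal P_{\mathcal A}$ together with the arrows $\widetilde{\mathcal A}\to\mathcal V_{max}(\widetilde{\mathcal A})$ and $\mathcal V_{min}(\widetilde{\mathcal A})\to\widetilde{\mathcal A}$ for each $\widetilde{\mathcal A}$. For nodes of $\mathcal P_{\mathcal S}$, $\preceq$ means ''equal to or earlier in the chain''. $\widetilde{\mathcal A}_i$ is strictly upstream from $\widetilde{\mathcal A}_j$ if $\widetilde{\mathcal A}_i\neq\widetilde{\mathcal A}_j$ and there is a path from $\widetilde{\mathcal A}_i$ to $\widetilde{\mathcal A}_j$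 in $\mathcal P$. The homeostasis subnetwork corresponding to $\widetilde{\mathcal A}$ is $\mathcal A$, and $\widetilde{\mathcal A}_i$ induces $\widetilde{\mathcal A}_j$ iff $\mathcal A_i\Rightarrow\mathcal A_j$. *)

(* Defs.v *)
From HB Require Import structures.
From mathcomp Require Import all_boot all_order all_algebra.
From mathcomp Require Import all_classical all_reals all_analysis.
From mathcomp Require mpoly.
From mathcomp Require Import complex.
Set Implicit Arguments.
Unset Strict Implicit.
Unset Printing Implicit Defensive.
Import Order.TTheory GRing.Theory Num.Theory.
Import numFieldNormedType.Exports.
Local Open Scope ring_scope.

(** * Networks *)

(* [arrow G x y] means x -> y.  Self-arrows are allowed but play no role: every
   node is internally coupled to itself anyway, and [subnetwork]s below only
   record arrows between distinct nodes. *)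
Record io_network (T : finType) := IONetwork {
  arrow : rel T;
  inode : T;
  onode : T;
  inode_neq_onode : inode != onode
}.

Record subnetwork (T : finType) := Subnetwork {
  sub_nodes : {set T};
  sub_arrows : {set T * T}
}.

Section Network.
Variables (T : finType) (G : io_network T).
Local Notation e := (arrow G).
Local Notation inp := (inode G).
Local Notation out := (onode G).

Definition core := forall x, connect e inp x /\ connect e x out.

(* The simple path consists of the nodes x :: p. *)
Definition simple_path (x y : T) (p : seq T) : bool :=
  [&& path e x p, last x p == y & uniq (x :: p)].

Definition io_simple_path (p : seq T) : bool := simple_path inp out p.

Definition simple_node (x : T) := exists2 p, io_simple_path p & x \in inp :: p.

Definition appendage_node (x : T) := ~ simple_node x.

Definition super_simple (x : T) := forall p, io_simple_path p -> x \in inp :: p.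

(* x comes before y: some io-simple path meets x, a super-simple node r and y in
   this order; r may coincide with x or with y. *)
Definition precedes (x y : T) :=
  x <> y /\
  exists p r, [/\ io_simple_path p, super_simple r,
    [&& x \in inp :: p, r \in inp :: p & y \in inp :: p]
    & (index x (inp :: p) <= index r (inp :: p) <= index y (inp :: p))%N].

(* (a, b) = (rho_(j-1), rho_j) for some j *)
Definition consecutive (a b : T) :=
  [/\ super_simple a, super_simple b, precedes a b &
      ~ exists r, [/\ super_simple r, precedes a r & precedes r b]].

(* transitive component of x in the subnetwork with node set D *)
Definition component (D : {set T}) (x : T) : {set T} :=
  let r := [rel y z | [&& e y z, y \in D & z \in D]] in
  [set y in D | connect r x y && connect r y x].

Definition complementary (p : seq T) : {set T} := [set x | x \notin inp :: p].

Definition super_appendage (t : T) :=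
  appendage_node t /\
  forall p, io_simple_path p -> t \in complementary p ->
    forall x, x \in component (complementary p) t -> appendage_node x.

(* The index j is carried by the consecutive pair (a, b) = (rho_(j-1), rho_j). *)
Definition simple_subnetwork (a b : T) : {set T} :=
  [set s | `[< [/\ simple_node s, precedes a s & precedes s b] >]].

Definition linked_appendage (a b : T) (t : T) :=
  [/\ appendage_node t, ~ super_appendage t &
    exists p, [/\ io_simple_path p, t \in complementary p,
      (exists2 s, s \in component (complementary p) t
                & s \in simple_subnetwork a b)
      & forall x, x \in component (complementary p) t ->
          [\/ x = t, x \in simple_subnetwork a b
            | appendage_node x /\ ~ super_appendage x]]].

Definition augmented_simple_subnetwork (a b : T) : {set T} :=
  simple_subnetwork a b :|: [set t | `[< linked_appendage a b t >]].

Definition appendage_subnetwork (A : {set T}) :=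
  exists2 t, super_appendage t
    & A = component [set x | `[< super_appendage x >]] t.

(* p is an appendage path from x to y *)
Definition appendage_path (x y : T) (p : seq T) :=
  [/\ simple_path x y p, (exists2 z, z \in x :: p & appendage_node z)
    & forall z, z \in x :: p -> z <> x -> z <> y -> appendage_node z].

Definition full_subnetwork (A : {set T}) : subnetwork T :=
  Subnetwork A
    [set a | [&& a.1 \in A, a.2 \in A, a.1 != a.2 & e a.1 a.2]].

End Network.

(** * Homeostasis pattern network *)

(* [Backbone a b] is the backbone node between the consecutive super-simple
   nodes a and b; [AppendageComponent A] is the appendage component of A. *)
Inductive pattern_node (T : Type) (S : Type) : Type :=
  | SuperSimple of T
  | Backbone of T & T
  | AppendageComponent of S.
Arguments SuperSimple {T S}.
Arguments Backbone {T S}.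
Arguments AppendageComponent {T S}.

Section PatternNodeFinite.
Variables (T S : Type).
Definition pattern_node_code (V : pattern_node T S) : T + T * T + S :=
  match V with
  | SuperSimple r => inl (inl r)
  | Backbone a b => inl (inr (a, b))
  | AppendageComponent A => inr A
  end.
Definition pattern_node_decode (c : T + T * T + S) : pattern_node T S :=
  match c with
  | inl (inl r) => SuperSimple r
  | inl (inr (a, b)) => Backbone a b
  | inr A => AppendageComponent A
  end.
Lemma pattern_node_codeK : cancel pattern_node_code pattern_node_decode.
Proof. by case. Qed.
End PatternNodeFinite.

HB.instance Definition _ (T S : finType) := Finite.copy (pattern_node T S)
  (can_type (@pattern_node_codeK T S)).

Section Pattern.
Variables (T : finType) (G : io_network T).
Local Notation pnode := (pattern_node T {set T}).

(* V is a node of the structural pattern network *)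
Definition structural_node (V : pnode) : Prop :=
  match V with
  | SuperSimple r => super_simple G r
  | Backbone a b => consecutive G a b
  | AppendageComponent _ => False
  end.

Definition pattern_node_set (V : pnode) : {set T} :=
  match V with
  | SuperSimple r => [set r]
  | Backbone a b => augmented_simple_subnetwork G a b
  | AppendageComponent A => A
  end.

Inductive structural_arrow : pnode -> pnode -> Prop :=
  | ArrowIn a b : consecutive G a b ->
      structural_arrow (SuperSimple a) (Backbone a b)
  | ArrowOut a b : consecutive G a b ->
      structural_arrow (Backbone a b) (SuperSimple b).

(* "equal to or earlier in the chain", for structural nodes *)
Definition chain_le (V W : pnode) : bool :=
  connect (fun U U' => `[< structural_arrow U U' >]) V W.

Definition appendage_exit (A : {set T}) (V : pnode) :=
  structural_node V /\
  exists t s p, [/\ t \in A, simple_node G s, s \in pattern_node_set V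
                  & appendage_path G t s p].

Definition appendage_entry (A : {set T}) (V : pnode) :=
  structural_node V /\
  exists s t p, [/\ simple_node G s, s \in pattern_node_set V, t \in A
                  & appendage_path G s t p].

(* V = V_max(A) *)
Definition is_Vmax (A : {set T}) (V : pnode) :=
  appendage_exit A V /\ forall W, appendage_exit A W -> chain_le W V.

(* V = V_min(A) *)
Definition is_Vmin (A : {set T}) (V : pnode) :=
  appendage_entry A V /\ forall W, appendage_entry A W -> chain_le V W.

Inductive appendage_arrow : pnode -> pnode -> Prop :=
  | ArrowAppendage A1 A2 t1 t2 :
      appendage_subnetwork G A1 -> appendage_subnetwork G A2 -> A1 <> A2 ->
      t1 \in A1 -> t2 \in A2 -> arrow G t1 t2 ->
      appendage_arrow (AppendageComponent A1) (AppendageComponent A2).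

Inductive pattern_arrow : pnode -> pnode -> Prop :=
  | ArrowS V W : structural_arrow V W -> pattern_arrow V W
  | ArrowA V W : appendage_arrow V W -> pattern_arrow V W
  | ArrowVmax A V : appendage_subnetwork G A -> is_Vmax A V ->
      pattern_arrow (AppendageComponent A) V
  | ArrowVmin A V : appendage_subnetwork G A -> is_Vmin A V ->
      pattern_arrow V (AppendageComponent A).

(* V :: p is a path from V to W in the homeostasis pattern network *)
Definition pattern_path (V W : pnode) (p : seq pnode) : bool :=
  path (fun U U' => `[< pattern_arrow U U' >]) V p && (last V p == W).

Definition strictly_upstream (V W : pnode) :=
  V <> W /\ exists p, pattern_path V W p.

End Pattern.

(** * Homeostasis blocks *)

(* A square block of the Jacobian matrix, given by the ordered lists of the
   nodes labelling its rows and its columns. *)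
Record block (T : Type) := Block {
  bsize : nat;
  brow : bsize.-tuple T;
  bcol : bsize.-tuple T
}.

Section Blocks.
Variables (T : finType) (G : io_network T).

(* f_{j,l} is not identically zero *)
Definition coupled (j l : T) : bool := (j == l) || arrow G l j.

(* B_1, ..., B_m are the diagonal blocks of a block upper triangular form of the
   matrix with rows [rows] and columns [cols]: concatenating the row (column)
   labels of the blocks permutes [rows] ([cols]), and entries below the
   diagonal blocks vanish identically. *)
Definition block_triangular_form (rows cols : seq T) (m : nat)
    (B : 'I_m -> block T) :=
  [/\ forall i, (0 < bsize (B i))%N,
      perm_eq [seq x | i <- enum 'I_m, x <- brow (B i)] rows,
      perm_eq [seq x | i <- enum 'I_m, x <- bcol (B i)] cols
    & forall i k : 'I_m, (k < i)%N ->
        forall j l, j \in (brow (B i) : seq T) -> l \in (bcol (B k) : seq T) ->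
          ~~ coupled j l].

Definition block_irreducible (b : block T) :=
  forall m (B : 'I_m -> block T),
    block_triangular_form (brow b) (bcol b) B -> m = 1%N.

(* The homeostasis matrix has a row for each node but the input node and a
   column for each node but the output node. *)
Definition homeostasis_block (b : block T) :=
  exists m (B : 'I_m -> block T),
    [/\ block_triangular_form (enum [set~ inode G]) (enum [set~ onode G]) B,
        forall i, block_irreducible (B i)
      & exists i, B i = b].

Definition block_entry (b : block T) (j l : T) : bool :=
  [&& j \in (brow b : seq T), l \in (bcol b : seq T) & coupled j l].

Definition homeostasis_subnetwork (b : block T) : subnetwork T :=
  Subnetwork
    [set x | [exists y, block_entry b x y || block_entry b y x]]
    [set a | block_entry b a.2 a.1 && (a.2 != a.1)].

End Blocks.

Definition block_mx (R : Type) n (J : 'M[R]_n) (b : block 'I_n) : 'M[R]_(bsize b) :=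
  \matrix_(i, k) J (tnth (brow b) i) (tnth (bcol b) k).

(** * Admissible systems *)

Fixpoint differentiable_n (R : realType) (V W : normedModType R) (k : nat)
    (g : V -> W) : Prop :=
  if k is k'.+1 then
    (forall x, differentiable g x) /\
    (forall v, differentiable_n k' (fun x => 'D_v g x))
  else True.

(* C^oo on a finite dimensional V: all iterated directional derivatives exist
   and are (Frechet) differentiable. *)
Definition smooth (R : realType) (V W : normedModType R) (g : V -> W) :=
  forall k, differentiable_n k g.

Section Dynamics.
Variables (R : realType) (n : nat) (G : io_network 'I_n).

(* f j (X, I) is the component f_j of the vector field at the state X and the
   parameter I. *)
Implicit Types (f : 'I_n -> 'rV[R]_n * R -> R) (X Y : 'rV[R]_n) (I : R).

Definition jacobian_mx f X I : 'M[R]_n :=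
  \matrix_(j, l) 'D_(delta_mx 0 l, 0) (f j) (X, I).

Definition input_derivative f X I : R := 'D_(0, 1) (f (inode G)) (X, I).

Definition admissible f :=
  [/\ forall j, smooth (f j),
      forall j, j <> inode G -> forall X I I', f j (X, I) = f j (X, I'),
      forall j X Y I, (forall l, coupled G j l -> X 0 l = Y 0 l) ->
        f j (X, I) = f j (Y, I)
    & forall j l, j <> l ->
        (forall X I, jacobian_mx f X I j l = 0) <-> ~~ arrow G l j].

Definition hyperbolic_equilibrium f X I :=
  (forall j, f j (X, I) = 0) /\
  forall z : R[i],
    eigenvalue (map_mx (real_complex R) (jacobian_mx f X I)) z ->
    complex.Re z != 0.

(* By the implicit function theorem, near a hyperbolic equilibrium there is
   exactly one germ of such a family. *)
Definition equilibrium_family f X0 I0 (Xf : R -> 'rV[R]_n) :=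
  [/\ Xf I0 = X0, {for I0, continuous Xf}
    & \forall I \near I0, forall j, f j (Xf I, I) = 0].

Definition homeostatic f X0 I0 (kappa : 'I_n) :=
  forall Xf, equilibrium_family f X0 I0 Xf ->
    is_derive I0 1 (fun I => Xf I 0 kappa) 0.

(* J is a possible value of the Jacobian matrix of an admissible system *)
Definition network_mx (J : 'M[R]_n) := forall j l, ~~ coupled G j l -> J j l = 0.

Definition homeostasis_inducing (K : subnetwork 'I_n) (J : 'M[R]_n) :=
  exists b, [/\ homeostasis_block G b, homeostasis_subnetwork G b = K
              & \det (block_mx J b) = 0].

(* value of the polynomial P at the partial derivatives J = (f_{j,l}) and
   s = f_{iota,I} *)
Definition eval_partials (P : mpoly.mpoly (n * n + 1) R) (J : 'M[R]_n) (s : R) : R :=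
  mpoly.meval (fun i => row_mx (mxvec J) s%:M 0 i) P.

Definition induces (K : subnetwork 'I_n) (kappa : 'I_n) :=
  exists P : mpoly.mpoly (n * n + 1) R,
    (exists J s, [/\ network_mx J, homeostasis_inducing K J
                   & eval_partials P J s != 0]) /\
    forall f X0 I0, admissible f -> hyperbolic_equilibrium f X0 I0 ->
      homeostasis_inducing K (jacobian_mx f X0 I0) ->
      eval_partials P (jacobian_mx f X0 I0) (input_derivative f X0 I0) != 0 ->
      homeostatic f X0 I0 kappa.

Definition induces_set (K : subnetwork 'I_n) (N : {set 'I_n}) :=
  forall kappa, kappa \in N -> induces K kappa.

Definition component_induces (A1 A2 : {set 'I_n}) :=
  induces_set (full_subnetwork G A1) A2.

End Dynamics.

(* Main.v *)
From HB Require Import structures.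
From mathcomp Require Import all_boot all_order all_algebra all_fingroup.
From mathcomp Require Import all_classical all_reals all_analysis.
From mathcomp Require mpoly.
From mathcomp Require Import complex.
From mathcomp Require Import finset path ring lra.
Require Import Defs.
Set Implicit Arguments.
Unset Strict Implicit.
Unset Printing Implicit Defensive.

(** An appendage subnetwork [Ai] induces a node [k] if and only if the determinant
    of the Jacobian on [Ai] divides the cofactor of the Jacobian at the input node
    and [k], because by Cramer's rule this cofactor is, up to generically nonzero
    factors, the derivative of the equilibrium at [k].  The terms of the cofactor
    are indexed by the permutations that consist of a simple path from the input
    node to [k] and disjoint cycles in its complement ([configuration]).
    Divisibility means that all of them preserve [Ai] ([config_invariant]), that
    is, that every simple path from the input node to [k] avoids [Ai] and that [Ai]
    is a transitive component of its complement ([invariant_avoids],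
    [invariant_component], [invariantI]).

    Analysis and algebra reduce induction to this condition.  If all configurations
    preserve [Ai], the cofactor vanishes when the block of [Ai] is singular
    ([invariant_cofactor0]), and the first order expansion of the family of
    equilibria gives homeostasis ([homeostatic_of_cofactor]).  Otherwise the
    cofactor does not vanish identically on the matrices with singular block.  This
    variety is irreducible ([singular_points_irreducible]), so one of its points
    avoids the exceptional polynomial and satisfies all other generic conditions,
    among them hyperbolicity, which follows from the absence of opposite
    eigenvalues ([resultant_hyperbolic]); the linear system with this Jacobian is
    not homeostatic at [k] ([induces_invariant]).  The block of [Ai] is found by
    ordering the rows and columns of the homeostasis matrix along the matching
    given by a simple path ([appendage_block_exists]).

    The rest is the comparison of the condition on all [k] in [Aj] with the pattern
    network ([invariant_iff_pattern]).  A super-simple node [r] that is not before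
    [V_max] of [Ai] and not after [V_min] of [Aj] lies on every path from the input
    node to [Aj].  Such a path that met [Ai], or a cycle in its complement that left
    [Ai], would do so before [r], and continuing the path from [r] to the output
    node would contradict that the nodes of [Ai] are super-appendage; hence the
    condition ([invariant_of_cut]).  Conversely, take an exit [s1] of [Ai] and an
    entry [s2] of [Aj].  If no single node separates the input node and [s1] from
    the output node and [s2], Menger's theorem for two paths
    ([two_disjoint_paths]) provides disjoint paths, which with the stretches
    between these nodes and the subnetworks form a configuration that does not
    preserve [Ai], or contradict that the nodes of [Ai] are super-appendage.  So
    there is a separating node, which is super-simple and lies between [s1] and
    [s2] ([super_simple_between]).  Finally, pattern paths from [Ai] to [Aj] cannot
    bypass this node, since detours through appendage components only lead back
    upstream ([pattern_path_crosses]). *)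

(** * Reachability inside a set of nodes *)

Section Linked.
Variable T : finType.
Implicit Types (e : rel T) (D U W N A B : {set T}).

Definition restrict e D : rel T := [rel y z | [&& e y z, y \in D & z \in D]].

Definition linked e D x y := [&& x \in D, y \in D & connect (restrict e D) x y].

Lemma linked_refl e D x : x \in D -> linked e D x x.
Proof. by move=> xD; rewrite /linked xD connect0. Qed.

Lemma linked_trans e D y x z : linked e D x y -> linked e D y z -> linked e D x z.
Proof.
move=> /and3P[xD _ xy] /and3P[_ zD yz].
by rewrite /linked xD zD (connect_trans xy yz).
Qed.

Lemma linked_edge e D x y : e x y -> x \in D -> y \in D -> linked e D x y.
Proof. by move=> exy xD yD; rewrite /linked xD yD connect1 //=; apply/and3P. Qed.

Lemma linkedL e D x y : linked e D x y -> x \in D.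
Proof. by case/and3P. Qed.

Lemma linkedR e D x y : linked e D x y -> y \in D.
Proof. by case/and3P. Qed.

Lemma linked_step e D x y z : e x y -> x \in D -> linked e D y z -> linked e D x z.
Proof.
by move=> exy xD yz; apply: (linked_trans _ yz); apply: linked_edge => //; case/and3P: yz.
Qed.

Lemma linked_rstep e D x y z : linked e D x y -> e y z -> z \in D -> linked e D x z.
Proof.
by move=> xy eyz zD; apply: (linked_trans xy); apply: linked_edge => //; case/and3P: xy.
Qed.

Lemma path_linked e D x p :
  path e x p -> {subset x :: p <= D} -> linked e D x (last x p).
Proof.
elim: p x => [|y p IH] x /=; first by move=> _ s; apply: linked_refl; rewrite s ?mem_head.
case/andP=> exy py s; apply: (@linked_step _ _ _ y) => //; first by rewrite s ?mem_head.
by apply: IH => // z zp; rewrite s // inE zp orbT.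
Qed.

Lemma linked_path e D x y : linked e D x y ->
  exists p, [/\ path e x p, last x p = y, uniq (x :: p) & {subset x :: p <= D}].
Proof.
case/and3P=> xD yD /connectP[p]; case/shortenP=> p' pp' Up' _ ->; exists p'; split=> //.
  by apply: sub_path pp' => a b /andP[].
move=> z; rewrite inE => /predU1P[->//|]; elim: p' (x) pp' {Up'} => //= a p' IH b.
by case/andP=> /and3P[_ _ aD] pp'; rewrite inE => /predU1P[->//|]; apply: IH pp'.
Qed.

Lemma linked_sub e e' D D' x y :
  (forall a b, a \in D -> b \in D -> e a b -> e' a b) -> {subset D <= D'} ->
  linked e D x y -> linked e' D' x y.
Proof.
move=> ee' DD' /linked_path[p [pp <- _ pD]]; apply: path_linked; last first.
  by move=> z /pD /DD'.
elim: p x pp pD => //= a p IH x /andP[xa pa] pD.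
rewrite ee' ?pD ?inE ?eqxx ?orbT //=; apply: IH => // z zp.
by rewrite pD // inE zp orbT.
Qed.

Lemma linkedS e D D' x y : {subset D <= D'} -> linked e D x y -> linked e D' x y.
Proof. exact: linked_sub. Qed.

Lemma linked_exit e D N x y : linked e D x y -> x \in N -> y \notin N ->
  exists z w, [/\ linked e (D :&: N) x z, e z w, w \notin N & linked e D w y].
Proof.
move=> /linked_path[p [pp <- _ pD]]; elim: p x pp pD => /= [|a p IH] x.
  by move=> _ _ ->.
case/andP=> exa pa s xN lN.
have xD : x \in D by rewrite s ?mem_head.
have s' : {subset a :: p <= D} by move=> z zp; rewrite s // inE zp orbT.
have [aN|aN] := boolP (a \in N); last first.
  by exists x, a; split=> //; [apply: linked_refl; rewrite inE xD xN | apply: path_linked].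
have [z [w [az ezw wN wl]]] := IH _ pa s' aN lN.
by exists z, w; split=> //; apply: linked_step az => //; rewrite inE xD.
Qed.

Lemma linked_enter e D N x y : linked e D x y -> x \notin N -> y \in N ->
  exists w z, [/\ linked e D x w, w \notin N, e w z & linked e (D :&: N) z y].
Proof.
move=> /linked_path[p [pp <- _ pD]] xN lN.
suff: x \in N /\ linked e (D :&: N) x (last x p) \/ 
  exists w z, [/\ linked e D x w, w \notin N, e w z & linked e (D :&: N) z (last x p)].
  by case=> // -[]; rewrite (negPf xN).
elim: p x pp pD {xN} lN => /= [|a p IH] x.
  by move=> _ s lN; left; split=> //; apply: linked_refl; rewrite inE s ?mem_head.
case/andP=> exa pa s lN.
have xD : x \in D by rewrite s ?mem_head.
have s' : {subset a :: p <= D} by move=> z zp; rewrite s // inE zp orbT.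
case: (IH _ pa s' lN) => [[aN al]|[w [z [aw wN ewz zl]]]]; last first.
  by right; exists w, z; split=> //; apply: linked_step aw.
have [xN|xN] := boolP (x \in N).
  by left; split=> //; apply: linked_step al => //; rewrite inE xD.
by right; exists x, a; split=> //; apply: linked_refl.
Qed.

Lemma linked_cat e U W x t y : linked e U x t -> linked e W t y ->
  (forall z, z \in U -> z \in W -> z = t) ->
  exists p q, [/\ path e x (p ++ q), last x p = t, last t q = y,
    uniq (x :: p ++ q) & {subset x :: p <= U} /\ {subset t :: q <= W}].
Proof.
move=> /linked_path[p [pp lp up sp]] /linked_path[q [pq lq uq sq]] UW.
exists p, q; split=> //; first by rewrite cat_path pp lp.
rewrite -cat_cons cat_uniq up; move: uq; rewrite cons_uniq => /andP[tq ->]; rewrite andbT.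
apply/hasPn=> z zq; apply/negP=> /sp zU; have zt := UW z zU (sq z _).
by move: tq; rewrite -zt ?zq // inE zq orbT.
Qed.

Lemma path_split e x p z : path e x p -> uniq (x :: p) -> z \in x :: p ->
  exists U W, [/\ linked e U x z, linked e W z (last x p),
    (forall a, a \in U -> a \in W -> a = z),
    {subset U <= x :: p} & {subset W <= x :: p}].
Proof.
move=> pp up zp; case/splitPl: zp pp up => p1 p2 lp; rewrite cat_path lp => /andP[pp1 pp2].
rewrite -cat_cons cat_uniq => /and3P[u1 dis u2].
exists [set a in x :: p1], [set a in z :: p2]; split.
- by rewrite -lp; apply: path_linked => // a; rewrite in_set.
- by rewrite last_cat lp; apply: path_linked => // a; rewrite in_set.
- move=> a; rewrite !in_set => a1; rewrite inE => /predU1P[//|a2].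
  by case/negP: (hasPn dis _ a2).
- by move=> a; rewrite in_set mem_cat => ->.
- move=> a; rewrite in_set inE mem_cat => /predU1P[->|->]; rewrite ?orbT //.
  by rewrite -lp mem_last.
Qed.

(** Keep one arrow into [A] of the walk from [x] to [t], and shorten the way
    back to its source. *)
Lemma crossing_cycle e D A t x : t \in A -> x \notin A -> linked e D t x ->
    linked e D x t ->
  exists z p, [/\ path.cycle e (z :: p), uniq (z :: p), {subset z :: p <= D},
    z \in A & last z p \notin A].
Proof.
move=> tA xA tx xt; have [w [z [xw wA ewz zt]]] := linked_enter xt xA tA.
have zt' : linked e D z t by apply: linkedS zt => a; rewrite inE => /andP[].
have [p [pp lp up sp]] := linked_path (linked_trans zt' (linked_trans tx xw)).
exists z, p; split=> //; [by rewrite /= rcons_path pp lp | | by rewrite lp].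
by have := linkedL zt; rewrite inE => /andP[].
Qed.

(** * Two disjoint paths *)

Definition inseparable e A B :=
  forall s, exists a b, [/\ a \in A, b \in B & linked e [set~ s] a b].

(** The set [U] contains one of the two paths and its complement the other, so
    that disjointness needs no lists of nodes. *)
Definition disjointly_linked e A B :=
  exists a b a' b' U, [/\ [/\ a \in A, b \in B, a' \in A & b' \in B],
    linked e U a b & linked e (~: U) a' b'].

Lemma disjointly_linked_pair e A s x :
    disjointly_linked e A [set s; x] -> s != x ->
  exists a a' U, [/\ a \in A, a' \in A, linked e U a s & linked e (~: U) a' x].
Proof.
case=> a [b [a' [b' [U [[aA bB a'A b'B] ab ab']]]]] sx.
have bb' : b != b'.
  by apply/eqP=> bb; have := linkedR ab'; rewrite -bb inE (linkedR ab).
move: bB b'B; rewrite !in_set2 => /pred2P[] bE /pred2P[] b'E; move: bb'; rewrite bE b'E ?eqxx // => _.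
  by exists a, a', U; rewrite -bE -b'E.
by exists a', a, (~: U); rewrite setCK -bE -b'E.
Qed.

Lemma disjointly_linked_pairl e B s x :
    disjointly_linked e [set s; x] B -> s != x ->
  exists b b' U, [/\ b \in B, b' \in B, linked e U s b & linked e (~: U) x b'].
Proof.
case=> a [b [a' [b' [U [[aA bB a'A b'B] ab ab']]]]] sx.
have bb' : a != a'.
  by apply/eqP=> bb; have := linkedL ab'; rewrite -bb inE (linkedL ab).
move: aA a'A; rewrite !in_set2 => /pred2P[] bE /pred2P[] b'E; move: bb'; rewrite bE b'E ?eqxx // => _.
  by exists b, b', U; rewrite -bE -b'E.
by exists b', b, (~: U); rewrite setCK -bE -b'E.
Qed.

(** Menger's theorem for two paths, by induction on the number of arrows.  If a
    node [s] separates [A] from [B] once the arrow [x -> y] is removed, then no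
    single node separates [A] from [{s, x}], or [{s, y}] from [B], without that
    arrow.  This gives two disjoint paths from [A] to [{s, x}] and two from
    [{s, y}] to [B]; since [s] separates, the former meet the latter only in
    [s], and the arrow joins the two that avoid [s]. *)
Theorem two_disjoint_paths (t0 : T) e A B : inseparable e A B -> disjointly_linked e A B.
Proof.
move: {2}#|[set a | e a.1 a.2]| (leqnn #|[set a | e a.1 a.2]|) => k.
elim: k e A B => [|k IH] e A B le_k insep.
  have noe a b : e a b = false.
    apply/negP=> eab; move: le_k; rewrite leqn0 cards_eq0 => /eqP/setP/(_ (a, b)).
    by rewrite !inE eab.
  have triv D a b : linked e D a b -> a = b.
    by case/linked_path=> -[|c p] [] //=; rewrite noe.
  have [a [b [aA bB /triv abE]]] := insep t0; subst b.
  have [a' [b [a'A bB' lab]]] := insep a; have abE := triv _ _ _ lab; subst b.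
  exists a, a, a', a', [set a]; split=> //; first by apply: linked_refl; rewrite inE.
have [[x y] /= exy|noe] := pickP [pred a | e a.1 a.2]; last first.
  apply: IH => //; rewrite (_ : [set a | _] = set0) ?cards0 //.
  by apply/setP=> a; rewrite !inE; apply: noe.
pose e' := [rel a b | e a b && ((a, b) != (x, y))].
have e'e D a b : linked e' D a b -> linked e D a b.
  by apply: linked_sub => // u v _ _ /andP[].
(* A path that uses the arrow is cut before its first and after its last use. *)
have cut_e D a b : linked e D a b -> linked e' D a b \/
    [/\ x \in D, y \in D, linked e' D a x & linked e' D y b].
  move=> /linked_path[p [pp <- _ sp]]; elim: p a pp sp => /= [|c p IHp] a.
    by move=> _ s; left; apply: linked_refl; rewrite s ?mem_head.
  case/andP=> eac pc s; have aD : a \in D by rewrite s ?mem_head.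
  have cD : c \in D by rewrite s // !inE eqxx orbT.
  have s' : {subset c :: p <= D} by move=> z zp; rewrite s // inE zp orbT.
  have [[ax cy]|ac] := eqVneq (a, c) (x, y).
    subst a c; right; case: (IHp _ pc s') => [yb|[_ _ _ yb]]; split=> //; exact: linked_refl.
  have e'ac : e' a c by rewrite /= eac.
  case: (IHp _ pc s') => [cb|[xD yD cx yb]]; [left|right; split=> //];
    by apply: linked_step e'ac _ _.
have le' : #|[set a | e' a.1 a.2]| <= k.
  rewrite -ltnS; apply: leq_trans le_k; apply: proper_card; apply/properP; split.
    by apply/fintype.subsetP=> a; rewrite !inE => /andP[].
  by exists (x, y); rewrite !inE //= eqxx andbF.
have [insep'|] := pselect (inseparable e' A B).
  have [a [b [a' [b' [U [mem /e'e ab /e'e ab']]]]]] := IH _ _ _ le' insep'.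
  by exists a, b, a', b', U.
move=> /existsNP[s sep].
have sepP a b : a \in A -> b \in B -> linked e' [set~ s] a b -> False.
  by move=> aA bB lab; apply: sep; exists a, b.
have [[xs ys] [[a0 [a0A a0x]] [b0 [b0B yb0]]]] : (x \in [set~ s] /\ y \in [set~ s]) /\
   (exists a, a \in A /\ linked e' [set~ s] a x) /\ (exists b, b \in B /\ linked e' [set~ s] y b).
  have [a [b [aA bB /cut_e[/(sepP _ _ aA bB)//|[xs ys ax yb]]]]] := insep s.
  by split=> //; split; [exists a | exists b].
have sx : s != x by move: xs; rewrite !inE eq_sym.
have sy : s != y by move: ys; rewrite !inE eq_sym.
have [a [a' [U [aA a'A as_ a'x]]]] : exists a a' U, [/\ a \in A, a' \in A,
    linked e' U a s & linked e' (~: U) a' x].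
  apply: disjointly_linked_pair sx; apply: IH le' _ => z.
  have [<-|zs] := eqVneq s z; first by exists a0, x; rewrite !inE eqxx orbT.
  have [a [b [aA bB /cut_e[ab|[_ _ ax _]]]]] := insep z; last first.
    by exists a, x; rewrite !inE eqxx orbT.
  exists a, s; rewrite !inE eqxx; split=> //.
  have [p [pp lp up sp]] := linked_path ab.
  have [sp'|sp'] := boolP (s \in a :: p); last first.
    case: (sepP a b aA bB); rewrite -lp; apply: path_linked => // c cp.
    by rewrite !inE; apply: contraNneq sp' => <-.
  have [V [_ [asV _ _ sV _]]] := path_split pp up sp'.
  by apply: linkedS asV => c /sV /sp.
have [b [b' [W [bB b'B sb yb']]]] : exists b b' U, [/\ b \in B, b' \in B,
    linked e' U s b & linked e' (~: U) y b'].
  apply: disjointly_linked_pairl sy; apply: IH le' _ => z.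
  have [<-|zs] := eqVneq s z; first by exists y, b0; rewrite !inE eqxx orbT.
  have [a1 [b [a1A bB /cut_e[ab|[_ _ _ yb]]]]] := insep z; last first.
    by exists y, b; rewrite !inE eqxx orbT.
  exists s, b; rewrite !inE eqxx; split=> //.
  have [p [pp lp up sp]] := linked_path ab.
  have [sp'|sp'] := boolP (s \in a1 :: p); last first.
    case: (sepP a1 b a1A bB); rewrite -lp; apply: path_linked => // c cp.
    by rewrite !inE; apply: contraNneq sp' => <-.
  have [_ [V [_ sbV _ _ sV]]] := path_split pp up sp'.
  by rewrite -lp; apply: linkedS sbV => c /sV /sp.
have [p1 [pp1 lp1 up1 sp1]] := linked_path as_.
have [p2 [pp2 lp2 up2 sp2]] := linked_path a'x.
have [q1 [pq1 lq1 uq1 sq1]] := linked_path sb.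
have [q2 [pq2 lq2 uq2 sq2]] := linked_path yb'.
have sU := linkedR as_; have sW := linkedL sb.
pose V := [set z in (a :: p1) ++ (s :: q1)].
have VC : {subset (a' :: p2) ++ (y :: q2) <= ~: V}.
  move=> z zpq; rewrite in_setC /V in_set mem_cat; apply/negP; move: zpq; rewrite mem_cat.
  move=> /orP[zp2|zq2] /orP[zp1|zq1].
  - by have := sp2 _ zp2; rewrite inE sp1.
  - have zU := sp2 _ zp2; have zs : s != z by apply: contraTneq zU => <-; rewrite inE sU.
    have [V1 [V2 [/linkedL sV1 zb V12 _ _]]] := path_split pq1 uq1 zq1.
    have [V3 [_ [a'z _ _ sV3 _]]] := path_split pp2 up2 zp2.
    apply: (sepP a' b) => //; apply: (@linked_trans _ _ z).
      apply: linkedS a'z => c /sV3 /sp2; rewrite !inE.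
      by apply: contraNneq => ->.
    rewrite -lq1; apply: linkedS zb => c cV2; rewrite !inE; apply: contraNneq zs => cs.
    by apply/eqP; apply: V12; rewrite // -cs.
  - have zW := sq2 _ zq2; have zs : s != z by apply: contraTneq zW => <-; rewrite inE sW.
    have [V1 [V2 [az /linkedR]]] := path_split pp1 up1 zp1.
    rewrite lp1 => sV2 V12 _ _.
    have [_ [V4 [_ zb _ _ sV4]]] := path_split pq2 uq2 zq2.
    apply: (sepP a b') => //; apply: (@linked_trans _ _ z).
      apply: linkedS az => c cV1; rewrite !inE; apply: contraNneq zs => cs.
      by apply/eqP; apply: V12; rewrite // -cs.
    rewrite -lq2; apply: linkedS zb => c /sV4 /sq2; rewrite !inE.
    by apply: contraNneq => ->.
  - by have := sq2 _ zq2; rewrite inE sq1.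
exists a, b, a', b', V; split=> //.
  apply: (@linked_trans _ _ s).
    rewrite -lp1; apply: path_linked; first by apply: sub_path pp1 => u v /andP[].
    by move=> z zp; rewrite in_set mem_cat zp.
  rewrite -lq1; apply: path_linked; first by apply: sub_path pq1 => u v /andP[].
  by move=> z zp; rewrite in_set mem_cat zp orbT.
apply: (@linked_trans _ _ x).
  rewrite -lp2; apply: path_linked; first by apply: sub_path pp2 => u v /andP[].
  by move=> z zp; apply: VC; rewrite mem_cat zp.
apply: (@linked_step _ _ _ y) => //.
  by apply: VC; rewrite mem_cat -lp2 mem_last.
rewrite -lq2; apply: path_linked; first by apply: sub_path pq2 => u v /andP[].
by move=> z zp; apply: VC; rewrite mem_cat zp orbT.
Qed.
End Linked.

(** * Permutations that avoid one entry of the Jacobian *)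

Section PrevPerm.
Variable T : finType.
Implicit Types (c p q : seq T) (x z : T).

Lemma prev_perm_exists c : uniq c -> exists s : {perm T}, s =1 prev c.
Proof.
move=> Uc; have inj : injective (prev c) by apply: can_inj (next_prev Uc).
by exists (perm inj) => x; rewrite permE.
Qed.

Lemma prev_notin c x : uniq c -> x \notin c -> prev c x = x.
Proof. by move=> Uc xc; rewrite prev_nth (negPf xc). Qed.

Lemma prev_cat x p z q : uniq (x :: p ++ z :: q) ->
  prev (x :: p ++ z :: q) z = last x p.
Proof.
move=> /cycle_prev; rewrite /path.cycle rcons_cat rcons_cons cat_path => /= /and3P[_ /eqP-> _].
by [].
Qed.

Lemma prev_head x p : uniq (x :: p) -> prev (x :: p) x = last x p.
Proof.
by move=> /cycle_prev; rewrite /path.cycle rcons_path => /andP[_ /eqP].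
Qed.

Lemma crossing_cat (A : {set T}) x p : x \notin A -> last x p \in A ->
  exists p1 z p2, [/\ p = p1 ++ z :: p2, last x p1 \notin A & z \in A].
Proof.
elim: p x => [|a p IH] x /= xA lA; first by rewrite lA in xA.
have [aA|aA] := boolP (a \in A); first by exists [::], a, p.
by have [p1 [z [p2 [-> ? ?]]]] := IH _ aA lA; exists (a :: p1), z, p2.
Qed.

End PrevPerm.

Section Configurations.
Variables (T : finType) (G : io_network T).
Local Notation e := (arrow G).
Local Notation inp := (inode G).
Local Notation out := (onode G).
Implicit Types (A U W : {set T}) (s : {perm T}).

(** The permutations that contribute to the cofactor of the Jacobian at row
    [inode G] and column [k]: a simple path from the input node to [k] together
    with disjoint cycles in its complement. *)
Definition configuration (k : T) s :=
  s inp = k /\ forall j, j != inp -> coupled G j (s j).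

(** The expansion of the cofactor has no cancellation between configurations, so
    this is the combinatorial form of the fact that the determinant on [A]
    divides the cofactor. *)
Definition config_invariant A k := forall s, configuration k s -> forall j, j \in A -> s j \in A.

(** Closing the path up by an arrow from its end to [inode G] and reversing it. *)
Lemma path_configuration p : path e inp p -> uniq (inp :: p) ->
  exists s, configuration (last inp p) s /\ s =1 prev (inp :: p).
Proof.
move=> pp up; have [s sE] := prev_perm_exists up; exists s; split=> //; split.
  by rewrite sE prev_head.
move=> j jinp; rewrite sE /coupled; have [jp|jp] := boolP (j \in inp :: p); last first.
  by rewrite prev_notin // eqxx.
move: jp; rewrite inE (negPf jinp) orFb => /splitPr jp.
case: jp pp up => p1 p2; rewrite cat_path => /and3P[_ ej _] up.
by rewrite prev_cat // ej orbT.
Qed.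

(** The configuration of the path through [t] leaves [A] where the path enters it. *)
Lemma invariant_avoids A k U W t : config_invariant A k -> inp \notin A -> t \in A ->
  linked e U inp t -> linked e W t k -> (forall z, z \in U -> z \in W -> z = t) -> False.
Proof.
move=> inv iA tA Ut Wk UW; have [p [q [pp lp lq up _]]] := linked_cat Ut Wk UW.
have [s [cs sE]] := path_configuration pp up.
rewrite last_cat lp lq in cs.
have [p1 [z [p2 [pE lA zA]]]] : exists p1 z p2, [/\ p = p1 ++ z :: p2, last inp p1 \notin A & z \in A].
  by apply: crossing_cat; rewrite ?lp.
move: (inv _ cs _ zA) lA; rewrite sE; move: up; rewrite pE -catA => up.
by rewrite prev_cat // => ->.
Qed.

(** A cycle in the complement of the path that leaves [A] would give a
    configuration, together with the path, that does not preserve [A]. *)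
Lemma invariant_component A k U W t x : config_invariant A k ->
  linked e U inp k -> (forall z, z \in U -> z \notin W) ->
  t \in A -> linked e W t x -> linked e W x t -> x \in A.
Proof.
move=> inv Uk UW tA tx xt; apply: contraT => xA.
have [p [pp lp up sp]] := linked_path Uk.
have [s0 [[s0i s0c] s0E]] := path_configuration pp up; rewrite lp in s0i.
have [z [q [cq uq sq zA lA]]] := crossing_cycle tA xA tx xt.
have [s1 s1E] := prev_perm_exists uq.
have dis y : y \in inp :: p -> y \notin z :: q.
  by move=> /sp /UW; apply: contra => /sq.
have s0in y : y \in inp :: p -> s0 y \in inp :: p by rewrite s0E mem_prev.
have s0out y : y \notin inp :: p -> s0 y = y by move=> yp; rewrite s0E prev_notin.
have s1out y : y \notin z :: q -> s1 y = y by move=> yp; rewrite s1E prev_notin.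
have zp : z \notin inp :: p by apply/negP => /dis; rewrite mem_head.
have conf : configuration k (s0 * s1)%g.
  split=> [|j ji]; first by rewrite permM s0i s1out // dis // -lp mem_last.
  rewrite permM; have [jp|jp] := boolP (j \in inp :: p).
    by rewrite s1out ?s0c // dis // s0in.
  rewrite s0out //; have [jq|jq] := boolP (j \in z :: q); last first.
    by rewrite s1out // /coupled eqxx.
  by rewrite s1E /coupled prev_cycle ?orbT.
have := inv _ conf z zA; rewrite permM s0out // s1E prev_head //.
by rewrite (negPf lA).
Qed.

Lemma iter_porbit_inj s x m m' : (0 < m <= #|porbit s x|)%N -> (0 < m' <= #|porbit s x|)%N ->
  iter m s x = iter m' s x -> m = m'.
Proof.
wlog le : m m' / (m <= m')%N.
  by move=> W; case/orP: (leq_total m m') => le *; [|symmetry]; apply: W.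
move=> /andP[m0 mk] /andP[m0' mk'] E.
have /eqP : nth x (traject s x #|porbit s x|) (m' - m) = nth x (traject s x #|porbit s x|) 0.
  have lt : (m' - m < #|porbit s x|)%N by apply: leq_trans mk'; rewrite ltn_subLR // -{1}[m']add0n ltn_add2r.
  rewrite !nth_traject //=; last by apply: leq_ltn_trans lt.
  apply: (@perm_inj _ (s ^+ m)%g); rewrite !permX -iterD subnKC //.
have lt : (m' - m < #|porbit s x|)%N by apply: leq_trans mk'; rewrite ltn_subLR // -{1}[m']add0n ltn_add2r.
rewrite nth_uniq ?size_traject ?uniq_traject_porbit //; last by apply: leq_ltn_trans lt.
by rewrite subn_eq0 => le'; apply/eqP; rewrite eqn_leq le.
Qed.

(** Conversely, the orbit of the input node under a configuration is a simple
    path from the input node to [k], run backwards. *)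
Lemma invariantI A k : inp \notin A ->
  (forall U W t, t \in A -> linked e U inp t -> linked e W t k ->
     (forall z, z \in U -> z \in W -> z = t) -> False) ->
  (forall U W t x, t \in A -> linked e U inp k -> (forall z, z \in U -> z \notin W) ->
     linked e W t x -> linked e W x t -> x \in A) ->
  config_invariant A k.
Proof.
move=> iA hit cyc s [sk sc] j jA; apply: contraT => sjA.
pose n := #|porbit s inp|.
have n0 : (0 < n)%N by rewrite lt0n card_porbit_neq0.
pose seg a b := [set iter (val m) s inp | m : 'I_n.+1 & (a <= m <= b)%N].
have itn m : (0 < m < n)%N -> iter m s inp != inp.
  move=> /andP[m0 mn]; apply/eqP => E.
  have E' : iter m s inp = iter n s inp by rewrite E iter_porbit.
  have := iter_porbit_inj _ _ E'; rewrite -/n leqnn n0 m0 (ltnW mn) => /(_ isT isT) mE.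
  by rewrite mE ltnn in mn.
have segP a b y : y \in seg a b -> exists m, [/\ (a <= m <= b)%N, (m <= n)%N & y = iter m s inp].
  by case/imsetP=> m; rewrite inE => lem ->; exists (val m); split=> //; exact: (ltn_ord m).
have mem_seg a b m : (m <= n)%N -> (a <= m <= b)%N -> iter m s inp \in seg a b.
  move=> mn lem; apply/imsetP; rewrite -ltnS in mn.
  by exists (Ordinal mn); rewrite ?inE.
have seg_linked a b : (0 < a)%N -> (b <= n)%N -> (a <= b)%N ->
    linked e (seg a b) (iter b s inp) (iter a s inp).
  move=> a0; elim: b => [|b IH] bn; first by rewrite leqNgt a0.
  rewrite leq_eqVlt => /predU1P[->|]; first by apply: linked_refl; apply: mem_seg; rewrite ?leqnn.
  rewrite ltnS => ab; have {}IH := IH (ltnW bn) ab.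
  have sub : {subset seg a b <= seg a b.+1}.
    by move=> y /segP[m [/andP[am mb] mn ->]]; apply: mem_seg; rewrite // am ltnW.
  have bi : iter b s inp != inp by apply: itn; rewrite (leq_trans a0 ab).
  have /orP[/eqP E|Eb] := sc _ bi; first by rewrite /= -E; apply: linkedS IH.
  apply: linked_step Eb _ (linkedS sub IH).
  by apply: (mem_seg _ _ b.+1); rewrite // leqnn (leq_trans ab) //.
have kE : iter 1 s inp = k by [].
have iE : iter n s inp = inp by rewrite iter_porbit.
have [jO|jO] := boolP (j \in porbit s inp).
  have [i [/andP[i0 ile] jE]] : exists i, (0 < i <= n)%N /\ j = iter i s inp.
    move: jO; rewrite porbit_traject => /trajectP[i ile ->].
    case: i ile => [|i] ile; last by exists i.+1; rewrite (ltnW ile).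
    by exists n; rewrite n0 leqnn iE.
  case: (hit (seg i n) (seg 1 i) j jA).
  - by have := seg_linked i n i0 (leqnn _) ile; rewrite iE -jE.
  - by have := seg_linked 1%N i isT ile i0; rewrite -jE kE.
  move=> z /segP[m [/andP[im _] mn zE]] /segP[m' [/andP[m0 m'i] m'n zE']].
  have mm : m = m' by apply: (@iter_porbit_inj s inp); rewrite ?m0 ?m'n ?mn ?(leq_trans i0) // -zE.
  by rewrite jE zE; congr (iter _ _ _); apply/eqP; rewrite eqn_leq im mm m'i.
have nin y m : y \notin porbit s inp -> iter m s y \notin porbit s inp.
  by move=> yO; rewrite -permX porbit_sym porbit_perm -porbit_sym.
have ninp y : y \notin porbit s inp -> y != inp.
  by apply: contraNneq => ->; rewrite porbit_id.
have back y m : y \notin porbit s inp -> linked e (~: porbit s inp) (iter m s y) y.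
  move=> yO; elim: m => [|m IH]; first by apply: linked_refl; rewrite inE.
  have /orP[/eqP E|Eb] := sc _ (ninp _ (nin _ m yO)); first by rewrite /= -E.
  by apply: linked_step Eb _ IH; rewrite inE (nin _ m.+1).
have sjO : s j \notin porbit s inp by apply: (nin _ 1).
case/negP: sjA; apply: (cyc (porbit s inp) (~: porbit s inp) j) => //.
- have := seg_linked 1%N n isT (leqnn _) n0; rewrite iE kE; apply: linkedS => y /segP[m [_ _ ->]].
  by rewrite -permX mem_porbit.
- by move=> z zO; rewrite inE zO.
- have jn : iter #|porbit s j|.-1 s (s j) = j by rewrite -iterSr prednK ?iter_porbit // lt0n card_porbit_neq0.
  by rewrite -{1}jn; apply: back.
- by apply: (back _ 1).
Qed.

End Configurations.

(** * Strongly connected components *)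

Section LinkedMore.
Variable T : finType.
Implicit Types (e : rel T) (D U W N A B : {set T}).

Lemma linked_between e D x y : linked e D x y ->
  linked e [set z | linked e D x z && linked e D z y] x y.
Proof.
move=> /linked_path[p [pp <- up sp]]; apply: path_linked => // z zp; rewrite inE.
have [U [W [xz zl _ sU sW]]] := path_split pp up zp.
by rewrite (linkedS _ xz) ?(linkedS _ zl) // => a; [move/sW/sp | move/sU/sp].
Qed.

Lemma linked_split e D s x y : linked e D x y -> ~~ linked e (D :\ s) x y ->
  exists U W, [/\ linked e U x s, linked e W s y,
    (forall a, a \in U -> a \in W -> a = s), {subset U <= D} & {subset W <= D}].
Proof.
move=> /linked_path[p [pp <- up sp]] nl.
have [sp'|sp'] := boolP (s \in x :: p).
  have [U [W [xz zl UW sU sW]]] := path_split pp up sp'.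
  by exists U, W; split=> // a; [move/sU/sp | move/sW/sp].
case/negP: nl; apply: path_linked => // z zp; rewrite in_setD1 sp // andbT.
by apply: contraNneq sp' => <-.
Qed.

Definition scc e D t := [set z | linked e D t z && linked e D z t].

Lemma scc_linked e D t x : x \in scc e D t ->
  linked e (scc e D t) t x /\ linked e (scc e D t) x t.
Proof.
rewrite inE => /andP[tx xt]; split.
  apply: linkedS (linked_between tx) => z; rewrite !inE => /andP[tz zx].
  by rewrite tz (linked_trans zx xt).
apply: linkedS (linked_between xt) => z; rewrite !inE => /andP[tz zx].
by rewrite zx (linked_trans tx tz).
Qed.

Lemma component_scc (G : io_network T) D t : t \in D -> component G D t = scc (arrow G) D t.
Proof.
move=> tD; apply/setP=> z; rewrite !inE /linked tD.
by case: (z \in D); rewrite ?andbF ?andbT.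
Qed.

End LinkedMore.

(** * Simple nodes *)

Section Nodes.
Variables (T : finType) (G : io_network T).
Local Notation e := (arrow G).
Local Notation inp := (inode G).
Local Notation out := (onode G).
Implicit Types (A U W D : {set T}).

Definition simple_nodes : {set T} := [set x | `[< simple_node G x >]].
Local Notation S := simple_nodes.
Local Notation N := (~: simple_nodes).
Definition super_appendage_nodes : {set T} := [set x | `[< super_appendage G x >]].

Lemma simple_nodesP x : reflect (simple_node G x) (x \in S).
Proof. by rewrite inE; apply: asboolP. Qed.

Lemma appendage_nodesP x : reflect (appendage_node G x) (x \in N).
Proof. by rewrite in_setC; apply: (iffP negP) => h /simple_nodesP. Qed.

Lemma super_appendage_nodesP x : reflect (super_appendage G x) (x \in super_appendage_nodes).
Proof. by rewrite inE; apply: asboolP. Qed.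

Lemma io_simple_path_linked p : io_simple_path G p -> linked e [set x in inp :: p] inp out.
Proof. by case/and3P=> pp /eqP <- up; apply: path_linked => // x; rewrite in_set. Qed.

Lemma linked_io_simple_path U : linked e U inp out ->
  exists p, io_simple_path G p /\ {subset inp :: p <= U}.
Proof.
by case/linked_path=> p [pp lp up sp]; exists p; rewrite /io_simple_path /simple_path pp lp up eqxx.
Qed.

Lemma io_simple_path_simple p : io_simple_path G p -> {subset inp :: p <= S}.
Proof. by move=> pp x xp; apply/simple_nodesP; exists p. Qed.

Lemma simple_split x : x \in S -> exists U W,
  [/\ linked e U inp x, linked e W x out, (forall a, a \in U -> a \in W -> a = x),
    {subset U <= S} & {subset W <= S}].
Proof.
case/simple_nodesP=> p pp xp; have sp := io_simple_path_simple pp.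
case/and3P: (pp) => pp' /eqP lp up; have [U [W [Ux xW UW sU sW]]] := path_split pp' up xp.
by exists U, W; rewrite -lp; split=> // a; [move/sU/sp | move/sW/sp].
Qed.

Lemma split_simple U W x : linked e U inp x -> linked e W x out ->
  (forall a, a \in U -> a \in W -> a = x) -> x \in S.
Proof.
move=> Ux xW UW; have [p [q [pp lp lq up _]]] := linked_cat Ux xW UW.
apply/simple_nodesP; exists (p ++ q).
  by rewrite /io_simple_path /simple_path pp last_cat lp lq eqxx.
by rewrite -lp -cat_cons mem_cat mem_last.
Qed.

Lemma super_simpleP r : super_simple G r <-> forall U, linked e U inp out -> r \in U.
Proof.
split=> [ssr U /linked_io_simple_path[p [/ssr rp sp]]|h p pp]; first exact: sp.
by have := h _ (io_simple_path_linked pp); rewrite in_set.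
Qed.

Section Positions.
Variable r : T.
Hypothesis ssr : super_simple G r.

Definition upstream_of x := linked e [set~ r] inp x.
Definition downstream_of x := linked e [set~ r] x out.

(** Otherwise a path from input to output would avoid [r]. *)
Lemma upstream_downstream x y : upstream_of x -> linked e [set~ r] x y -> ~~ downstream_of y.
Proof.
move=> ix xy; apply/negP=> yo; have /super_simpleP/(_ _ (linked_trans ix (linked_trans xy yo))) := ssr.
by rewrite !inE eqxx.
Qed.

Lemma upstream_not_downstream x : upstream_of x -> ~~ downstream_of x.
Proof. by move=> ix; apply: upstream_downstream (ix) (linked_refl _ (linkedR ix)). Qed.

Lemma simple_position x : x \in S ->
  [\/ x = r, linked e (S :\ r) inp x | linked e (S :\ r) x out].
Proof.
case/simple_split=> U [W [Ux xW UW sU sW]].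
have [->|xr] := eqVneq x r; first by constructor 1.
have [rU|rU] := boolP (r \in U).
  constructor 3; apply: linkedS xW => z zW; rewrite in_setD1 sW // andbT.
  by apply: contraNneq xr => zr; rewrite -zr (UW z) // zr.
constructor 2; apply: linkedS Ux => z zU; rewrite in_setD1 sU // andbT.
by apply: contraNneq rU => <-.
Qed.

Lemma in_simple_avoid z : z \in S :\ r -> z \in [set~ r].
Proof. by rewrite !inE => /andP[]. Qed.

End Positions.

Hypothesis coreG : core G.

Lemma core_in x : linked e setT inp x.
Proof.
have [/connectP[p pp ->] _] := coreG x; by apply: path_linked => // z _; rewrite in_setT.
Qed.

Lemma core_out x : linked e setT x out.
Proof.
have [_ /connectP[p pp ->]] := coreG x; by apply: path_linked => // z _; rewrite in_setT.
Qed.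

Lemma io_linked : linked e S inp out.
Proof.
have [p [pp _]] := linked_io_simple_path (core_in out).
by apply: linkedS (io_simple_path_linked pp) => x; rewrite in_set => /(io_simple_path_simple pp).
Qed.

Lemma inp_simple : inp \in S. Proof. exact: linkedL io_linked. Qed.
Lemma out_simple : out \in S. Proof. exact: linkedR io_linked. Qed.

Lemma super_simple_simple r : super_simple G r -> r \in S.
Proof. by move/super_simpleP; apply; apply: io_linked. Qed.

Lemma super_simple_cut r : r \in S -> ~~ linked e (S :\ r) inp out -> super_simple G r.
Proof.
move=> rS nl; apply/super_simpleP=> U /linked_io_simple_path[p [pp sp]].
apply/sp/negPn/negP=> rp; case/negP: nl; apply: linkedS (io_simple_path_linked pp).
move=> x; rewrite in_set => xp; rewrite in_setD1 (io_simple_path_simple pp xp) andbT.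
by apply: contraNneq rp => <-.
Qed.

Definition tail r := r |: [set z in S | linked e (S :\ r) z out].

Lemma tail_linked r : super_simple G r -> linked e (tail r) r out.
Proof.
move=> ssr; have rS := super_simple_simple ssr.
have [U [W [_ rW _ _ sW]]] := simple_split rS.
have [p [pp lp up sp]] := linked_path rW.
case: p pp lp up sp => [_ <- _ _|a p /= /andP[ra pa] lp /andP[rp _] sp].
  by apply: linked_refl; rewrite !inE eqxx.
have ao : linked e (S :\ r) a out.
  rewrite -lp; apply: path_linked => // z zp.
  have zS : z \in S by apply: sW; apply: sp; rewrite in_cons zp orbT.
  rewrite in_setD1 zS andbT.
  by apply: contraNneq rp => <-.
have ao' : linked e (tail r) a out.
  apply: linkedS (linked_between ao) => z; rewrite !inE => /andP[/linkedR zS ->].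
  by move: zS; rewrite !inE => /andP[_ ->]; rewrite orbT.
by apply: linked_step ra _ ao'; rewrite !inE eqxx.
Qed.

Lemma tailP r z : z \in tail r -> z = r \/ z \in S /\ downstream_of r z.
Proof.
rewrite in_setU1 in_set => /predU1P[->|/andP[zS zo]]; first by left.
by right; split=> //; apply: linkedS zo; apply: in_simple_avoid.
Qed.

(** * Appendage subnetworks *)

(** The two nodes have the same transitive component outside every simple path
    from input to output, since these paths avoid the cycle. *)
Lemma super_appendage_cycle t x : super_appendage G t ->
  linked e N t x -> linked e N x t -> super_appendage G x.
Proof.
case=> tN ht tx xt; split; first by apply/appendage_nodesP; apply: linkedR tx.
move=> p pp xp y.
have NC z : z \in N -> z \in complementary G p.
  by rewrite !in_set; apply: contra => zp; apply/asboolP; exists p.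
have tC := NC _ (linkedL tx).
rewrite component_scc // inE => /andP[xy yx]; apply: (ht p pp tC).
rewrite component_scc // inE.
by rewrite (linked_trans (linkedS NC tx) xy) (linked_trans yx (linkedS NC xt)).
Qed.

Section AppendageSubnetwork.
Variable A : {set T}.
Hypothesis hA : appendage_subnetwork G A.

Lemma appendage_subnetwork_scc :
  exists t, t \in super_appendage_nodes /\ A = scc e super_appendage_nodes t.
Proof.
case: hA => t ht ->; exists t; have tS : t \in super_appendage_nodes by rewrite inE; apply/asboolP.
by rewrite -component_scc.
Qed.

Lemma appendage_subnetwork_super x : x \in A -> super_appendage G x.
Proof.
case: appendage_subnetwork_scc => t [tS ->]; rewrite inE => /andP[/linkedR h _].
exact/super_appendage_nodesP.
Qed.

Lemma appendage_subnetwork_sub x : x \in A -> x \in N.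
Proof. by case/appendage_subnetwork_super => ? _; apply/appendage_nodesP. Qed.

Lemma appendage_subnetwork_neq0 : exists t, t \in A.
Proof.
case: appendage_subnetwork_scc => t [tS ->]; exists t.
by rewrite inE !linked_refl.
Qed.

Lemma appendage_subnetwork_linked x y : x \in A -> y \in A -> linked e A x y.
Proof.
case: appendage_subnetwork_scc => t [tS ->] /scc_linked[_ xt] /scc_linked[ty _].
exact: linked_trans xt ty.
Qed.

Lemma appendage_subnetwork_max t x : t \in A -> linked e super_appendage_nodes t x ->
  linked e super_appendage_nodes x t -> x \in A.
Proof.
case: appendage_subnetwork_scc => u [uS ->]; rewrite !inE => /andP[ut tu] tx xt.
by rewrite (linked_trans ut tx) (linked_trans xt tu).
Qed.

(** The transitive component of [t] outside the path consists of appendage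
    nodes, which are super-appendage by [super_appendage_cycle] and therefore
    belong to [A]. *)
Lemma appendage_subnetwork_closed U W t x : linked e U inp out ->
  (forall z, z \in U -> z \notin W) -> t \in A -> linked e W t x -> linked e W x t -> x \in A.
Proof.
move=> /linked_io_simple_path[p [pp sp]] UW tA tx xt.
have [_ ht] := appendage_subnetwork_super tA.
have WC z : z \in W -> z \in complementary G p.
  by rewrite in_set; apply: contraL => /sp /UW.
have tC := WC _ (linkedL tx).
have sccN : {subset scc e (complementary G p) t <= N}.
  by move=> z; rewrite -component_scc // => /(ht p pp tC)/appendage_nodesP.
have xs : x \in scc e (complementary G p) t.
  by rewrite inE (linkedS WC tx) (linkedS WC xt).
have [tx' xt'] := scc_linked xs.
have sccS : {subset scc e (complementary G p) t <= super_appendage_nodes}.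
  move=> z /scc_linked[tz zt]; apply/super_appendage_nodesP.
  apply: (@super_appendage_cycle t) (linkedS sccN tz) (linkedS sccN zt).
  exact: appendage_subnetwork_super.
exact: appendage_subnetwork_max tA (linkedS sccS tx') (linkedS sccS xt').
Qed.

Lemma appendage_cycle t x : t \in A -> linked e N t x -> linked e N x t -> x \in A.
Proof.
by apply: appendage_subnetwork_closed io_linked _ => z zS; rewrite inE zS.
Qed.

Lemma appendage_subnetwork_inp : inp \notin A.
Proof. by apply/negP=> /appendage_subnetwork_sub; rewrite inE inp_simple. Qed.

Lemma appendage_subnetwork_invariant : config_invariant G A out.
Proof.
apply: invariantI; first exact: appendage_subnetwork_inp.
  move=> U W t /appendage_subnetwork_sub tN Ut tW UW.
  by move: tN; rewrite inE (split_simple Ut tW UW).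
move=> U W t x tA Uo UW; exact: appendage_subnetwork_closed Uo UW tA.
Qed.

(** * Entries and exits of an appendage subnetwork *)

Definition entry_node s := s \in S /\ exists z t, [/\ e s z, linked e N z t & t \in A].
Definition exit_node s := s \in S /\ exists z t, [/\ t \in A, linked e N t z & e z s].

Lemma entry_last D s t : s \in S -> linked e D s t -> t \in A ->
  exists s', [/\ linked e D s s', linked e D s' t & entry_node s'].
Proof.
move=> sS st tA; have sN : s \notin N by rewrite inE negbK.
have [w [z [sw wN ewz zt]]] := linked_enter st sN (appendage_subnetwork_sub tA).
have sub a : a \in D :&: N -> a \in D by rewrite inE => /andP[].
exists w; split=> //; first by apply: linked_step ewz (linkedR sw) (linkedS sub zt).
split; first by move: wN; rewrite inE negbK.
by exists z, t; split=> //; apply: linkedS zt => a; rewrite inE => /andP[].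
Qed.

Lemma exit_first D t s : s \in S -> linked e D t s -> t \in A ->
  exists s', [/\ linked e D t s', linked e D s' s & exit_node s'].
Proof.
move=> sS ts tA; have sN : s \notin N by rewrite inE negbK.
have [z [w [tz ezw wN ws]]] := linked_exit ts (appendage_subnetwork_sub tA) sN.
have sub a : a \in D :&: N -> a \in D by rewrite inE => /andP[].
exists w; split=> //; first by apply: linked_rstep (linkedS sub tz) ezw (linkedL ws).
split; first by move: wN; rewrite inE negbK.
by exists z, t; split=> //; apply: linkedS tz => a; rewrite inE => /andP[].
Qed.

Lemma entry_exists : exists s, entry_node s.
Proof.
have [t tA] := appendage_subnetwork_neq0.
by have [s [_ _ ?]] := entry_last inp_simple (core_in t) tA; exists s.
Qed.

Lemma exit_exists : exists s, exit_node s.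
Proof.
have [t tA] := appendage_subnetwork_neq0.
by have [s [_ _ ?]] := exit_first out_simple (core_out t) tA; exists s.
Qed.

Definition leading_to : {set T} := [set z | [exists t in A, linked e N z t]].
Definition reached_from : {set T} := [set z | [exists t in A, linked e N t z]].

Lemma leading_toP z : reflect (exists2 t, t \in A & linked e N z t) (z \in leading_to).
Proof. by rewrite inE; apply: exists_inP. Qed.

Lemma reached_fromP z : reflect (exists2 t, t \in A & linked e N t z) (z \in reached_from).
Proof. by rewrite inE; apply: exists_inP. Qed.

Lemma appendage_linked x y : x \in A -> y \in A -> linked e N x y.
Proof. by move=> xA yA; apply: linkedS (appendage_subnetwork_linked xA yA); exact: appendage_subnetwork_sub. Qed.

Lemma leading_reached z : z \in leading_to -> z \in reached_from -> z \in A.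
Proof.
case/leading_toP=> t tA zt; case/reached_fromP=> t' t'A tz.
exact: appendage_cycle t'A tz (linked_trans zt (appendage_linked tA t'A)).
Qed.

Lemma leading_to_sub z : z \in leading_to -> z \in N.
Proof. by case/leading_toP=> t _ /linkedL. Qed.

Lemma reached_from_sub z : z \in reached_from -> z \in N.
Proof. by case/reached_fromP=> t _ /linkedR. Qed.

Lemma reached_from_self z : z \in A -> z \in reached_from.
Proof. by move=> zA; apply/reached_fromP; exists z; rewrite // linked_refl // appendage_subnetwork_sub. Qed.

Lemma reached_from_linked t z : t \in A -> z \in reached_from -> linked e reached_from t z.
Proof.
move=> tA /reached_fromP[t' t'A t'z].
have /linked_between tz := linked_trans (appendage_linked tA t'A) t'z.
apply: linkedS tz => a; rewrite [a \in _]inE => /andP[ta _]; by apply/reached_fromP; exists t.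
Qed.

(** Stopping where [A] is met for the first time keeps the stretch disjoint from
    the appendage nodes reached from [A], by [leading_reached]. *)
Lemma entry_stretch s : entry_node s ->
  exists2 t, t \in A & linked e (t |: (s |: (leading_to :\: A))) s t.
Proof.
case=> sS [z [t [esz zt tA]]].
have [zA|zA] := boolP (z \in A).
  by exists z => //; apply: linked_edge; rewrite // !inE eqxx ?orbT.
have [y [w [zy eyw wA _]]] : exists y w, [/\ linked e (N :&: ~: A) z y, e y w, w \notin ~: A & linked e N w t].
  by apply: linked_exit zt _ _; rewrite inE ?negbK.
rewrite inE negbK in wA; exists w => //.
have wN := appendage_subnetwork_sub wA.
apply: (@linked_step _ _ _ _ z) => //; first by rewrite !inE eqxx orbT.
apply: linked_rstep (eyw) _; last by rewrite !inE eqxx.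
apply: linkedS (linked_between zy) => a; rewrite [a \in _]inE => /andP[/linkedR aNA ay].
move: aNA; rewrite inE [a \in ~: A]inE => /andP[aN aA].
rewrite 2!in_setU1 in_setD aA; apply/or3P; constructor 3; apply/leading_toP; exists w => //.
by apply: linked_rstep eyw _ => //; apply: linkedS ay => b; rewrite inE => /andP[].
Qed.

Lemma exit_stretch t s : t \in A -> exit_node s -> linked e (s |: reached_from) t s.
Proof.
move=> tA [sS [z [t' [t'A t'z ezs]]]].
apply: linked_rstep ezs _; last by rewrite !inE eqxx.
apply: linkedS (reached_from_linked tA _); last by apply/reached_fromP; exists t'.
by move=> a aR; rewrite in_setU1 aR orbT.
Qed.

(** The two paths and the stretches between them and [A] would form a simple path
    from input to output through [A]. *)
Lemma no_bypass s0 s1 U W : entry_node s0 -> exit_node s1 ->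
  {subset U <= S} -> {subset W <= S} -> (forall z, z \in U -> z \notin W) ->
  linked e U inp s0 -> linked e W s1 out -> False.
Proof.
move=> en ex sU sW UW Us0 s1W; have [t tA s0t] := entry_stretch en.
have tN := appendage_subnetwork_sub tA.
have := exit_stretch tA ex => ts1.
have : t \in S; last by move: tN; rewrite in_setC => /negP.
apply: (@split_simple (U :|: (t |: (leading_to :\: A))) (reached_from :|: W)).
- apply: (@linked_trans _ _ _ s0); first by apply: linkedS Us0 => a aU; rewrite inE aU.
  apply: linkedS s0t => a; rewrite 2!in_setU1 in_setU in_setU1.
  by case/or3P=> [->|/eqP->|->]; rewrite ?orbT // (linkedR Us0).
- apply: (@linked_trans _ _ _ s1); last by apply: linkedS s1W => a aU; rewrite inE aU orbT.
  apply: linkedS ts1 => a; rewrite in_setU1 in_setU => /predU1P[->|->//].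
  by rewrite (linkedL s1W) orbT.
move=> a; rewrite !in_setU in_set1 in_setD => /or3P[aU|/eqP //|/andP[aA al]] /orP[ar|aW].
- by have := reached_from_sub ar; rewrite inE sU.
- by have := UW _ aU; rewrite aW.
- by rewrite (leading_reached al ar) in aA.
- by have := leading_to_sub al; rewrite inE sW.
Qed.

(** The path from exit to entry and the stretches between them and [A] would
    close a cycle that leaves [A] and avoids [U]. *)
Lemma no_detour s0 s1 U W k : config_invariant G A k -> linked e U inp k ->
  {subset W <= S} -> (forall z, z \in U -> z \notin W) ->
  (forall z, z \in U -> z \notin leading_to :|: reached_from) ->
  entry_node s0 -> exit_node s1 -> linked e W s1 s0 -> False.
Proof.
move=> inv Uk sW UW UN en ex s10.
have [t tA s0t] := entry_stretch en; have ts1 := exit_stretch tA ex.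
have s1A : s1 \in A; last by have := appendage_subnetwork_sub s1A; rewrite inE; case: ex => ->.
have UR z : z \in U -> z \notin W :|: (leading_to :|: reached_from).
  by move=> zU; rewrite in_setU negb_or UW // UN.
have tR : t \in reached_from by apply: reached_from_self.
apply: (invariant_component inv Uk UR tA).
  apply: linkedS ts1 => a; rewrite in_setU1 !in_setU => /predU1P[->|->]; rewrite ?orbT //.
  by rewrite (linkedL s10).
apply: (@linked_trans _ _ _ s0); first by apply: linkedS s10 => a aW; rewrite in_setU aW.
apply: linkedS s0t => a; rewrite 2!in_setU1 !in_setU in_setD.
case/or3P => [/eqP->|/eqP->|/andP[_ ->]]; rewrite ?orbT //; first by rewrite tR !orbT.
by rewrite (linkedR s10).
Qed.

End AppendageSubnetwork.
End Nodes.

(** * Super-simple nodes between two appendage subnetworks *)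

Section TwoSubnetworks.
Variables (T : finType) (G : io_network T).
Local Notation e := (arrow G).
Local Notation inp := (inode G).
Local Notation out := (onode G).
Local Notation S := (simple_nodes G).
Local Notation N := (~: simple_nodes G).
Implicit Types (A U W D : {set T}).

Lemma linked_restrict D U x y : linked (restrict e D) U x y -> x \in D ->
  linked e (U :&: D) x y.
Proof.
move=> /linked_path[p [pp <- _ pU]] xD; elim: p x xD pp pU => [|a p IH] x xD /=.
  by move=> _ s; apply: linked_refl; rewrite inE xD s ?mem_head.
case/andP=> /and3P[xa _ aD] pa s.
apply: (@linked_step _ _ _ _ a) => //; first by rewrite inE xD s ?mem_head.
by apply: IH => // z zp; rewrite s // inE zp orbT.
Qed.

Definition separates x s b1 b2 := forall a b,
  a \in [set inp; s] -> b \in [set b1; b2] -> ~~ linked e (S :\ x) a b.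

(** [two_disjoint_paths] among the simple nodes: the two sources have to be joined
    to the two targets in one of the two possible ways. *)
Lemma separatesI s b1 b2 : inp \in S -> s \in S ->
  (forall U W, {subset U <= S} -> {subset W <= S} -> (forall z, z \in U -> z \notin W) ->
     linked e U inp b1 -> linked e W s b2 -> False) ->
  (forall U W, {subset U <= S} -> {subset W <= S} -> (forall z, z \in U -> z \notin W) ->
     linked e U inp b2 -> linked e W s b1 -> False) ->
  exists x, separates x s b1 b2.
Proof.
move=> iS sS no12 no21; apply: contrapT => /forallNP nsep.
have insep : inseparable (restrict e S) [set inp; s] [set b1; b2].
  move=> x; have := nsep x; rewrite /separates => h; apply: contrapT => nh; apply: h => a b aA bB.
  apply/negP=> l; apply: nh; exists a, b; split=> //.
  apply: linked_sub l => [u v|u]; last by rewrite !inE => /andP[].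
  by rewrite !in_setD1 => /andP[_ uS] /andP[_ vS] euv; apply/and3P.
have [a [b [a' [b' [U [[aA bB a'A b'B] ab ab']]]]]] := two_disjoint_paths inp insep.
have aS : a \in S by move: aA; rewrite in_set2 => /pred2P[]->.
have a'S : a' \in S by move: a'A; rewrite in_set2 => /pred2P[]->.
have neA : a != a'.
  by apply/eqP=> aE; have := linkedL ab'; rewrite -aE inE (linkedL ab).
have neB : b != b'.
  by apply/eqP=> bE; have := linkedR ab'; rewrite -bE inE (linkedR ab).
have l := linked_restrict ab aS; have l' := linked_restrict ab' a'S.
have sub V : {subset V :&: S <= S} by move=> z; rewrite inE => /andP[].
have dis z : z \in U :&: S -> z \notin ~: U :&: S by rewrite !inE => /andP[->].
have dis' z : z \in ~: U :&: S -> z \notin U :&: S.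
  by rewrite !in_setI in_setC => /andP[/negPf->].
move: aA a'A bB b'B; rewrite !in_set2.
move=> /pred2P[] aE /pred2P[] a'E; rewrite aE a'E ?eqxx // in neA l l' *;
move=> /pred2P[] bE /pred2P[] b'E; rewrite bE b'E ?eqxx // in neB l l' *.
- exact: no12 (sub _) (sub _) dis l l'.
- exact: no21 (sub _) (sub _) dis l l'.
- exact: no21 (sub _) (sub _) dis' l' l.
- exact: no12 (sub _) (sub _) dis' l' l.
Qed.

Hypothesis coreG : core G.
Let iS := inp_simple coreG.

(** The separator meets every simple path from input to output.  Such a path
    through [s1] does not meet it before [s1], nor one through [s2] after [s2]. *)
Lemma separates_super_simple x s1 s2 : s1 \in S -> s2 \in S ->
  separates x s1 out s2 -> [/\ super_simple G x, s1 = x \/ upstream_of G x s1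
     & s2 = x \/ downstream_of G x s2].
Proof.
move=> s1S s2S sep; have sii a : a \in [set inp; a] by rewrite !inE eqxx orbT.
have isi a : inp \in [set inp; a] by rewrite !inE eqxx.
have oso a : out \in [set out; a] by rewrite !inE eqxx.
have nio := sep _ _ (isi s1) (oso s2).
have xS : x \in S.
  apply: contraT => xS; case/negP: nio; apply: linkedS (io_linked coreG) => z zS.
  by rewrite in_setD1 zS andbT; apply: contraNneq xS => <-.
have ssx := super_simple_cut xS nio; split=> //.
- case: (simple_position x s1S) => [|l|]; [by left | right | by rewrite (negPf (sep _ _ (sii _) (oso _)))].
  by apply: linkedS l; apply: in_simple_avoid.
- case: (simple_position x s2S) => [|| l]; [by left | | right]; last by apply: linkedS l; apply: in_simple_avoid.
  by rewrite (negPf (sep _ _ (isi _) _)) // !inE eqxx orbT.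
Qed.

(** Two disjoint paths would make a node of [A] simple, or form a simple path from
    input to output and a cycle in its complement that leaves [A]. *)
Lemma exit_entry_separator A s0 s1 : appendage_subnetwork G A ->
  entry_node G A s0 -> exit_node G A s1 -> exists x, separates x s1 out s0.
Proof.
move=> hA en ex; have s1S : s1 \in S by case: ex.
apply: separatesI => // U W sU sW UW.
  move=> Uo s10; apply: (no_detour hA (appendage_subnetwork_invariant coreG hA) Uo sW UW _ en ex s10).
  move=> z /sU zS; rewrite in_setU negb_or; apply/andP; split; apply/negP.
    by move/(leading_to_sub); rewrite in_setC zS.
  by move/(reached_from_sub); rewrite in_setC zS.
exact: (no_bypass coreG hA en ex sU sW UW).
Qed.

Section Induction.
Variables Ai Aj : {set T}.
Hypotheses (hAi : appendage_subnetwork G Ai) (hAj : appendage_subnetwork G Aj).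

Section Necessary.
Hypothesis inv : forall k, k \in Aj -> config_invariant G Ai k.

(** Otherwise a simple path from the input node could traverse [Ai] on its way to
    [k]. *)
Lemma no_appendage_path t k : t \in Ai -> k \in Aj -> ~ linked e N t k.
Proof.
move=> tA kA tk; have [s0 en] := entry_exists coreG hAi.
have [U [_ [Us0 _ _ sU _]]] := simple_split (proj1 en).
have [u uA s0u] := entry_stretch hAi en.
apply: (@invariant_avoids _ G Ai k (U :|: (u |: (leading_to G Ai :\: Ai))) (reached_from G Ai) u).
- exact: inv.
- exact: appendage_subnetwork_inp coreG _ hAi.
- exact: uA.
- apply: (@linked_trans _ _ _ s0); first by apply: linkedS Us0 => a aU; rewrite inE aU.
  apply: linkedS s0u => a; rewrite 2!in_setU1 in_setU in_setU1.
  by case/or3P=> [->|/eqP->|->]; rewrite ?orbT // (linkedR Us0).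
- by apply: (reached_from_linked hAi) => //; apply/reached_fromP; exists t.
move=> a; rewrite in_setU in_setU1 in_setD => /or3P[/sU aS|/eqP//|/andP[aA al]] ar.
  by have := reached_from_sub ar; rewrite inE aS.
by rewrite (leading_reached coreG hAi al ar) in aA.
Qed.

(** Two disjoint paths would extend, by the entry [s2] of [Aj], to a simple path
    from input to [k] that traverses [Ai], or that is disjoint from a cycle
    leaving [Ai]. *)
Lemma entry_separator s0 s1 s2 : entry_node G Ai s0 -> exit_node G Ai s1 ->
  entry_node G Aj s2 -> ~ entry_node G Ai s2 -> exists x, separates x s1 s0 s2.
Proof.
move=> en ex [s2S [z [k [es2 zk kA]]]] nen.
pose E := [set v | linked e N z v && linked e N v k].
have zE : z \in E by rewrite inE zk linked_refl ?(linkedL zk).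
have s2k U : s2 \in U -> linked e (U :|: E) s2 k.
  move=> s2U; apply: (@linked_step _ _ _ _ z) => //; first by rewrite inE s2U.
  by apply: linkedS (linked_between zk) => a aE; rewrite in_setU aE orbT.
have EN v : v \in E -> v \in N by rewrite [v \in E]inE => /andP[/linkedR].
have El v : v \in E -> v \notin leading_to G Ai.
  rewrite [v \in E]inE => /andP[zv _]; apply/negP=> /leading_toP[t tA vt].
  by apply: nen; split=> //; exists z, t; split=> //; apply: linked_trans vt.
have Er v : v \in E -> v \notin reached_from G Ai.
  rewrite [v \in E]inE => /andP[_ vk]; apply/negP=> /reached_fromP[t tA tv].
  exact: (no_appendage_path tA kA (linked_trans tv vk)).
have Nlr a : a \in S -> a \notin leading_to G Ai :|: reached_from G Ai.
  move=> aS; rewrite in_setU negb_or; apply/andP; split; apply/negP.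
    by move/(leading_to_sub); rewrite inE aS.
  by move/(reached_from_sub); rewrite inE aS.
have NS a : a \in S -> a \notin E by move=> aS; apply/negP=> /EN; rewrite inE aS.
have s1S : s1 \in S by case: ex.
apply: separatesI => // U W sU sW UW.
  move=> Us0 s1W; have [t tA s0t] := entry_stretch hAi en.
  have ts1 := exit_stretch hAi tA ex.
  apply: (@invariant_avoids _ G Ai k (U :|: (t |: (leading_to G Ai :\: Ai))) 
    (reached_from G Ai :|: (W :|: E)) t).
  - exact: inv.
  - exact: appendage_subnetwork_inp coreG _ hAi.
  - exact: tA.
  - apply: (@linked_trans _ _ _ s0); first by apply: linkedS Us0 => a aU; rewrite inE aU.
    apply: linkedS s0t => a; rewrite 2!in_setU1 in_setU in_setU1.
    by case/or3P=> [->|/eqP->|->]; rewrite ?orbT // (linkedR Us0).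
  - apply: (@linked_trans _ _ _ s1).
      apply: linkedS ts1 => a; rewrite in_setU1 2!in_setU => /predU1P[->|->//].
      by rewrite (linkedL s1W) orbT.
    apply: (@linked_trans _ _ _ s2).
      by apply: linkedS s1W => a aW; rewrite !in_setU aW orbT.
    by apply: linkedS (s2k _ (linkedR s1W)) => a aW; rewrite in_setU aW orbT.
  move=> a; rewrite !in_setU in_set1 in_setD => /or3P[aU|/eqP //|/andP[aA al]] /or3P[ar|aW|aE].
  - by have := Nlr _ (sU _ aU); rewrite in_setU ar orbT.
  - by have := UW _ aU; rewrite aW.
  - by have := NS _ (sU _ aU); rewrite aE.
  - by rewrite (leading_reached coreG hAi al ar) in aA.
  - by have := Nlr _ (sW _ aW); rewrite in_setU al.
  - by have := El _ aE; rewrite al.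
move=> Us2 s10; have U'k : linked e (U :|: E) inp k.
  by apply: linked_trans (s2k _ (linkedR Us2)); apply: linkedS Us2 => a aU; rewrite inE aU.
apply: (no_detour hAi (inv kA) U'k sW _ _ en ex s10) => a; rewrite in_setU => /orP[aU|aE].
- exact: UW.
- by apply/negP=> /sW; apply/negP; have := EN _ aE; rewrite inE.
- exact: Nlr (sU _ aU).
- by rewrite in_setU negb_or El ?Er.
Qed.

(** If [s2] is not itself an entry of [Ai], take an entry [s0].  By
    [exit_entry_separator] and [entry_separator], nodes [x] and [y] separate the
    sources from [{out, s0}] and from [{s0, s2}].  If neither separates them from
    [{out, s2}], then [x] and [y] would precede each other on the way to [s0]. *)
Lemma super_simple_between s1 s2 : exit_node G Ai s1 -> entry_node G Aj s2 ->
  exists r, [/\ super_simple G r, s1 = r \/ upstream_of G r s1 & s2 = r \/ downstream_of G r s2].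
Proof.
move=> ex en2; have s1S : s1 \in S by case: ex.
have s2S : s2 \in S by case: en2.
suff [r sep] : exists x, separates x s1 out s2 by exists r; apply: separates_super_simple.
have [en|nen] := pselect (entry_node G Ai s2); first exact: (exit_entry_separator hAi en ex).
have [s0 en0] := entry_exists coreG hAi; have s0S : s0 \in S by case: en0.
have [x sepx] := exit_entry_separator hAi en0 ex.
have [y sepy] := entry_separator en0 ex en2 nen.
apply: contrapT => /forallNP nsep.
have [a' [a'A a'o]] : exists a', a' \in [set inp; s1] /\ linked e (S :\ y) a' out.
  apply: contrapT => h; apply: (nsep y) => a b aA; rewrite in_set2 => /pred2P[]->.
    by apply/negP=> l; apply: h; exists a.
  by apply: sepy; rewrite // !inE eqxx orbT.
have [a [aA as2]] : exists a, a \in [set inp; s1] /\ linked e (S :\ x) a s2.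
  apply: contrapT => h; apply: (nsep x) => a b aA; rewrite in_set2 => /pred2P[]->; last first.
    by apply/negP=> l; apply: h; exists a.
  by apply: sepx; rewrite // !inE eqxx.
have ois : out \in [set out; s0] by rewrite !inE eqxx.
have s0is : s0 \in [set out; s0] by rewrite !inE eqxx orbT.
have s0is' : s0 \in [set s0; s2] by rewrite !inE eqxx.
have s2is : s2 \in [set s0; s2] by rewrite !inE eqxx orbT.
have iis : inp \in [set inp; s1] by rewrite !inE eqxx.
have ay : linked e (S :\ x) a y.
  have nl : ~~ linked e ((S :\ x) :\ y) a s2.
    apply: contra (sepy _ _ aA s2is); apply: linkedS => z.
    by rewrite !in_setD1 => /and3P[-> _ ->].
  by have [U [_ [Uy _ _ sU _]]] := linked_split as2 nl; apply: linkedS Uy.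
have yx : y != x by have := linkedR ay; rewrite in_setD1 => /andP[].
have [V [_ [is0 _ _ sV _]]] := simple_split s0S.
have nl : ~~ linked e (S :\ y) inp s0 by apply: sepy.
have [_ [W [_ ys0 _ _ sW]]] := linked_split (linkedS sV is0) nl.
have nlx : ~~ linked e (W :\ x) y s0.
  apply: contra (sepx _ _ aA s0is) => l; apply: linked_trans ay _.
  by apply: linkedS l => z; rewrite !in_setD1 => /andP[-> /sW].
have [U1 [W1 [yx1 x1s0 meet _ sW1]]] := linked_split ys0 nlx.
have xs0 : linked e (S :\ y) x s0.
  apply: linkedS x1s0 => z zW; rewrite in_setD1 sW ?sW1 // andbT.
  by apply: contraNneq yx => zy; rewrite -(meet y) ?(linkedL yx1) // -zy.
have nlo : ~~ linked e ((S :\ y) :\ x) a' out.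
  apply: contra (sepx _ _ a'A ois); apply: linkedS => z.
  by rewrite !in_setD1 => /and3P[-> _ ->].
have [U2 [_ [a'x _ _ sU2 _]]] := linked_split a'o nlo.
have := sepy _ _ a'A s0is'; rewrite (linked_trans (linkedS sU2 a'x) xs0) //.
Qed.

End Necessary.

Section Sufficient.
Variable r : T.
Hypotheses (ssr : super_simple G r)
  (exits : forall s, exit_node G Ai s -> s = r \/ upstream_of G r s)
  (entries : forall s, entry_node G Aj s -> s = r \/ downstream_of G r s)
  (unlinked : forall t k, t \in Ai -> k \in Aj -> ~ linked e (super_appendage_nodes G) t k).

Let rS := super_simple_simple coreG ssr.

Lemma exit_entry_crosses D s s' : exit_node G Ai s -> entry_node G Aj s' ->
  linked e D s s' -> ~~ linked e (D :\ r) s s'.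
Proof.
move=> /exits ex /entries en ss'; apply/negP=> l.
have avoid z : z \in D :\ r -> z \in [set~ r] by rewrite !inE => /andP[].
have := linkedL l; have := linkedR l; rewrite !in_setD1 => /andP[s'r _] /andP[sr _].
case: ex => [sE|us]; first by rewrite sE eqxx in sr.
case: en => [sE|ds]; first by rewrite sE eqxx in s'r.
by have := upstream_downstream ssr us (linkedS avoid l); rewrite ds.
Qed.

(** A non-super-appendage node on the path would be linked to simple nodes on
    both sides of [r] by paths that avoid [r]. *)
Lemma no_appendage_path_of_cut t k : t \in Ai -> k \in Aj -> ~ linked e N t k.
Proof.
move=> tA kA tk; apply: (unlinked tA kA); apply: linkedS (linked_between tk) => v.
rewrite [v \in _]inE => /andP[tv vk]; apply/super_appendage_nodesP.
apply: contrapT => nsv; have vN := linkedR tv.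
have {nsv} : exists p, [/\ io_simple_path G p, v \in complementary G p &
    exists2 s, s \in component G (complementary G p) v & s \in S].
  apply: contrapT => h; apply: nsv; split; first exact/appendage_nodesP.
  move=> p pp vC x xK; apply/appendage_nodesP; rewrite in_setC; apply/negP=> xS.
  by apply: h; exists p; split=> //; exists x.
case=> p [pp vC [s]]; rewrite component_scc // inE => /andP[vs sv] sS.
have rC : r \notin complementary G p by rewrite in_set negbK; apply: ssr.
have sN : s \notin N by rewrite in_setC negbK.
have [z [w [vz ezw wN ws]]] := linked_exit vs vN sN.
have [w' [z' [sw' w'N ew'z z'v]]] := linked_enter sv sN vN.
have sub D : {subset D :&: N <= N} by move=> a; rewrite inE => /andP[].
have exw : exit_node G Ai w.
  split; first by move: wN; rewrite in_setC negbK.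
  by exists z, t; split=> //; apply: linked_trans tv (linkedS (@sub _) vz).
have enw : entry_node G Aj w'.
  split; first by move: w'N; rewrite in_setC negbK.
  by exists z', k; split=> //; apply: linked_trans (linkedS (@sub _) z'v) vk.
have := linked_trans ws sw' => ww'.
case/negP: (exit_entry_crosses exw enw ww'); apply: linkedS ww' => a aC.
by rewrite in_setD1 aC andbT; apply: contraNneq rC => <-.
Qed.

(** Every simple path from input to [k] passes [r].  If it met [Ai], or if a cycle
    outside it left [Ai], this would happen before [r], and the path could be
    continued from [r] to the output node. *)
Lemma invariant_of_cut k : k \in Aj -> config_invariant G Ai k.
Proof.
move=> kA; apply: invariantI; first exact: appendage_subnetwork_inp coreG _ hAi.
  move=> U W t tA Ut tk UW; have tN := appendage_subnetwork_sub hAi tA.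
  have [v [tv vk vS]] : exists v, [/\ linked e W t v, linked e W v k & v \in S].
    apply: contrapT => h; apply: (no_appendage_path_of_cut tA kA).
    apply: linkedS (linked_between tk) => v; rewrite [v \in _]inE => /andP[tv vk].
    by rewrite in_setC; apply/negP=> vS; apply: h; exists v.
  have [s [ts sv ex]] := exit_first hAi vS tv tA.
  have [s' [vs' _ en]] := entry_last hAj vS vk kA.
  have ss' := linked_trans sv vs'.
  have [W2 [_ [sr _ _ sW2 _]]] := linked_split ss' (exit_entry_crosses ex en ss').
  have tr := linked_trans ts (linkedS sW2 sr).
  have rU : r \notin U.
    by apply/negP=> rU; move: tN; rewrite -(UW _ rU (linkedR tr)) in_setC rS.
  have avoid z : z \in U -> z \in [set~ r].
    by move=> zU; rewrite !inE; apply: contraNneq rU => <-.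
  move: tN; rewrite in_setC; apply/negP/negPn.
  apply: (split_simple (linked_between Ut) (W := W :|: tail G r)).
    apply: (@linked_trans _ _ _ r); first by apply: linkedS tr => a aW; rewrite in_setU aW.
    by apply: linkedS (tail_linked coreG ssr) => a aW; rewrite in_setU aW orbT.
  move=> a; rewrite in_set => /andP[ia _]; rewrite in_setU => /orP[aW|/tailP[ar|[_ ao]]].
  - exact: UW (linkedR ia) aW.
  - by have := linkedR ia; rewrite ar (negPf rU).
  - by have := upstream_not_downstream ssr (linkedS avoid ia); rewrite ao.
move=> U W t x tA Uk UW tx xt.
have [s [is_ _ en]] := entry_last hAj iS Uk kA.
have Ur : linked e U inp r.
  have [<-//|sr] := eqVneq s r.
  have [U1 [_ [ir _ _ sU1 _]]] : exists U1 W1, [/\ linked e U1 inp r, linked e W1 r s,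
      forall a, a \in U1 -> a \in W1 -> a = r, {subset U1 <= U} & {subset W1 <= U}].
    apply: linked_split is_ _; apply/negP=> l.
    have avoid z : z \in U :\ r -> z \in [set~ r] by rewrite !inE => /andP[].
    case: (entries en) => [sE|so]; first by rewrite sE eqxx in sr.
    by have := upstream_not_downstream ssr (linkedS avoid l); rewrite so.
  exact: linkedS ir.
have rW : r \notin W by apply: UW (linkedR Ur).
have avoid z : z \in W -> z \in [set~ r].
  by move=> zW; rewrite !inE; apply: contraNneq rW => <-.
have xK : x \in scc e W t by rewrite inE tx.
have [tx' xt'] := scc_linked xK.
apply: (appendage_subnetwork_closed hAi (U := U :|: tail G r) _ _ tA tx' xt').
  apply: (@linked_trans _ _ _ r); first by apply: linkedS Ur => a aU; rewrite in_setU aU.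
  by apply: linkedS (tail_linked coreG ssr) => a aU; rewrite in_setU aU orbT.
move=> z zUt; apply/negP; rewrite in_set => /andP[tz _]; have zW := linkedR tz.
move: zUt; rewrite in_setU => /orP[zU|/tailP[zr|[zS zo]]].
- by have := UW _ zU; rewrite zW.
- by rewrite zr (negPf rW) in zW.
have [w [_ wz ex]] := exit_first hAi zS tz tA.
case: (exits ex) => [wr|iw]; first by have := linkedL wz; rewrite wr (negPf rW).
by have := upstream_downstream ssr iw (linkedS avoid wz); rewrite zo.
Qed.

End Sufficient.
End Induction.
End TwoSubnetworks.

(** * Positions on the structural chain *)

Section Chain.
Variables (T : finType) (G : io_network T).
Local Notation e := (arrow G).
Local Notation inp := (inode G).
Local Notation out := (onode G).
Local Notation S := (simple_nodes G).
Local Notation N := (~: simple_nodes G).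
Local Notation pnode := (pattern_node T {set T}).
Implicit Types (A : {set T}) (V W : pnode).

Lemma index_path_sides p x y : io_simple_path G p -> x \in inp :: p -> y \in inp :: p ->
  (index x (inp :: p) < index y (inp :: p))%N -> upstream_of G y x /\ downstream_of G x y.
Proof.
case/and3P=> pp /eqP lp up xp yp lt.
have xy : x != y by apply: contraTneq lt => ->; rewrite ltnn.
split.
  case/splitPl: xp pp lp up lt yp => p1 p2 lx; rewrite cat_path => /andP[pp1 _] _.
  rewrite -cat_cons cat_uniq => /and3P[u1 _ _] lt _.
  rewrite /upstream_of -lx; apply: path_linked => // z zp; rewrite !inE.
  apply: contraTneq lt => zy; rewrite zy in zp; rewrite -leqNgt !index_cat zp -lx mem_last.
  by rewrite index_last // -ltnS -[X in (_ < X)%N]/(size (inp :: p1)) index_mem.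
case/splitPl: yp pp lp up lt xp => p1 p2 ly; rewrite cat_path ly => /andP[_ pp2].
rewrite last_cat ly => lo.
rewrite -cat_cons cat_uniq => /and3P[u1 dis _] lt xp.
rewrite /downstream_of -lo; apply: path_linked => // z; rewrite inE => /predU1P[->|zp].
  by rewrite !inE eq_sym.
rewrite !inE; apply: contraTneq lt => zx; rewrite zx in zp.
have xp1 := hasPn dis _ zp; rewrite /= in xp1.
rewrite -leqNgt !index_cat -[x \in _](negbK) xp1 -ly mem_last index_last //.
by apply: leq_trans (leq_addr _ _).
Qed.

Lemma precedes_up r x : super_simple G r -> x \in S ->
  precedes G x r <-> upstream_of G r x.
Proof.
move=> ssr xS; split=> [[xr [p [r' [pp _ /and3P[xp _ rp] /andP[le1 le2]]]]]|ux].
  have le := leq_trans le1 le2; suff lt : (index x (inp :: p) < index r (inp :: p))%N.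
    by case: (index_path_sides pp xp rp lt).
  rewrite ltn_neqAle le andbT; apply/eqP=> E; apply: xr.
  by rewrite -(nth_index inp xp) E nth_index.
split; first by move=> xr; have := linkedR ux; rewrite xr !inE eqxx.
case/simple_nodesP: xS => p pp xp; exists p, r; split=> //; first by rewrite xp ssr.
rewrite leqnn andbT leqNgt; apply/negP=> lt.
have [_ dx] := index_path_sides pp (ssr _ pp) xp lt.
by have := upstream_not_downstream ssr ux; rewrite dx.
Qed.

Lemma precedes_down r x : super_simple G r -> x \in S ->
  precedes G r x <-> downstream_of G r x.
Proof.
move=> ssr xS; split=> [[xr [p [r' [pp _ /and3P[rp _ xp] /andP[le1 le2]]]]]|ux].
  have le := leq_trans le1 le2; suff lt : (index r (inp :: p) < index x (inp :: p))%N.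
    by case: (index_path_sides pp rp xp lt).
  rewrite ltn_neqAle le andbT; apply/eqP=> E; apply: xr.
  by rewrite -(nth_index inp rp) E nth_index.
split; first by move=> xr; have := linkedL ux; rewrite xr !inE eqxx.
case/simple_nodesP: xS => p pp xp; exists p, r; split=> //; first by rewrite xp ssr.
rewrite leqnn leqNgt; apply/negP=> lt.
have [dx _] := index_path_sides pp xp (ssr _ pp) lt.
by have := upstream_not_downstream ssr dx; rewrite ux.
Qed.

(** Super-simple nodes come in the same order on all simple paths from input to
    output, so the positions on any of them order the chain. *)
Section Rank.
Variable p : seq T.
Hypothesis pp : io_simple_path G p.
Let pS := io_simple_path_simple pp.

Definition position x := index x (inp :: p).
Local Notation pos := position.

Lemma position_inj x y : x \in inp :: p -> pos x = pos y -> x = y.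
Proof.
move=> xp E; have yp : y \in inp :: p by rewrite -index_mem -/(pos y) -E index_mem.
by rewrite -(nth_index inp xp) -/(pos x) E nth_index.
Qed.

Lemma position_upstream r x : super_simple G r -> x \in inp :: p ->
  (pos x < pos r)%N <-> upstream_of G r x.
Proof.
move=> ssr xp; split=> [lt|ux]; first by case: (index_path_sides pp xp (ssr _ pp) lt).
rewrite ltnNge; apply/negP=> le.
have [xr|xr] := eqVneq x r; first by have := linkedR ux; rewrite xr !inE eqxx.
have lt : (pos r < pos x)%N.
  rewrite ltn_neqAle le andbT; apply: contraNneq xr => E.
  by rewrite (position_inj (ssr _ pp) E).
have [_ dx] := index_path_sides pp (ssr _ pp) xp lt.
by have := upstream_not_downstream ssr ux; rewrite dx.
Qed.

Lemma position_downstream r x : super_simple G r -> x \in inp :: p ->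
  (pos r < pos x)%N <-> downstream_of G r x.
Proof.
move=> ssr xp; split=> [lt|dx]; first by case: (index_path_sides pp (ssr _ pp) xp lt).
have xr : x <> r by move=> xr; have := linkedL dx; rewrite xr !inE eqxx.
rewrite ltn_neqAle; apply/andP; split.
  by apply/eqP=> E; apply: xr; rewrite (position_inj (ssr _ pp) E).
rewrite leqNgt; apply/negP=> /(position_upstream ssr xp) ux.
by have := upstream_not_downstream ssr ux; rewrite dx.
Qed.

Lemma position_precedes a b : super_simple G a -> super_simple G b ->
  precedes G a b <-> (pos a < pos b)%N.
Proof.
move=> ssa ssb; have aS := pS (ssa _ pp).
rewrite (position_upstream ssb (ssa _ pp)); exact: precedes_up.
Qed.

Lemma consecutiveP a b : consecutive G a b <-> [/\ super_simple G a, super_simple G b,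
  (pos a < pos b)%N & forall r, super_simple G r -> (pos a < pos r)%N -> (pos b <= pos r)%N].
Proof.
split=> [[ssa ssb /(position_precedes ssa ssb) ab nr]|[ssa ssb ab nr]]; split=> //.
- move=> r ssr ar; rewrite leqNgt; apply/negP=> rb; apply: nr.
  by exists r; split=> //; apply/position_precedes.
- exact/position_precedes.
- case=> r [ssr /(position_precedes ssa ssr) ar /(position_precedes ssr ssb) rb].
  by have := nr r ssr ar; rewrite leqNgt rb.
Qed.

Definition rank V : nat := match V with
  | SuperSimple r => (pos r).*2
  | Backbone a _ => (pos a).*2.+1
  | AppendageComponent _ => 0
  end.

Lemma structural_arrow_nodes V V' : structural_arrow G V V' ->
  structural_node G V /\ structural_node G V'.
Proof. by case=> a b ab; split=> //=; case: ab. Qed.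

Lemma structural_arrow_rank V V' : structural_arrow G V V' -> (rank V < rank V')%N.
Proof.
case=> a b /consecutiveP[_ _ ab _] /=; first by rewrite ltnSn.
by rewrite -doubleS leq_double.
Qed.

Lemma structural_arrow_next V V' W : structural_arrow G V V' -> structural_node G W ->
  (rank V < rank W)%N -> (rank V' <= rank W)%N.
Proof.
case=> a b /consecutiveP[_ _ _ nr] //; case: W => [c|c d|//] /=.
- move=> ssc; rewrite -doubleS => lt; rewrite leq_double; apply: nr => //.
  by rewrite -leq_double; apply: leq_trans lt; rewrite leq_double.
- case=> ssc _ _ _; rewrite ltnS => lt.
  by apply: leqW; rewrite leq_double nr // -ltn_double.
Qed.

Lemma structural_arrow_exists V W : structural_node G V -> structural_node G W ->
  (rank V < rank W)%N -> exists V', structural_arrow G V V'.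
Proof.
case: V => [a|a b|//] /= ssV ssW lt; last first.
  by exists (SuperSimple b); constructor.
have [d [ssd ad]] : exists d, super_simple G d /\ (pos a < pos d)%N.
  case: W ssW lt => [c|c d|//] /=; first by exists c; rewrite -ltn_double.
  move=> /consecutiveP[ssc ssd cd _]; rewrite ltnS leq_double => le.
  by exists d; split=> //; apply: leq_ltn_trans cd.
pose Q c := `[< super_simple G c >] && (pos a < pos c)%N.
have Qd : Q d by rewrite /Q ad andbT; apply/asboolP.
case: (arg_minnP pos Qd) => b /andP[/asboolP ssb ab] bmin.
exists (Backbone a b); constructor; apply/consecutiveP; split=> // r ssr ar.
by apply: bmin; rewrite /Q ar andbT; apply/asboolP.
Qed.

Lemma rank_inj V W : structural_node G V -> structural_node G W -> rank V = rank W -> V = W.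
Proof.
have odd2 n m : n.*2 = m.*2.+1 -> False.
  by move=> /(congr1 odd); rewrite /= !odd_double.
case: V W => [a|a b|//] [c|c d|//] /=.
- by move=> ssa _ /double_inj /(position_inj (ssa _ pp)) ->.
- by move=> _ _ /odd2.
- by move=> _ _ /esym /odd2.
move=> /consecutiveP[ssa ssb ab mb] /consecutiveP[ssc ssd cd md] /succn_inj /double_inj.
move/(position_inj (ssa _ pp)) => E; subst c; congr (Backbone _ _).
by apply: (position_inj (ssb _ pp)); apply/eqP; rewrite eqn_leq mb ?md.
Qed.

Lemma chain_le_rank V W : structural_node G V -> structural_node G W ->
  chain_le G V W = (rank V <= rank W)%N.
Proof.
move=> sV sW; apply/idP/idP.
  move=> /connectP[q pq ->] {sV sW}; elim: q V pq => //= U q IH V /andP[/asboolP VU pq].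
  exact: leq_trans (ltnW (structural_arrow_rank VU)) (IH _ pq).
move: {2}(rank W - rank V)%N (leqnn (rank W - rank V)%N) => k.
elim: k V sV => [|k IH] V sV le_k le.
  suff -> : V = W by apply: connect0.
  by apply: rank_inj => //; apply/eqP; rewrite eqn_leq le -subn_eq0 -leqn0.
move: le; rewrite leq_eqVlt => /predU1P[/(rank_inj sV sW)->|lt]; first exact: connect0.
have [V' VV'] := structural_arrow_exists sV sW lt.
apply: connect_trans (connect1 _) _; first by apply/asboolP; apply: VV'.
have lt' := structural_arrow_rank VV'; apply: IH.
- by case: (structural_arrow_nodes VV').
- by rewrite -ltnS; apply: leq_trans le_k; apply: ltn_sub2l.
- exact: structural_arrow_next VV' sW lt.
Qed.

Lemma simple_node_of V s : structural_node G V -> s \in S -> s \in pattern_node_set G V ->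
  match V with
  | SuperSimple r => s = r
  | Backbone a b => downstream_of G a s /\ upstream_of G b s
  | AppendageComponent _ => False
  end.
Proof.
case: V => [r _ _|a b ab sS|//] /=; first by rewrite inE => /eqP.
have [ssa ssb _ _] := ab.
rewrite in_setU => /orP[]; rewrite inE => /asboolP.
  by case=> _ /(precedes_down ssa sS) ? /(precedes_up ssb sS).
by case=> ns _ _; move/simple_nodesP: sS.
Qed.

(** [s] lies on the reference path, so the positions of the ends of its backbone
    node bracket its own. *)
Lemma rank_le_super_simple V s r : structural_node G V -> super_simple G r ->
  s \in inp :: p -> s \in pattern_node_set G V ->
  (rank V <= rank (SuperSimple r))%N = (pos s <= pos r)%N.
Proof.
move=> sV ssr sp sin; have := simple_node_of sV (pS sp) sin.
case: V sV sin => [r' _ _ ->|a b ab _|//]; first by rewrite leq_double.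
have /consecutiveP[ssa ssb _ nr] := ab.
case=> /(position_downstream ssa sp) las /(position_upstream ssb sp) lsb /=.
rewrite ltn_double; apply/idP/idP => [ar|sr]; last exact: leq_trans las sr.
exact: leq_trans (ltnW lsb) (nr r ssr ar).
Qed.

Lemma rank_ge_super_simple V s r : structural_node G V -> super_simple G r ->
  s \in inp :: p -> s \in pattern_node_set G V ->
  (rank (SuperSimple r) <= rank V)%N = (pos r <= pos s)%N.
Proof.
move=> sV ssr sp sin; have := simple_node_of sV (pS sp) sin.
case: V sV sin => [r' _ _ ->|a b ab _|//]; first by rewrite leq_double.
have /consecutiveP[ssa ssb _ nr] := ab.
case=> /(position_downstream ssa sp) las /(position_upstream ssb sp) lsb /=.
rewrite leq_Sdouble; apply/idP/idP => [ra|rs]; first exact: leq_trans ra (ltnW las).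
by rewrite leqNgt; apply/negP=> /(nr r ssr) br; have := leq_trans br rs; rewrite leqNgt lsb.
Qed.

End Rank.

Lemma structural_node_exists s : s \in S ->
  exists V, structural_node G V /\ s \in pattern_node_set G V.
Proof.
move=> sS; have [ss|nss] := pselect (super_simple G s).
  by exists (SuperSimple s); rewrite /= inE.
case/simple_nodesP: (sS) => p pp sp.
have ssi : super_simple G inp by move=> q _; rewrite mem_head.
have sso : super_simple G out by move=> q /and3P[_ /eqP<- _]; rewrite mem_last.
have neq r : super_simple G r -> position p s <> position p r.
  by move=> ssr E; apply: nss; rewrite (position_inj sp E).
pose Qa c := `[< super_simple G c >] && (position p c < position p s)%N.
pose Qb c := `[< super_simple G c >] && (position p s < position p c)%N.
have Qi : Qa inp.
  rewrite /Qa; apply/andP; split; first exact/asboolP.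
  have i0 : position p inp = 0 by rewrite /position /= eqxx.
  by rewrite i0 lt0n; apply/eqP=> s0; apply: (neq _ ssi); rewrite s0 i0.
have Qo : Qb out.
  rewrite /Qb; apply/andP; split; first exact/asboolP.
  rewrite ltn_neqAle; apply/andP; split; first by apply/eqP=> /neq; apply.
  case/and3P: pp => _ /eqP <- up; rewrite /position index_last //.
  by rewrite -ltnS -[X in (_ < X)%N]/(size (inp :: p)) index_mem.
case: (arg_maxnP (position p) Qi) => a /andP[/asboolP ssa las] amax.
case: (arg_minnP (position p) Qo) => b /andP[/asboolP ssb lsb] bmin.
exists (Backbone a b); split.
  apply/(consecutiveP pp); split=> //; first exact: ltn_trans las lsb.
  move=> r ssr ar; have [rs|sr] := leqP (position p r) (position p s).
    have : Qa r.
      rewrite /Qa ltn_neqAle rs andbT; apply/andP; split; first exact/asboolP.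
      by apply/eqP=> /esym/neq; apply.
    by move/amax; rewrite /= leqNgt ar.
  by apply: bmin; rewrite /Qb sr andbT; apply/asboolP.
rewrite /= in_setU; apply/orP; left; rewrite in_set; apply/asboolP; split; first exact/simple_nodesP.
  by apply/precedes_down => //; apply/(position_downstream pp).
by apply/precedes_up => //; apply/(position_upstream pp).
Qed.

Lemma chain_le_super_simple V s r : structural_node G V -> super_simple G r ->
  s \in S -> s \in pattern_node_set G V ->
  chain_le G V (SuperSimple r) <-> s = r \/ upstream_of G r s.
Proof.
move=> sV ssr /simple_nodesP[p pp sp] sin.
rewrite (chain_le_rank pp) // (rank_le_super_simple pp sV ssr sp sin).
rewrite leq_eqVlt; split=> [/predU1P[/(position_inj sp)|]|[->|]].
- by left.
- by move/(position_upstream pp ssr sp); right.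
- by rewrite eqxx.
- by move/(position_upstream pp ssr sp) ->; rewrite orbT.
Qed.

Lemma chain_ge_super_simple V s r : structural_node G V -> super_simple G r ->
  s \in S -> s \in pattern_node_set G V ->
  chain_le G (SuperSimple r) V <-> s = r \/ downstream_of G r s.
Proof.
move=> sV ssr /simple_nodesP[p pp sp] sin.
rewrite (chain_le_rank pp) // (rank_ge_super_simple pp sV ssr sp sin).
rewrite leq_eqVlt; split=> [/predU1P[/esym/(position_inj sp)|]|[->|]].
- by left.
- by move/(position_downstream pp ssr sp); right.
- by rewrite eqxx.
- by move/(position_downstream pp ssr sp) ->; rewrite orbT.
Qed.

End Chain.

(** * The combinatorial theorem *)

Section Pattern.
Variables (T : finType) (G : io_network T).
Local Notation e := (arrow G).
Local Notation inp := (inode G).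
Local Notation out := (onode G).
Local Notation S := (simple_nodes G).
Local Notation N := (~: simple_nodes G).
Local Notation pnode := (pattern_node T {set T}).
Implicit Types (A : {set T}) (V W : pnode).

Hypothesis coreG : core G.

Lemma appendage_exitP A V : appendage_subnetwork G A ->
  appendage_exit G A V <->
  structural_node G V /\ exists2 s, s \in pattern_node_set G V & exit_node G A s.
Proof.
move=> hA; split=> [[sV [t [s [p [tA sS sin [/and3P[pp /eqP lp up] _ app]]]]]]|[sV [s sin]]].
  split=> //; exists s => //; split; first exact/simple_nodesP.
  have tN := appendage_subnetwork_sub hA tA.
  have sN : s \notin N by rewrite in_setC negbK; apply/simple_nodesP.
  have ts : linked e [set x in t :: p] t s.
    by rewrite -lp; apply: path_linked => // x; rewrite in_set.
  have [z [w [tz ezw wN ws]]] := linked_exit ts tN sN.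
  exists z, t; split=> //; first by apply: linkedS tz => x; rewrite inE => /andP[].
  suff <- : w = s by [].
  apply: contrapT => wns; case/negP: (wN); apply/appendage_nodesP; apply: app => //.
    by have := linkedL ws; rewrite in_set.
  by move=> wt; rewrite wt tN in wN.
move=> [sS [z [t [tA tz ezs]]]]; split=> //.
have [p [pp lp up sp]] := linked_path tz.
exists t, s, (rcons p s); split=> //; first exact/simple_nodesP.
split.
- have sp' : s \notin t :: p by apply/negP=> /sp; rewrite in_setC sS.
  by rewrite /simple_path rcons_path pp lp ezs last_rcons eqxx -rcons_cons rcons_uniq up sp'.
- by exists t; [rewrite mem_head | apply/appendage_nodesP; apply: linkedL tz].
- move=> y; rewrite -rcons_cons mem_rcons inE => /predU1P[->//|/sp yN _ _].
  exact/appendage_nodesP.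
Qed.

Lemma appendage_entryP A V : appendage_subnetwork G A ->
  appendage_entry G A V <->
  structural_node G V /\ exists2 s, s \in pattern_node_set G V & entry_node G A s.
Proof.
move=> hA; split=> [[sV [s [t [p [sS sin tA [/and3P[pp /eqP lp up] _ app]]]]]]|[sV [s sin]]].
  split=> //; exists s => //; split; first exact/simple_nodesP.
  have tN := appendage_subnetwork_sub hA tA.
  have sN : s \notin N by rewrite in_setC negbK; apply/simple_nodesP.
  have st : linked e [set x in s :: p] s t.
    by rewrite -lp; apply: path_linked => // x; rewrite in_set.
  have [w [z [sw wN ewz zt]]] := linked_enter st sN tN.
  exists z, t; split=> //; last by apply: linkedS zt => x; rewrite inE => /andP[].
  suff <- : w = s by [].
  apply: contrapT => wns; case/negP: (wN); apply/appendage_nodesP; apply: app => //.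
    by have := linkedR sw; rewrite in_set.
  by move=> wt; rewrite wt tN in wN.
move=> [sS [z [t [esz zt tA]]]]; split=> //.
have [p [pp lp up sp]] := linked_path zt.
exists s, t, (z :: p); split=> //; first exact/simple_nodesP.
split.
- have sp' : s \notin z :: p by apply/negP=> /sp; rewrite in_setC sS.
  rewrite /simple_path -[path _ s _]/(e s z && path e z p) esz pp -[last s _]/(last z p) lp eqxx.
  by rewrite cons_uniq up sp'.
- by exists z; [rewrite !inE eqxx orbT | apply/appendage_nodesP; apply: linkedL zt].
- move=> y; rewrite in_cons => /predU1P[->//|/sp yN _ _].
  exact/appendage_nodesP.
Qed.

Lemma is_Vmax_exists A : appendage_subnetwork G A -> exists V, is_Vmax G A V.
Proof.
move=> hA; have [s ex] := exit_exists coreG hA.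
have [V [sV sin]] := structural_node_exists (proj1 ex).
have [p [pp _]] := linked_io_simple_path (io_linked coreG).
have QV : `[< appendage_exit G A V >].
  by apply/asboolP/appendage_exitP => //; split=> //; exists s.
case: (@arg_maxnP _ V (fun W => `[< appendage_exit G A W >]) (rank G p) QV) => W /asboolP exW max.
exists W; split=> // W' exW'; case: (exW) (exW') => sW _ [sW' _].
by rewrite (chain_le_rank pp) //; apply: max; apply/asboolP.
Qed.

Lemma is_Vmin_exists A : appendage_subnetwork G A -> exists V, is_Vmin G A V.
Proof.
move=> hA; have [s en] := entry_exists coreG hA.
have [V [sV sin]] := structural_node_exists (proj1 en).
have [p [pp _]] := linked_io_simple_path (io_linked coreG).
have QV : `[< appendage_entry G A V >].
  by apply/asboolP/appendage_entryP => //; split=> //; exists s.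
case: (@arg_minnP _ V (fun W => `[< appendage_entry G A W >]) (rank G p) QV) => W /asboolP enW min.
exists W; split=> // W' enW'; case: (enW) (enW') => sW _ [sW' _].
by rewrite (chain_le_rank pp) //; apply: min; apply/asboolP.
Qed.

Lemma appendage_subnetwork_eq A B t : appendage_subnetwork G A -> appendage_subnetwork G B ->
  t \in A -> t \in B -> A = B.
Proof.
move=> hA hB tA tB.
have sub A' B' : appendage_subnetwork G A' -> appendage_subnetwork G B' -> t \in A' -> t \in B' -> {subset A' <= B'}.
  move=> hA' hB' tA' tB' x xA'.
  have AS y : y \in A' -> y \in super_appendage_nodes G.
    by move=> yA; apply/super_appendage_nodesP; apply: appendage_subnetwork_super yA.
  apply: (appendage_subnetwork_max hB' tB').
    exact: linkedS AS (appendage_subnetwork_linked hA' tA' xA').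
  exact: linkedS AS (appendage_subnetwork_linked hA' xA' tA').
by apply/setP=> x; apply/idP/idP; apply: sub.
Qed.

Lemma appendage_subnetwork_of x : x \in super_appendage_nodes G ->
  exists2 A, appendage_subnetwork G A & x \in A.
Proof.
move=> xS; exists (component G (super_appendage_nodes G) x).
  by exists x => //; apply/super_appendage_nodesP.
by rewrite component_scc // inE !linked_refl.
Qed.

(** Each node of the path is sent to the appendage subnetwork that contains it,
    and repetitions are dropped. *)
Lemma appendage_pattern_path Ai Aj t k : appendage_subnetwork G Ai -> appendage_subnetwork G Aj ->
  t \in Ai -> k \in Aj -> linked e (super_appendage_nodes G) t k ->
  exists q : seq {set T},
    pattern_path G (AppendageComponent Ai) (AppendageComponent Aj) (map (@AppendageComponent T _) q).
Proof.
move=> hAi hAj tA kA /linked_path[p [pp lp _ sp]]; rewrite -{}lp in kA.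
elim: p t Ai hAi tA pp sp kA => [|a p IH] t Ai hAi tA /= pp sp kA.
  by exists [::]; rewrite /pattern_path /= (appendage_subnetwork_eq hAi hAj tA kA).
case/andP: pp => eta pa; have aS : a \in super_appendage_nodes G by rewrite sp // !inE eqxx orbT.
have [A hA aA] := appendage_subnetwork_of aS.
have sp' : {subset a :: p <= super_appendage_nodes G}.
  by move=> z zp; apply: sp; rewrite in_cons zp orbT.
have [q /andP[pq lq]] := IH a A hA aA pa sp' kA.
have [AA|AA] := eqVneq Ai A; first by exists q; rewrite AA /pattern_path pq.
exists (A :: q); rewrite /pattern_path /= pq lq !andbT; apply/asboolP.
by apply: ArrowA; apply: (ArrowAppendage (t1 := t) (t2 := a)) => //; apply/eqP.
Qed.

Lemma chain_le_pattern_path V W : chain_le G V W -> exists p, pattern_path G V W p.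
Proof.
case/connectP=> p pp lp; exists p; rewrite /pattern_path lp eqxx andbT.
by apply: sub_path pp => U U' /asboolP h; apply/asboolP; apply: ArrowS.
Qed.

Lemma pattern_path_cat V W W' p q : pattern_path G V W p -> pattern_path G W W' q ->
  pattern_path G V W' (p ++ q).
Proof.
case/andP=> pp /eqP lp /andP[pq lq].
by rewrite /pattern_path cat_path last_cat lp pp pq lq.
Qed.

Lemma pattern_path1 V W : pattern_arrow G V W -> pattern_path G V W [:: W].
Proof. by move=> VW; rewrite /pattern_path /= eqxx !andbT; apply/asboolP. Qed.

Section Components.
Variables Ai Aj : {set T}.
Hypotheses (hAi : appendage_subnetwork G Ai) (hAj : appendage_subnetwork G Aj).

Definition separated_by r := exists Vmax Vmin, [/\ super_simple G r, is_Vmax G Ai Vmax,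
  is_Vmin G Aj Vmin & chain_le G Vmax (SuperSimple r) && chain_le G (SuperSimple r) Vmin].

Lemma separated_exits r s : separated_by r -> exit_node G Ai s -> s = r \/ upstream_of G r s.
Proof.
case=> V [_ [ssr [_ Vmax] _ /andP[Vr _]]] ex.
have [W [sW sin]] := structural_node_exists (proj1 ex).
apply/(chain_le_super_simple sW ssr _ sin); first by case: ex.
apply: connect_trans Vr; apply: Vmax; apply/appendage_exitP => //.
by split=> //; exists s.
Qed.

Lemma separated_entries r s : separated_by r -> entry_node G Aj s -> s = r \/ downstream_of G r s.
Proof.
case=> _ [V [ssr _ [_ Vmin] /andP[_ Vr]]] en.
have [W [sW sin]] := structural_node_exists (proj1 en).
apply/(chain_ge_super_simple sW ssr _ sin); first by case: en.
apply: connect_trans Vr _; apply: Vmin; apply/appendage_entryP => //.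
by split=> //; exists s.
Qed.

(** Otherwise a simple path from input to output would run to [s0], through [A]
    and on from [s1]. *)
Lemma super_simple_upstream_disjoint A r s0 s1 : appendage_subnetwork G A -> super_simple G r ->
  entry_node G A s0 -> upstream_of G r s0 -> exit_node G A s1 -> s1 = r \/ upstream_of G r s1.
Proof.
move=> hA ssr en us0 ex; have avoid := @in_simple_avoid _ G r.
have s0S : s0 \in S by case: en.
have s1S : s1 \in S by case: ex.
case: (simple_position r s1S) => [|l|s1o]; [by left | by right; apply: linkedS l | ].
case: (simple_position r s0S) => [s0r|is0|l].
- by have := linkedR us0; rewrite s0r !inE eqxx.
- case: (no_bypass coreG hA en ex _ _ _ (linked_between is0) (linked_between s1o)).
  + by move=> z; rewrite in_set => /andP[/linkedR]; rewrite !inE => /andP[].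
  + by move=> z; rewrite in_set => /andP[/linkedR]; rewrite !inE => /andP[].
  move=> z; rewrite in_set => /andP[iz _]; apply/negP; rewrite in_set => /andP[_ zo].
  by have := upstream_not_downstream ssr (linkedS avoid iz); rewrite /downstream_of (linkedS avoid zo).
- by have := upstream_not_downstream ssr us0; rewrite /downstream_of (linkedS avoid l).
Qed.

(** A pattern path from [Ai] that avoids [r] stays before [r]: arrows of the
    chain advance by one step, and a detour through appendage components leads
    back upstream.  So it does not reach [Aj]. *)
Lemma pattern_path_crosses r p : separated_by r ->
  (forall t k, t \in Ai -> k \in Aj -> ~ linked e N t k) ->
  pattern_path G (AppendageComponent Ai) (AppendageComponent Aj) p ->
  SuperSimple r \in AppendageComponent Ai :: p.
Proof.
move=> sep nolink /andP[pp /eqP lp]; have [V1 [V2 [ssr vmax vmin /andP[V1r rV2]]]] := sep.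
have rS := super_simple_simple coreG ssr.
have [p0 [pp0 _]] := linked_io_simple_path (io_linked coreG).
pose before V := structural_node G V /\ (rank G p0 V < rank G p0 (SuperSimple r))%N.
pose good V := match V with
  | AppendageComponent A => appendage_subnetwork G A /\
      ((exists t k, [/\ t \in Ai, k \in A & linked e N t k]) \/
       (exists s, entry_node G A s /\ upstream_of G r s))
  | _ => before V end.
have sr : structural_node G (SuperSimple r : pnode) by [].
have avoided V : structural_node G V -> (rank G p0 V <= rank G p0 (SuperSimple r))%N ->
    V != SuperSimple r -> before V.
  move=> sV le neq; split=> //; rewrite ltn_neqAle le andbT; apply: contraNneq neq => E.
  by apply/eqP; apply: rank_inj E.
have good_before V : structural_node G V -> before V -> good V by case: V.
have before_good V : structural_node G V -> good V -> before V by case: V.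
have step V W : good V -> pattern_arrow G V W -> W != SuperSimple r -> good W.
  move=> gV VW Wr; case: VW gV Wr => {V W}.
  - move=> V W VW gV Wr; have [sV sW] := structural_arrow_nodes VW.
    apply: good_before => //; apply: avoided => //.
    by apply: (structural_arrow_next pp0 VW) => //; case: (before_good _ sV gV).
  - move=> _ _ [A1 A2 t1 t2 hA1 hA2 _ t1A t2A e12] [_ gV] _; split=> //.
    have t1N := appendage_subnetwork_sub hA1 t1A; have t2N := appendage_subnetwork_sub hA2 t2A.
    case: gV => [[t [k [tA kA tk]]]|[s [[sS [z [t [esz zt tA]]]] us]]].
      left; exists t, t2; split=> //; apply: linked_rstep e12 t2N.
      exact: linked_trans tk (appendage_linked hA1 kA t1A).
    right; exists s; split=> //; split=> //; exists z, t2; split=> //.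
    by apply: linked_rstep e12 t2N; apply: linked_trans zt (appendage_linked hA1 tA t1A).
  - move=> A V hA [exV _] [_ gV] Vr; have [sV [s sin ex]] := (appendage_exitP V hA).1 exV.
    apply: good_before => //; apply: avoided => //.
    rewrite -(chain_le_rank pp0) //; apply/(chain_le_super_simple sV ssr (proj1 ex) sin).
    case: gV => [[t [k [tA kA tk]]]|[s0 [en us]]]; last exact: super_simple_upstream_disjoint hA ssr en us ex.
    apply: (separated_exits sep); case: ex => sS [z [t' [t'A t'z ezs]]]; split=> //.
    exists z, t; split=> //; apply: linked_trans tk _.
    exact: linked_trans (appendage_linked hA kA t'A) t'z.
  - move=> A V hA [enV _] gV _; have [sV [s sin en]] := (appendage_entryP V hA).1 enV.
    split=> //; right; exists s; split=> //.
    have [_ lt] := before_good _ sV gV.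
    have le : chain_le G V (SuperSimple r) by rewrite (chain_le_rank pp0) // ltnW.
    case: ((chain_le_super_simple sV ssr (proj1 en) sin).1 le) => // E.
    have : chain_le G (SuperSimple r) V.
      by apply/(chain_ge_super_simple sV ssr (proj1 en) sin); left.
    by rewrite (chain_le_rank pp0) // leqNgt lt.
apply: contraT; rewrite in_cons /= => rp.
have gAi : good (AppendageComponent Ai).
  split=> //; left; have [t tA] := appendage_subnetwork_neq0 hAi.
  by exists t, t; split=> //; apply: linked_refl; apply: appendage_subnetwork_sub tA.
have : good (AppendageComponent Aj).
  rewrite -lp; elim: p (AppendageComponent Ai : pnode) gAi pp rp {lp} => //= W p IH V gV.
  case/andP=> /asboolP VW pp; rewrite in_cons negb_or eq_sym => /andP[Wr rp].
  by apply: IH => //; apply: step VW Wr.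
case=> _ [[t [k [tA kA tk]]]|[s [en us]]]; first by case: (nolink t k tA kA tk).
case: (separated_entries sep en) => [E|ds].
  by have := linkedR us; rewrite E !inE eqxx.
by have := upstream_not_downstream ssr us; rewrite ds.
Qed.

Theorem invariant_iff_pattern :
  (forall k, k \in Aj -> config_invariant G Ai k) <->
  strictly_upstream G (AppendageComponent Ai) (AppendageComponent Aj) /\
  (forall p, pattern_path G (AppendageComponent Ai) (AppendageComponent Aj) p ->
     exists rho Vmax Vmin,
       [/\ super_simple G rho, SuperSimple rho \in AppendageComponent Ai :: p,
           is_Vmax G Ai Vmax, is_Vmin G Aj Vmin
         & chain_le G Vmax (SuperSimple rho) && chain_le G (SuperSimple rho) Vmin]).
Proof.
split=> [inv|[[_ [p0 pp0]] hp] k].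
  have nolink t k : t \in Ai -> k \in Aj -> ~ linked e N t k.
    exact: no_appendage_path inv t k.
  have [V1 vmax] := is_Vmax_exists hAi; have [V2 vmin] := is_Vmin_exists hAj.
  have [sV1 [s1 s1in ex]] := (appendage_exitP V1 hAi).1 (proj1 vmax).
  have [sV2 [s2 s2in en]] := (appendage_entryP V2 hAj).1 (proj1 vmin).
  have [r [ssr s1r s2r]] := super_simple_between coreG hAi inv ex en.
  have le1 := (chain_le_super_simple sV1 ssr (proj1 ex) s1in).2 s1r.
  have le2 := (chain_ge_super_simple sV2 ssr (proj1 en) s2in).2 s2r.
  have sep : separated_by r by exists V1, V2; split=> //; rewrite le1.
  split.
    split.
      case=> AA; have [t tA] := appendage_subnetwork_neq0 hAi.
      apply: (nolink t t) => //; first by rewrite -AA.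
      by apply: linked_refl; apply: appendage_subnetwork_sub tA.
    have [p1 pp1] := chain_le_pattern_path le1; have [p2 pp2] := chain_le_pattern_path le2.
    exists ([:: V1] ++ p1 ++ p2 ++ [:: AppendageComponent Aj]).
    apply: pattern_path_cat (pattern_path1 _) _; first exact: ArrowVmax.
    apply: pattern_path_cat pp1 (pattern_path_cat pp2 (pattern_path1 _)).
    exact: ArrowVmin.
  move=> p pp; exists r, V1, V2; split=> //; last by rewrite le1.
  exact: pattern_path_crosses sep nolink pp.
have [r [V1 [V2 [ssr _ v1 v2 v12]]]] := hp _ pp0.
have sep : separated_by r by exists V1, V2.
apply: (invariant_of_cut coreG hAi hAj ssr).
- by move=> s; apply: separated_exits.
- by move=> s; apply: separated_entries.
move=> t k' tA kA tk; have [q pq] := appendage_pattern_path hAi hAj tA kA tk.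
have [r' [_ [_ [_ mem _ _ _]]]] := hp _ pq.
move: mem; rewrite in_cons => /orP[/eqP//|/mapP[A _ //]].
Qed.

End Components.
End Pattern.

(** * Block triangular forms *)

Section BlockForms.
Variables (T : finType) (G : io_network T).
Local Notation e := (arrow G).
Implicit Types (r c : seq T) (b : block T) (bs : seq (block T)).

Lemma block_exists r c : size r = size c ->
  exists b, [/\ bsize b = size r, brow b = r :> seq T & bcol b = c :> seq T].
Proof.
by move=> /esym /eqP szc; exists (Block (in_tuple r) (Tuple szc)).
Qed.

Definition uncoupled r c := all (fun j => all (fun l => ~~ coupled G j l) c) r.

Lemma uncoupledP r c : reflect (forall j l, j \in r -> l \in c -> ~~ coupled G j l) (uncoupled r c).
Proof.
apply: (iffP allP) => [h j l jr lc|h j jr]; first by apply: (allP (h j jr)).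
by apply/allP=> l lc; apply: h.
Qed.

(** Lists of blocks, unlike families indexed by ordinals, are easy to
    concatenate. *)
Definition triangular_blocks r c bs :=
  [/\ all (fun b => (0 < bsize b)%N) bs,
      perm_eq (flatten [seq (brow b : seq T) | b <- bs]) r,
      perm_eq (flatten [seq (bcol b : seq T) | b <- bs]) c
    & pairwise (fun b b' => uncoupled (brow b') (bcol b)) bs].

Lemma flatten_blocks (f : block T -> seq T) bs :
  [seq x | i <- enum 'I_(size bs), x <- f (tnth (in_tuple bs) i)] = flatten [seq f b | b <- bs].
Proof.
transitivity (flatten [seq f b | b <- map (tnth (in_tuple bs)) (enum 'I_(size bs))]).
  by rewrite -map_comp; congr flatten; apply: eq_map => i /=; rewrite map_id.
by rewrite map_tnth_enum.
Qed.

Lemma triangular_blocks_form r c bs (b0 : block T) : triangular_blocks r c bs ->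
  block_triangular_form G r c (fun i : 'I_(size bs) => tnth (in_tuple bs) i).
Proof.
case=> pos pr pc pw; split.
- by move=> i; rewrite (tnth_nth b0); apply: (all_nthP b0 pos).
- by rewrite -flatten_blocks in pr.
- by rewrite -flatten_blocks in pc.
- move=> i k ki; apply/uncoupledP.
  rewrite !(tnth_nth b0); apply: (pairwiseP b0 pw) => //; by rewrite inE ltn_ord.
Qed.

Lemma uniq_flatten_mem (s : seq (seq T)) r : uniq (flatten s) -> r \in s -> uniq r.
Proof.
elim: s => //= r' s IH; rewrite cat_uniq => /and3P[ur _ us].
by rewrite inE => /predU1P[->//|]; apply: IH.
Qed.

Lemma allpairs_split m (f : 'I_m.+1 -> seq T) : [seq x | i <- enum 'I_m.+1, x <- f i] =
  f ord0 ++ flatten [seq f (lift ord0 i) | i <- enum 'I_m].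
Proof.
rewrite enum_ordSl /= map_id -map_comp; congr (_ ++ flatten _).
by apply: eq_map => i /=; rewrite map_id.
Qed.

Lemma not_irreducible_split b : (0 < bsize b)%N -> ~ block_irreducible G b ->
  exists r1 r2 c1 c2, [/\ perm_eq (r1 ++ r2) (brow b), perm_eq (c1 ++ c2) (bcol b),
    (size r1 = size c1) /\ (size r2 = size c2), (0 < size r1 < bsize b)%N & uncoupled r2 c1].
Proof.
move=> b0 /existsNP[m /existsNP[B /not_implyP[[pos pr pc vanish] m1]]].
have size_rows : size (brow b) = bsize b by apply: size_tuple.
have size_cols : size (bcol b) = bsize b by apply: size_tuple.
case: m B m1 pos pr pc vanish => [|[|m]] B //.
  by move=> _ _ /perm_size; rewrite size_rows enum_ord0 /= => b0'; rewrite -b0' in b0.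
pose r2 := flatten [seq (brow (B (lift ord0 i)) : seq T) | i <- enum 'I_m.+1].
pose c2 := flatten [seq (bcol (B (lift ord0 i)) : seq T) | i <- enum 'I_m.+1].
move=> _ pos; rewrite !allpairs_split -/r2 -/c2 => pr pc vanish.
exists (brow (B ord0)), r2, (bcol (B ord0)), c2.
have sz1 : size (brow (B ord0)) = size (bcol (B ord0)) by rewrite !size_tuple.
have sz2 : size r2 = size c2.
  apply/eqP; rewrite -(eqn_add2l (size (brow (B ord0)))) {2}sz1 -!size_cat.
  by rewrite (perm_size pr) (perm_size pc) size_rows size_cols.
have r2_gt0 : (0 < size r2)%N.
  have [x xB] : exists x, x \in (brow (B (lift ord0 ord0)) : seq T).
    by exists (tnth (brow (B (lift ord0 ord0))) (Ordinal (pos _))); apply: mem_tnth.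
  suff : x \in r2 by case: (r2).
  apply/flattenP; exists (brow (B (lift ord0 ord0)) : seq T) => //.
  by apply: (map_f (fun i => (brow (B (lift ord0 i)) : seq T))); rewrite mem_enum.
split=> //.
  rewrite size_tuple pos -size_rows -(perm_size pr) size_cat size_tuple.
  by rewrite -[X in (X < _)%N]addn0 ltn_add2l.
apply/uncoupledP=> j l /flattenP[s /mapP[i _ ->] ji] lc.
exact: vanish ji lc.
Qed.

Lemma triangular_blocks_cat bs1 bs2 r1 r2 c1 c2 : triangular_blocks r1 c1 bs1 ->
  triangular_blocks r2 c2 bs2 -> uncoupled r2 c1 ->
  triangular_blocks (r1 ++ r2) (c1 ++ c2) (bs1 ++ bs2).
Proof.
case=> pos1 pr1 pc1 pw1 [pos2 pr2 pc2 pw2] /uncoupledP unc; split.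
- by rewrite all_cat pos1.
- by rewrite map_cat flatten_cat perm_cat.
- by rewrite map_cat flatten_cat perm_cat.
rewrite pairwise_cat pw1 pw2 !andbT; pose b0 : block T := Block (nil_tuple T) (nil_tuple T).
have mem_flat (f : block T -> seq T) bs i x : (i < size bs)%N -> x \in f (nth b0 bs i) ->
    x \in flatten [seq f b | b <- bs].
  move=> ib xf; apply/flattenP; exists (f (nth b0 bs i)) => //.
  by rewrite -(nth_map b0 [::]) // mem_nth ?size_map.
apply/(all_nthP b0) => i1 lt1; apply/(all_nthP b0) => i2 lt2; apply/uncoupledP=> j l jb lb.
apply: unc.
  by rewrite -(perm_mem pr2); apply: (mem_flat (fun b => (brow b : seq T))) jb.
by rewrite -(perm_mem pc1); apply: (mem_flat (fun b => (bcol b : seq T))) lb.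
Qed.

Lemma triangular_blocks_perm r r' c c' bs : perm_eq r r' -> perm_eq c c' ->
  triangular_blocks r c bs -> triangular_blocks r' c' bs.
Proof.
move=> rr' cc' [pos pr pc pw]; split=> //.
  exact: perm_trans pr rr'.
exact: perm_trans pc cc'.
Qed.

Definition irreducible_blocks bs := all (fun b => `[< block_irreducible G b >]) bs.

(** Splitting blocks as long as one of them is reducible. *)
Lemma irreducible_form_exists r c : size r = size c ->
  exists2 bs, triangular_blocks r c bs & irreducible_blocks bs.
Proof.
move: {2}(size r) (leqnn (size r)) => k; elim: k r c => [|k IH] r c.
  rewrite leqn0 => /nilP -> /esym/eqP/nilP ->; exists [::] => //.
move=> le szc; have [r0|r0] := posnP (size r).
  by apply: IH; rewrite // r0.
have [b [szb rb cb]] := block_exists szc.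
have [irr|/not_irreducible_split] := pselect (block_irreducible G b).
  exists [:: b]; last by rewrite /irreducible_blocks /= andbT; apply/asboolP.
  by split; rewrite /= ?cats0 ?rb ?cb ?szb ?r0.
have b_gt0 : (0 < bsize b)%N by rewrite szb.
rewrite rb cb => /(_ b_gt0) [r1 [r2 [c1 [c2 [pr pc [sz1 sz2] /andP[r1_gt0 r1_lt] unc]]]]].
rewrite szb in r1_lt.
have [|bs1 t1 i1] := IH r1 c1 _ sz1; first by rewrite -ltnS; apply: leq_trans r1_lt le.
have [|bs2 t2 i2] := IH r2 c2 _ sz2.
  rewrite -ltnS; apply: leq_trans le; rewrite -(perm_size pr) size_cat.
  by rewrite -[X in (X < _)%N]add0n ltn_add2r.
exists (bs1 ++ bs2); last by rewrite /irreducible_blocks all_cat; apply/andP.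
by apply: (triangular_blocks_perm pr pc); apply: triangular_blocks_cat.
Qed.

(** A row without nonzero entries can be moved to the bottom, as a block of size
    one together with an arbitrary column. *)
Lemma irreducible_row b j : block_irreducible G b -> (1 < bsize b)%N ->
  j \in (brow b : seq T) -> exists l, block_entry G b j l.
Proof.
move=> irr b1 jb; apply: contrapT => /forallNP none.
have [l lb] : exists l, l \in (bcol b : seq T).
  by exists (tnth (bcol b) (Ordinal (ltnW b1))); apply: mem_tnth.
have szr : size (rem j (brow b)) = size (rem l (bcol b)).
  by rewrite !size_rem // !size_tuple.
have [b1' [sz1 rb1 cb1]] := block_exists szr.
have [b2 [sz2 rb2 cb2]] := @block_exists [:: j] [:: l] erefl.
suff h : triangular_blocks (brow b) (bcol b) [:: b1'; b2].
  by have /irr := triangular_blocks_form b h.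
split.
- by rewrite /= sz1 sz2 size_rem // size_tuple -subn1 subn_gt0 b1.
- rewrite /= rb1 rb2 cats0 perm_sym; apply: perm_trans (perm_to_rem jb) _.
  by rewrite -cat1s perm_catC.
- rewrite /= cb1 cb2 cats0 perm_sym; apply: perm_trans (perm_to_rem lb) _.
  by rewrite -cat1s perm_catC.
rewrite /= !andbT rb2 cb1; apply/uncoupledP=> j' l'; rewrite inE => /eqP -> l'b.
apply/negP=> cpl; apply: (none l'); rewrite /block_entry jb cpl andbT.
exact: mem_rem l'b.
Qed.

End BlockForms.

(** * The block of an appendage subnetwork *)

Section AppendageBlock.
Variables (T : finType) (G : io_network T).
Local Notation e := (arrow G).
Local Notation inp := (inode G).
Local Notation out := (onode G).
Hypothesis coreG : core G.
Variable A : {set T}.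
Hypothesis hA : appendage_subnetwork G A.

(** As the diagonal entries are structurally nonzero, the last block of a
    triangular form has the same row and column labels.  No arrow leads from other nodes of [A] to
    these labels, so by strong connectivity there are no other nodes. *)
Lemma appendage_block_irreducible b : brow b = enum A :> seq T -> bcol b = enum A :> seq T ->
  block_irreducible G b.
Proof.
move=> rb cb m B [pos pr pc vanish]; rewrite rb in pr; rewrite cb in pc.
have [t tA] := appendage_subnetwork_neq0 hA.
case: m B pos pr pc vanish => [|m] B pos pr pc vanish.
  by have := perm_mem pr t; rewrite enum_ord0 mem_enum tA.
have memr i x : x \in (brow (B i) : seq T) -> x \in A.
  move=> xB; rewrite -(mem_enum A) -(perm_mem pr); apply/allpairsPdep.
  by exists i, x; rewrite mem_enum.
have colE x : x \in A -> exists i, x \in (bcol (B i) : seq T).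
  rewrite -(mem_enum A) -(perm_mem pc) => /allpairsPdep[i [y [_ yB ->]]]; by exists i.
have rowE x : x \in A -> exists i, x \in (brow (B i) : seq T).
  rewrite -(mem_enum A) -(perm_mem pr) => /allpairsPdep[i [y [_ yB ->]]]; by exists i.
have max_col j : j \in (brow (B ord_max) : seq T) -> j \in (bcol (B ord_max) : seq T).
  move=> jR; have [i ji] := colE j (memr _ _ jR).
  have [<-//|im] := eqVneq i ord_max.
  have lt : (i < @ord_max m)%N by rewrite ltn_neqAle im -ltnS ltn_ord.
  by have := vanish _ _ lt j j jR ji; rewrite /coupled eqxx.
have ur : uniq (brow (B ord_max)).
  apply: (@uniq_flatten_mem _ [seq (brow (B i) : seq T) | i <- enum 'I_m.+1]).
    rewrite -(eq_map (f := fun i => [seq x | x <- brow (B i)])) ?(perm_uniq pr) ?enum_uniq //.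
    by move=> i; rewrite map_id.
  by apply: (map_f (fun i => (brow (B i) : seq T))); rewrite mem_enum.
have max_row j : j \in (bcol (B ord_max) : seq T) -> j \in (brow (B ord_max) : seq T).
  have [] := uniq_min_size ur max_col; first by rewrite !size_tuple.
  by move=> _ /(_ j) <-.
have full x : x \in A -> x \in (brow (B ord_max) : seq T).
  move=> xA; apply: contraT => xR.
  have rR := mem_tnth (Ordinal (pos ord_max)) (brow (B ord_max)).
  have rA := memr _ _ rR; have xN : x \notin [set y in (brow (B ord_max) : seq T)] by rewrite in_set.
  have rN : tnth (brow (B ord_max)) (Ordinal (pos ord_max)) \in [set y in (brow (B ord_max) : seq T)].
    by rewrite in_set.
  have [w [z [/linkedR wA wN ewz /linkedL]]] := linked_enter (appendage_subnetwork_linked hA xA rA) xN rN.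
  rewrite in_setI in_set => /andP[_ zR]; rewrite in_set in wN.
  have [i wi] := colE w wA.
  have lt : (i < @ord_max m)%N.
    rewrite ltn_neqAle -ltnS ltn_ord andbT; apply: contraNneq wN => /val_inj E.
    by apply: max_row; rewrite -E.
  by have := vanish _ _ lt z w zR wi; rewrite /coupled ewz orbT.
case: m B pos pr pc vanish memr colE rowE max_col ur max_row full => // m B pos pr _ _ memr _ _ _ _ _ full.
have : uniq [seq x | i <- enum 'I_m.+2, x <- brow (B i)] by rewrite (perm_uniq pr) enum_uniq.
rewrite (allpairs_split (fun i => (brow (B i) : seq T))) cat_uniq => /and3P[_ /hasPn dis _].
pose x := tnth (brow (B ord0)) (Ordinal (pos ord0)).
have xB : x \in (brow (B ord0) : seq T) := mem_tnth _ _.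
have : x \in flatten [seq (brow (B (lift ord0 i)) : seq T) | i <- enum 'I_m.+1].
  apply/flattenP; exists (brow (B ord_max) : seq T); last by apply: full; apply: memr xB.
  apply/mapP; exists ord_max; first by rewrite mem_enum.
  by congr (brow (B _) : seq T); apply: val_inj.
by move=> /dis; rewrite /= xB.
Qed.

Lemma appendage_block_subnetwork b : perm_eq (brow b) (enum A) -> perm_eq (bcol b) (enum A) ->
  homeostasis_subnetwork G b = full_subnetwork G A.
Proof.
move=> rb cb; have entryE j l : block_entry G b j l = [&& j \in A, l \in A & coupled G j l].
  by rewrite /block_entry (perm_mem rb) (perm_mem cb) !mem_enum.
congr Subnetwork; apply/setP=> x; rewrite !in_set.
  apply/existsP/idP => [[y]|xA]; first by rewrite !entryE => /orP[] /and3P[].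
  by exists x; rewrite !entryE xA /coupled eqxx.
rewrite entryE /coupled eq_sym; case: (x.1 =P x.2) => [->|_] /=; rewrite ?andbF ?andbT //=.
by rewrite andbCA.
Qed.

(** Ordering the blocks: first those reached from [A] by alternating between
    coupled entries and the matching given by a simple path from input to
    output, then [A], then the others. *)
Lemma appendage_block_exists :
  exists b, [/\ homeostasis_block G b, brow b = enum A :> seq T & bcol b = enum A :> seq T].
Proof.
have [p [pp pS]] := linked_io_simple_path (io_linked coreG).
have [pe /eqP lp up] : [/\ path e inp p, last inp p == out & uniq (inp :: p)] by apply/and3P.
have [s [[si sc] sE]] := path_configuration pe up; rewrite lp in si.
have sA a : a \in A -> s a = a.
  move=> aA; rewrite sE prev_notin //; apply/negP=> /pS aS.
  by have := appendage_subnetwork_sub hA aA; rewrite in_setC aS.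
have iA := appendage_subnetwork_inp coreG hA.
pose d := [rel j j' | (j' != inp) && coupled G j' (s j)].
(* Rerouting the matching along a cycle gives a configuration for [onode G]. *)
have closed t x : t \in A -> connect d t x -> connect d x t -> x \in A.
  move=> tA tx xt; apply: contraT => xA.
  have lset y z : connect d y z -> linked d setT y z.
    by case/connectP=> q pq ->; apply: path_linked => // w _; rewrite in_setT.
  have [z [q [cq uq _ zA lA]]] := crossing_cycle tA xA (lset _ _ tx) (lset _ _ xt).
  have [r rE] := prev_perm_exists uq.
  have conf : configuration G out (r * s)%g.
    split=> [|j ji]; rewrite permM rE.
      rewrite prev_notin //; apply/negP=> iq.
      by have := prev_cycle cq iq; rewrite /= eqxx.
    have [jq|jq] := boolP (j \in z :: q); last by rewrite prev_notin // sc.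
    by have := prev_cycle cq jq => /= /andP[].
  have := appendage_subnetwork_invariant coreG hA conf zA; rewrite permM rE prev_head // => sl.
  by have := sA _ sl => /perm_inj E; rewrite E (negPf lA) in sl.
pose R1 := [set j | (j \notin A) && (j != inp) && [exists t in A, connect d t j]].
pose R3 := ~: (inp |: (A :|: R1)).
have R1P j : j \in R1 -> [/\ j \notin A, j != inp & exists2 t, t \in A & connect d t j].
  by rewrite in_set => /andP[/andP[jA ji] /exists_inP].
have toR1 j t : t \in A -> connect d t j -> j \notin A -> j != inp -> j \in R1.
  by move=> tA tj jA ji; rewrite in_set jA ji /=; apply/exists_inP; exists t.
have R3P j : j \in R3 -> [/\ j \notin A, j != inp & j \notin R1].
  by rewrite in_setC in_setU1 in_setU !negb_or => /and3P[].
have szm (D : {set T}) : size (enum D) = size (map s (enum D)) by rewrite size_map.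
have [bs1 tri1 irr1] := irreducible_form_exists G (szm R1).
have [bs3 tri3 irr3] := irreducible_form_exists G (szm R3).
have [b [szb rb cb]] := @block_exists _ (enum A) (enum A) erefl.
have [t0 t0A] := appendage_subnetwork_neq0 hA.
have triA : triangular_blocks G (enum A) (map s (enum A)) [:: b].
  split; rewrite /= ?cats0 ?rb ?cb //.
    by rewrite szb -cardE (cardD1 t0) t0A.
  suff -> : map s (enum A) = enum A by [].
  by rewrite -[RHS]map_id; apply/eq_in_map => a; rewrite mem_enum => /sA.
have tri : triangular_blocks G (enum R1 ++ (enum A ++ enum R3))
    (map s (enum R1) ++ (map s (enum A) ++ map s (enum R3))) (bs1 ++ ([:: b] ++ bs3)).
  apply: triangular_blocks_cat => //; first apply: triangular_blocks_cat => //.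
    apply/uncoupledP=> j l; rewrite mem_enum => /R3P[jA ji jR] /mapP[a]; rewrite mem_enum => aA ->.
    apply/negP=> cpl; case/negP: jR; apply: (toR1 _ _ aA _ jA ji); apply: connect1.
    by rewrite /= ji.
  apply/uncoupledP=> j l; rewrite mem_cat !mem_enum => jAR /mapP[a]; rewrite mem_enum => /R1P[aA ai [t tA ta]] ->.
  apply/negP=> cpl; have ji : j != inp by case/orP: jAR => [jA|/R3P[]//]; apply: contraNneq iA => <-.
  have aj : connect d a j by apply: connect1; rewrite /= ji.
  case/orP: jAR => [jA|/R3P[jA _]]; last by rewrite (toR1 _ _ tA (connect_trans ta aj)).
  case/negP: aA; apply: (closed t) => //; apply: connect_trans aj _.
  have AE y z : y \in A -> z \in A -> connect d y z.
    move=> yA zA; have [q [pq <- _ sq]] := linked_path (appendage_subnetwork_linked hA yA zA).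
    elim: q y yA pq sq => //= w q IH y yA /andP[yw pq] sq.
    have wA : w \in A by apply: sq; rewrite !inE eqxx orbT.
    apply: connect_trans (connect1 _) (IH w wA pq _); last by move=> v vq; apply: sq; rewrite in_cons vq orbT.
    by rewrite /= sA // /coupled yw orbT andbT; apply: contraNneq iA => <-.
  exact: AE.
have rowsE : perm_eq (enum R1 ++ (enum A ++ enum R3)) (enum [set~ inp]).
  apply: uniq_perm; rewrite ?enum_uniq //.
    rewrite !cat_uniq !enum_uniq /= andbT; apply/andP; split; apply/hasPn=> x;
      rewrite ?mem_cat !mem_enum.
      by case/orP=> [xA|/R3P[]//]; apply/negP=> /R1P[]; rewrite xA.
    by case/R3P.
  move=> x; rewrite !mem_cat !mem_enum [in RHS]in_setC in_set1.
  have [->|xi] := eqVneq x inp; last first.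
    by rewrite /R3 in_setC in_setU1 in_setU (negPf xi) /=; case: (x \in A); case: (x \in R1).
  apply/negP=> /or3P[/R1P[]|iA'|/R3P[]]; rewrite ?eqxx //.
  by rewrite iA' in iA.
have colsE : perm_eq (map s (enum R1) ++ (map s (enum A) ++ map s (enum R3))) (enum [set~ out]).
  rewrite -!map_cat; apply: (@perm_trans _ (map s (enum [set~ inp]))); first exact: perm_map.
  apply: uniq_perm; rewrite ?enum_uniq ?map_inj_uniq ?enum_uniq //; first exact: perm_inj.
  move=> x; rewrite mem_enum in_setC in_set1 -si; apply/mapP/idP => [[y]|xs].
    by rewrite mem_enum in_setC in_set1 => yi ->; rewrite (inj_eq perm_inj).
  exists (s^-1 x)%g; last by rewrite permKV.
  rewrite mem_enum in_setC in_set1; apply: contraNneq xs => <-; by rewrite permKV.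
have {}tri := triangular_blocks_perm rowsE colsE tri.
have bs_irr : irreducible_blocks G (bs1 ++ ([:: b] ++ bs3)).
  rewrite /irreducible_blocks !all_cat; apply/and3P; split=> //.
  by rewrite /= andbT; apply/asboolP; apply: appendage_block_irreducible.
exists b; split=> //; exists (size (bs1 ++ [:: b] ++ bs3)), (fun i => tnth (in_tuple (bs1 ++ [:: b] ++ bs3)) i).
split; first exact: triangular_blocks_form.
  by move=> i; rewrite (tnth_nth b); apply/asboolP; apply: (all_nthP b bs_irr); rewrite ltn_ord.
have lt : (size bs1 < size (bs1 ++ [:: b] ++ bs3))%N by rewrite size_cat /= addnS ltnS leq_addr.
by exists (Ordinal lt); rewrite (tnth_nth b) /= nth_cat ltnn subnn.
Qed.

(** The arrows between the nodes of [A] make each of them a row label and a column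
    label.  Any other row would have no nonzero entry, which contradicts
    [irreducible_row]. *)
Lemma homeostasis_block_labels b : homeostasis_block G b ->
  homeostasis_subnetwork G b = full_subnetwork G A ->
  perm_eq (brow b) (enum A) /\ perm_eq (bcol b) (enum A).
Proof.
case=> m [B [[pos pr pc _] irr [i0 Bb]]] E.
have [t tA] := appendage_subnetwork_neq0 hA.
have ur : uniq (brow b).
  apply: (@uniq_flatten_mem _ [seq (brow (B i) : seq T) | i <- enum 'I_m]).
    rewrite -(eq_map (f := fun i => [seq x | x <- brow (B i)])) ?(perm_uniq pr) ?enum_uniq //.
    by move=> i; rewrite map_id.
  by rewrite -Bb; apply: (map_f (fun i => (brow (B i) : seq T))); rewrite mem_enum.
have uc : uniq (bcol b).
  apply: (@uniq_flatten_mem _ [seq (bcol (B i) : seq T) | i <- enum 'I_m]).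
    rewrite -(eq_map (f := fun i => [seq x | x <- bcol (B i)])) ?(perm_uniq pc) ?enum_uniq //.
    by move=> i; rewrite map_id.
  by rewrite -Bb; apply: (map_f (fun i => (bcol (B i) : seq T))); rewrite mem_enum.
have {}irr : block_irreducible G b by rewrite -Bb.
have nodesE x : [exists y, block_entry G b x y || block_entry G b y x] = (x \in A).
  by have /setP/(_ x) := congr1 (@sub_nodes _) E; rewrite in_set.
have arrowsE x y : block_entry G b y x && (y != x) = [&& x \in A, y \in A, x != y & e x y].
  by have /setP/(_ (x, y)) := congr1 (@sub_arrows _) E; rewrite !in_set.
have entryA j l : block_entry G b j l -> j \in A /\ l \in A.
  by move=> jl; split; rewrite -nodesE; apply/existsP; [exists l | exists j]; rewrite jl ?orbT.
have sub x : x \in A -> x \in (brow b : seq T) /\ x \in (bcol b : seq T).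
  move=> xA; have [[y [yA yx]]|one] := pselect (exists y, y \in A /\ y != x).
    have out_arrow u v : u \in A -> v \in A -> v != u -> exists w, block_entry G b w u.
      move=> uA vA vu; have uN : u \in [set u] by rewrite inE.
      have vN : v \notin [set u] by rewrite inE.
      have [z [w [uz ezw wu wv]]] := linked_exit (appendage_subnetwork_linked hA uA vA) uN vN.
      have := linkedR uz; rewrite in_setI in_set1 => /andP[_ /eqP zu]; subst z.
      exists w; have /andP[] // : block_entry G b w u && (w != u).
      by rewrite arrowsE uA (linkedL wv) ezw andbT /= eq_sym; rewrite in_set1 in wu.
    have in_arrow u v : u \in A -> v \in A -> v != u -> exists w, block_entry G b u w.
      move=> uA vA vu; have uN : u \in [set u] by rewrite inE.
      have vN : v \notin [set u] by rewrite inE.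
      have [w [z [vw wu ewz zu']]] := linked_enter (appendage_subnetwork_linked hA vA uA) vN uN.
      have := linkedL zu'; rewrite in_setI in_set1 => /andP[_ /eqP zu]; subst z.
      exists w; have /andP[] // : block_entry G b u w && (u != w).
      by rewrite arrowsE uA (linkedR vw) ewz andbT; rewrite in_set1 in wu.
    have [w /and3P[_ xc _]] := out_arrow x y xA yA yx.
    by have [w' /and3P[xr _ _]] := in_arrow x y xA yA yx.
  have only y : y \in A -> y = x.
    by move=> yA; apply/eqP; apply: contraT => yx; case: one; exists y.
  move: xA; rewrite -nodesE => /existsP[y /orP[] h]; have [/only E1 /only E2] := entryA _ _ h;
    by move: h; rewrite ?E1 ?E2 => /and3P[].
have szA : (#|A| <= bsize b)%N.
  rewrite cardE -[bsize b](size_tuple (brow b)); apply: uniq_leq_size; first exact: enum_uniq.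
  by move=> x; rewrite mem_enum => /sub[].
have rowA j : j \in (brow b : seq T) -> j \in A.
  move=> jb; have [b1|b1] := ltnP 1 (bsize b).
    by have [l /entryA[]] := irreducible_row irr b1 jb.
  have [tr _] := sub t tA.
  have sz1 : size (brow b) = 1%N.
    apply/eqP; rewrite eqn_leq size_tuple b1 /=; apply: leq_trans szA.
    by rewrite (cardD1 t) tA.
  by move: jb tr; case: (tval (brow b)) sz1 => [|a []] // _; rewrite !inE => /eqP -> /eqP <-.
have pr' : perm_eq (brow b) (enum A).
  apply: uniq_perm; rewrite ?enum_uniq // => x; rewrite mem_enum; apply/idP/idP => [/rowA//|/sub[]//].
split=> //; rewrite perm_sym; apply: uniq_perm; rewrite ?enum_uniq //.
have [] // := @uniq_min_size _ (enum A) (bcol b) (enum_uniq _) _ _.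
  by move=> x; rewrite mem_enum => /sub[].
by rewrite size_tuple -(perm_size pr') size_tuple.
Qed.

End AppendageBlock.

Import Order.TTheory GRing.Theory Num.Theory.
Import numFieldNormedType.Exports.
Local Open Scope ring_scope.

(** * Singular blocks and cofactors *)

Section Singular.
Variables (R : realType) (n : nat) (G : io_network 'I_n).
Local Notation e := (arrow G).
Local Notation inp := (inode G).
Implicit Types (J : 'M[R]_n) (A : {set 'I_n}) (u w : 'rV[R]_n).

(** The principal submatrix of [J] on [A] is singular, expressed through a row
    vector of its left kernel. *)
Definition singular_on A J := exists u, [/\ u != 0, forall i, i \notin A -> u 0 i = 0
  & forall k, k \in A -> (u *m J) 0 k = 0].

Lemma det_block_singular A J (b : block 'I_n) : perm_eq (brow b) (enum A) ->
  perm_eq (bcol b) (enum A) -> \det (block_mx J b) = 0 <-> singular_on A J.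
Proof.
move=> rb cb.
have rowA a : tnth (brow b) a \in A by rewrite -mem_enum -(perm_mem rb) mem_tnth.
have colA k : k \in A -> exists c, k = tnth (bcol b) c.
  by rewrite -mem_enum -(perm_mem cb) => /tnthP.
have ur : uniq (brow b) by rewrite (perm_uniq rb) enum_uniq.
split=> [/eqP/det0P[v v0 vb]|[u [u0 uA uJ]]].
  exists (\row_i \sum_(a < bsize b | tnth (brow b) a == i) v 0 a); split.
  - case/rV0Pn: v0 => a va; apply/rV0Pn; exists (tnth (brow b) a); rewrite mxE.
    rewrite (big_pred1 a) // => a' /=; apply/eqP/eqP => [|-> //].
    by move/(tuple_uniqP _ ur).
  - move=> i iA; rewrite mxE big_pred0 // => a; apply: contraNF iA => /eqP <-; exact: rowA.
  move=> k /colA[c ->]; have := congr1 (fun v : 'rV[R]_(bsize b) => v 0 c) vb => vbc.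
  rewrite [LHS]mxE [RHS]mxE in vbc; apply: etrans vbc; rewrite mxE.
  rewrite (eq_bigr (fun i => \sum_(a < bsize b | tnth (brow b) a == i) v 0 a * J i (tnth (bcol b) c)));
    last by move=> i _; rewrite mxE; rewrite mulr_suml.
  rewrite (exchange_big_dep xpredT) //=; apply: eq_bigr => a _.
  by rewrite (big_pred1 (tnth (brow b) a)) ?mxE // => i /=; rewrite eq_sym.
apply/eqP/det0P; exists (\row_a u 0 (tnth (brow b) a)).
  case/rV0Pn: u0 => i ui; apply/rV0Pn.
  have : i \in (brow b : seq 'I_n).
    by rewrite (perm_mem rb) mem_enum; apply: contraT => /uA iA; rewrite iA eqxx in ui.
  by case/tnthP=> a ai; exists a; rewrite mxE -ai.
apply/rowP=> c; rewrite !mxE.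
have cA : tnth (bcol b) c \in A by rewrite -mem_enum -(perm_mem cb) mem_tnth.
apply: etrans (uJ _ cA); rewrite [RHS]mxE [RHS](bigID (mem A)) /= [X in _ = _ + X]big1 ?addr0; last first.
  by move=> i iA; rewrite uA // mul0r.
rewrite -[RHS]big_enum -[RHS](perm_big _ rb) [RHS]big_tuple; apply: eq_bigr => a _.
by rewrite !mxE.
Qed.

(** Its determinant is the cofactor, whose expansion thereby ranges over all
    permutations of the nodes. *)
Definition cofactor_mx (k : 'I_n) J : 'M[R]_n :=
  \matrix_(i, j) if i == inp then (j == k)%:R else J i j.

Lemma det_cofactor_mx k J : \det (cofactor_mx k J) = cofactor J inp k.
Proof.
rewrite (expand_det_row _ inp) (bigD1 k) //= big1 ?addr0 => [|j jk].
  rewrite mxE eqxx eqxx mul1r; congr (_ * \det _); apply/matrixP=> i j.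
  by rewrite !mxE eq_sym (negPf (neq_lift _ _)).
by rewrite mxE eqxx (negPf jk) mul0r.
Qed.

(** Only configurations contribute to the expansion of the determinant, and
    these preserve [A]: the entries between [A] and its complement can be
    replaced by zero. *)
Lemma invariant_cofactor0 A k J : inp \notin A -> network_mx G J -> config_invariant G A k ->
  singular_on A J -> cofactor J inp k = 0.
Proof.
move=> iA nJ inv [u [u0 uA uJ]]; rewrite -det_cofactor_mx.
pose M : 'M[R]_n := \matrix_(i, j) if (i \in A) == (j \in A) then cofactor_mx k J i j else 0.
have -> : \det (cofactor_mx k J) = \det M.
  rewrite /determinant; apply: eq_bigr => s _; congr (_ * _).
  have [[sk sc]|nconf] := pselect (configuration G k s).
    apply: eq_bigr => i _; rewrite [RHS]mxE.
    have -> : (s i \in A) = (i \in A).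
      have inv' := inv s (conj sk sc).
      have : [set s x | x in A] = A.
        apply/eqP; rewrite eqEcard; apply/andP; split.
          by apply/fintype.subsetP=> _ /imsetP[x xA ->]; apply: inv'.
        by rewrite card_imset //; apply: perm_inj.
      by move=> E; rewrite -[in LHS]E mem_imset //; apply: perm_inj.
    by rewrite eqxx.
  have [i z] : exists i, cofactor_mx k J i (s i) = 0.
    apply: contrapT => /forallNP nz; apply: nconf; split.
      apply/eqP; have := nz inp; rewrite mxE eqxx; case: eqP => // _ []; reflexivity.
    move=> j ji; have := nz j; rewrite mxE (negPf ji) => Jj.
    by apply: contraT => /nJ.
  rewrite (bigD1 i) //= z mul0r (bigD1 i) //= [M _ _]mxE z; case: ifP; by rewrite mul0r.
apply/eqP/det0P; exists u => //; apply/rowP=> j; rewrite !mxE.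
have [jA|jA] := boolP (j \in A).
  apply: etrans (uJ _ jA); rewrite [RHS]mxE; apply: eq_bigr => i _.
  have [iA'|/uA ->] := boolP (i \in A); last by rewrite !mul0r.
  by rewrite !mxE iA' jA eqxx; case: eqP iA' iA => // -> ->.
apply: big1 => i _; have [iA'|/uA ->] := boolP (i \in A); last by rewrite mul0r.
by rewrite mxE iA' (negPf jA) mulr0.
Qed.

(** The matrix of the configuration has a unit cofactor, while its row [j] vanishes
    on [A]. *)
Lemma configuration_witness A k s j : inp \notin A -> configuration G k s ->
  j \in A -> s j \notin A -> exists J, [/\ network_mx G J, singular_on A J & cofactor J inp k != 0].
Proof.
move=> iA [sk sc] jA sjA.
pose J : 'M[R]_n := \matrix_(i, l) ((i != inp) && (l == s i))%:R.
exists J; split.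
- move=> i l; rewrite mxE; have [->//|ii] := eqVneq i inp.
  by have [->|//] := eqVneq l (s i); rewrite sc.
- exists (delta_mx 0 j); split.
  + by apply/rV0Pn; exists j; rewrite mxE !eqxx oner_neq0.
  + move=> i iA'; rewrite mxE; case: (i =P j) => [E|_]; last by rewrite andbF.
    by rewrite E jA in iA'.
  move=> l lA; rewrite -rowE !mxE; have [E|//] := eqVneq l (s j); last by rewrite andbF.
  by rewrite -E lA in sjA.
rewrite -det_cofactor_mx (_ : cofactor_mx k J = perm_mx s); first by rewrite det_perm signr_eq0.
apply/matrixP=> i l; rewrite !mxE.
have [->|ii] /= := eqVneq i inp; first by rewrite sk eq_sym.
by rewrite eq_sym.
Qed.

End Singular.

(** * The variety of singular network matrices is irreducible *)

Section Irreducible.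
Variables (R : realType) (n : nat) (G : io_network 'I_n).
Local Notation e := (arrow G).
Implicit Types (J : 'M[R]_n) (A : {set 'I_n}) (u w : 'rV[R]_n) (F : 'M[R]_n -> R -> R).

Lemma poly_nonroot (p : {poly R}) : p != 0 -> exists t, p.[t] != 0.
Proof.
move=> p0; apply: contrapT => /forallNP h.
have := max_poly_roots (rs := [seq i%:R | i <- iota 0 (size p)]) p0.
rewrite size_map size_iota ltnn => none; suff : false by []; apply: none.
- by apply/allP=> _ /mapP[i _ ->]; apply/eqP; have /negP := h i%:R; rewrite negbK => /eqP.
- rewrite map_inj_uniq ?iota_uniq // => i j /eqP; rewrite eqr_nat => /eqP //.
Qed.

(** Functions of a matrix and a scalar that are polynomial along every
    polynomial curve; in particular, polynomial functions of the entries. *)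
Definition curve_poly F := forall (J : 'M[{poly R}]_n) (s : {poly R}),
  exists p : {poly R}, forall t, F (map_mx (horner_eval t) J) s.[t] = p.[t].

Lemma curve_polyM F F' : curve_poly F -> curve_poly F' ->
  curve_poly (fun J s => F J s * F' J s).
Proof.
move=> cF cF' J s; have [p pE] := cF J s; have [p' pE'] := cF' J s.
by exists (p * p') => t; rewrite hornerM pE pE'.
Qed.

Variable A : {set 'I_n}.
Hypothesis strong : forall x y, x \in A -> y \in A -> linked e A x y.

Definition singular_point J := network_mx G J /\ singular_on A J.

Definition zeros u := [set i in A | u 0 i == 0].

Lemma zerosP u i : (i \in zeros u) = (i \in A) && (u 0 i == 0).
Proof. by rewrite inE. Qed.

(** A step towards a left kernel vector without zeros on [A], along a line of
    singular matrices on which [F] does not vanish identically.  Let [I0] be the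
    set of zeros of [u] on [A], and [k0 -> j0] an arrow that leaves it.  There is
    a nonzero vector [w] on [I0] that annihilates the columns of [I0] other than [k0]; every other
    column has a structurally nonzero entry in a row where [u] does not vanish,
    which is used to make [u + t w] a kernel vector for every [t]. *)
Lemma kernel_vector_step F J s u : curve_poly F -> network_mx G J -> F J s != 0 ->
  u != 0 -> (forall i, i \notin A -> u 0 i = 0) -> (forall k, k \in A -> (u *m J) 0 k = 0) ->
  (exists2 i, i \in A & u 0 i = 0) ->
  exists J' u', [/\ network_mx G J', F J' s != 0, forall i, i \notin A -> u' 0 i = 0,
    forall k, k \in A -> (u' *m J') 0 k = 0
    & (#|zeros u'| < #|zeros u|)%N /\ u' != 0].
Proof.
move=> cF nJ FJ u0 uA uJ [x xA ux]; pose I0 := zeros u.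
have [y yu] := rV0Pn _ u0; have yA : y \in A by apply: contraT => /uA E; rewrite E eqxx in yu.
have xI : x \in I0 by rewrite zerosP xA ux eqxx.
have yI : y \notin I0 by rewrite zerosP yA (negPf yu).
have [k0 [j0 [/linkedR k0I ekj j0I /linkedL j0A]]] := linked_exit (strong xA yA) xI yI.
have {}k0I : k0 \in I0 by move: k0I; rewrite inE => /andP[].
have uj0 : u 0 j0 != 0 by move: j0I; rewrite zerosP j0A.
pose M : 'M[R]_n := \matrix_(i, k) if k \in I0 then (if (k != k0) && (i \in I0) then J i k else 0)
  else (i == k)%:R.
have [w w0 wM] : exists2 w : 'rV_n, w != 0 & w *m M = 0.
  apply/det0P; rewrite (expand_det_col _ k0) big1 // => i _.
  by rewrite mxE k0I eqxx mul0r.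
have wI k : k \notin I0 -> w 0 k = 0.
  move=> kI; have := congr1 (fun v : 'rV[R]_n => v 0 k) wM; rewrite !mxE (bigD1 k) //= big1 ?addr0.
    by rewrite mxE (negPf kI) eqxx mulr1.
  by move=> i ik; rewrite mxE (negPf kI) (negPf ik) mulr0.
have wJ k : k \in I0 -> k != k0 -> (w *m J) 0 k = 0.
  move=> kI kk; have E := congr1 (fun v : 'rV[R]_n => v 0 k) wM; rewrite [RHS]mxE in E; apply: etrans E.
  rewrite !mxE; apply: eq_bigr => i _; rewrite mxE kI kk /=; case: ifP => // /negbT/wI ->; by rewrite !mul0r.
pose C : 'M[R]_n := \matrix_(i, k) if i \in A :\: I0 then
    (i == k)%:R * ((w *m J) 0 k / u 0 i) + ((i == j0) && (k == k0))%:R * ((w *m J) 0 k / u 0 i) else 0.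
have I0A i : i \in I0 -> i \in A by rewrite zerosP => /andP[].
have uI i : i \in I0 -> u 0 i = 0 by rewrite zerosP => /andP[_ /eqP].
have uAI i : i \in A :\: I0 -> u 0 i != 0.
  by rewrite in_setD => /andP[iI iA]; move: iI; rewrite zerosP iA.
have uC k : k \in A -> (u *m C) 0 k = (w *m J) 0 k.
  move=> kA; rewrite mxE.
  have uCi i : i \in A :\: I0 -> u 0 i * C i k =
      ((i == k)%:R + ((i == j0) && (k == k0))%:R) * (w *m J) 0 k.
    move=> iAI; rewrite [C i k]mxE iAI; have := uAI _ iAI => ui.
    by field.
  rewrite (bigID (mem (A :\: I0))) /= [X in _ + X]big1 ?addr0; last first.
    by move=> i iAI; rewrite [C i k]mxE (negPf iAI) mulr0.
  rewrite (eq_bigr _ uCi) -mulr_suml big_split /=.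
  have j0AI : j0 \in A :\: I0 by rewrite in_setD j0I.
  have [kI|kI] := boolP (k \in I0).
    rewrite big1 ?add0r; last first.
      by move=> i; rewrite in_setD => /andP[iI _]; case: eqP kI iI => // -> ->.
    have [kk|kk] := eqVneq k k0.
      rewrite (bigD1 j0) //= eqxx big1 ?addr0 ?mul1r // => i /andP[_ ij].
      by rewrite (negPf ij).
    by rewrite wJ // mulr0.
  have kAI : k \in A :\: I0 by rewrite in_setD kI.
  rewrite (bigD1 k) //= eqxx big1 ?addr0; last by move=> i /andP[_ /negPf->].
  rewrite big1 ?addr0 ?mul1r // => i _; case: (k =P k0) => [E|_]; last by rewrite andbF.
  by rewrite E k0I in kI.
have wC k : (w *m C) 0 k = 0.
  rewrite mxE big1 // => i _; rewrite [C i k]mxE; case: ifP; last by rewrite mulr0.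
  by rewrite in_setD => /andP[/wI -> _]; rewrite mul0r.
pose Jt : 'M[{poly R}]_n := map_mx polyC J - 'X *: map_mx polyC C.
have [p pE] := cF Jt s%:P.
have JtE t : map_mx (horner_eval t) Jt = J - t *: C.
  apply/matrixP=> i k; rewrite !mxE /horner_eval !hornerE //.
have p0 : p.[0] != 0 by rewrite -pE JtE scale0r subr0 hornerC.
have pX : p * 'X != 0.
  by rewrite mulf_neq0 ?polyX_eq0 //; apply: contraNneq p0 => ->; rewrite horner0.
have [t] := poly_nonroot pX; rewrite hornerM hornerX mulf_eq0 negb_or => /andP[pt t0].
exists (J - t *: C), (u + t *: w); split.
- move=> j l njl; rewrite !mxE nJ // sub0r; case: ifP; last by rewrite mulr0 oppr0.
  move=> _; have -> : (j == l) = false by apply: contraNF njl => /eqP->; rewrite /coupled eqxx.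
  have -> : (j == j0) && (l == k0) = false.
    by apply: contraNF njl => /andP[/eqP-> /eqP->]; rewrite /coupled ekj orbT.
  by rewrite !mul0r addr0 mulr0 oppr0.
- by rewrite -JtE -[s](hornerC _ t) pE.
- move=> i iA; rewrite !mxE uA // wI ?mulr0 ?addr0 //; apply: contra iA; exact: I0A.
- move=> k kA; rewrite mulmxDl !mulmxBr -!scalemxAl -!scalemxAr.
  move: (uJ k kA) (uC k kA) (wC k).
  move: (u *m J) (u *m C) (w *m J) (w *m C) => a b a' b' ak bk b'k.
  by rewrite !mxE ak bk b'k; ring.
split; last first.
  by apply/rV0Pn; exists y; rewrite !mxE wI ?mulr0 ?addr0.
have [i wi] := rV0Pn _ w0; have iI : i \in I0 by apply: contraT => /wI E; rewrite E eqxx in wi.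
apply: proper_card; apply/properP; split.
  apply/fintype.subsetP=> a; rewrite !zerosP !mxE => /andP[aA E]; rewrite aA /=.
  by apply: contraTT E => ua; rewrite wI ?mulr0 ?addr0 // zerosP aA.
exists i => //; rewrite zerosP (I0A _ iI) !mxE uI // add0r mulf_eq0 negb_or t0 //=.
Qed.

Lemma kernel_vector_full F J s : curve_poly F -> singular_point J -> F J s != 0 ->
  exists J' u, [/\ network_mx G J', F J' s != 0, u != 0, forall i, (i \in A) = (u 0 i != 0)
    & forall k, k \in A -> (u *m J') 0 k = 0].
Proof.
move=> cF [nJ [u [u0 uA uJ]]] FJ.
move: {2}#|zeros u| (leqnn #|zeros u|) => m.
elim: m J u nJ u0 uA uJ FJ => [|m IH] J u nJ u0 uA uJ FJ.
  rewrite leqn0 cards_eq0 => /eqP I0; exists J, u; split=> // i; apply/idP/idP.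
    by move=> iA; apply: contraT; rewrite negbK => ui; have := in_set0 i; rewrite -I0 zerosP iA ui.
  by apply: contraNT => /uA ->.
move=> le; have [ex|none] := pselect (exists2 i, i \in A & u 0 i = 0).
  have [J' [u' [nJ' FJ' uA' uJ' [lt u0']]]] := kernel_vector_step cF nJ FJ u0 uA uJ ex.
  by apply: (IH J' u') => //; rewrite -ltnS; apply: leq_trans lt le.
apply: (IH J u) => //; rewrite (_ : zeros u = set0) ?cards0 //.
apply/setP=> i; rewrite zerosP in_set0; apply/negP=> /andP[iA /eqP ui]; apply: none; exists i => //.
Qed.

(** By [kernel_vector_full] it suffices to join two matrices whose left kernel
    vectors have no zeros on [A].  Such matrices are products [diag(d) M] where
    the entries over [A] of each column of [M] in [A] sum to zero; a segment in
    the vector space of the pairs [(d, M)] is mapped to a polynomial curve of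
    singular matrices, along which neither function vanishes identically. *)
Lemma singular_points_irreducible F F' : curve_poly F -> curve_poly F' ->
  (exists J s, singular_point J /\ F J s != 0) -> (exists J s, singular_point J /\ F' J s != 0) ->
  exists J s, singular_point J /\ F J s * F' J s != 0.
Proof.
move=> cF cF' [J0' [s0 [Z0 F0]]] [J1' [s1 [Z1 F1]]].
have [J0 [u0 [nJ0 {}F0 u0n u0A u0J]]] := kernel_vector_full cF Z0 F0.
have [J1 [u1 [nJ1 {}F1 u1n u1A u1J]]] := kernel_vector_full cF' Z1 F1.
pose seg (a b : R) : {poly R} := (1 - 'X) * a%:P + 'X * b%:P.
have segE a b t : (seg a b).[t] = (1 - t) * a + t * b by rewrite /seg !hornerE.
pose d i := if i \in A then seg (u0 0 i)^-1 (u1 0 i)^-1 else 1.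
pose c (u : 'rV[R]_n) J i k := if i \in A then u 0 i * J i k else J i k.
pose M i k := seg (c u0 J0 i k) (c u1 J1 i k).
pose Jt : 'M[{poly R}]_n := \matrix_(i, k) (d i * M i k).
have JtE t : map_mx (horner_eval t) Jt = \matrix_(i, k) ((d i).[t] * (M i k).[t]).
  by apply/matrixP=> i k; rewrite !mxE /horner_eval hornerM.
have Jt0 : map_mx (horner_eval 0) Jt = J0.
  rewrite JtE; apply/matrixP=> i k; rewrite mxE /M segE subr0 mul1r mul0r addr0 /d /c.
  case: ifP => iA; last by rewrite hornerC mul1r.
  by rewrite segE subr0 mul1r mul0r addr0 mulrA mulVf ?mul1r // -u0A.
have Jt1 : map_mx (horner_eval 1) Jt = J1.
  rewrite JtE; apply/matrixP=> i k; rewrite mxE /M segE subrr mul1r mul0r add0r /d /c.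
  case: ifP => iA; last by rewrite hornerC mul1r.
  by rewrite segE subrr mul1r mul0r add0r mulrA mulVf ?mul1r // -u1A.
have [p pE] := cF Jt (seg s0 s1); have [q qE] := cF' Jt (seg s0 s1).
have p0 : p != 0.
  by apply: contraNneq F0 => p0; rewrite -Jt0 -[s0](_ : (seg s0 s1).[0] = s0) ?pE ?p0 ?horner0 //
    segE subr0 mul1r mul0r addr0.
have q0 : q != 0.
  by apply: contraNneq F1 => q0; rewrite -Jt1 -[s1](_ : (seg s0 s1).[1] = s1) ?qE ?q0 ?horner0 //
    segE subrr mul1r mul0r add0r.
have [t] := poly_nonroot (mulf_neq0 p0 q0); rewrite hornerM -pE -qE => nz.
exists (map_mx (horner_eval t) Jt), (seg s0 s1).[t]; split=> //; split.
  move=> j l njl; rewrite JtE mxE /M segE /c nJ0 // nJ1 //.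
  by case: ifP; rewrite !mulr0 ?addr0 mulr0.
have colsum (u : 'rV[R]_n) J k : (forall i, (i \in A) = (u 0 i != 0)) ->
    (forall k, k \in A -> (u *m J) 0 k = 0) -> k \in A -> \sum_(i in A) c u J i k = 0.
  move=> uA uJ kA; apply: etrans (uJ k kA); rewrite [RHS]mxE [RHS](bigID (mem A)) /= [X in _ = _ + X]big1 ?addr0.
    by apply: eq_bigr => i iA; rewrite /c iA.
  by move=> i; rewrite uA negbK => /eqP ->; rewrite mul0r.
have Msum k : k \in A -> \sum_(i in A) (M i k).[t] = 0.
  move=> kA; under eq_bigr do rewrite segE.
  by rewrite big_split /= -!mulr_sumr (colsum _ _ _ u0A) // (colsum _ _ _ u1A) // !mulr0 addr0.
have [[i iA di]|nz_d] := pselect (exists2 i, i \in A & (d i).[t] = 0).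
  exists (delta_mx 0 i); split.
  - by apply/rV0Pn; exists i; rewrite mxE !eqxx oner_neq0.
  - move=> j jA; rewrite mxE; case: (j =P i) => [E|_]; last by rewrite andbF.
    by rewrite E iA in jA.
  by move=> k kA; rewrite -rowE JtE !mxE di mul0r.
exists (\row_i if i \in A then (d i).[t]^-1 else 0); split.
- have [i ui] := rV0Pn _ u0n; have iA : i \in A by rewrite u0A.
  apply/rV0Pn; exists i; rewrite mxE iA invr_eq0; apply/eqP=> di; apply: nz_d; by exists i.
- by move=> i iA; rewrite mxE (negPf iA).
move=> k kA; apply: etrans (Msum k kA); rewrite mxE [LHS](bigID (mem A)) /= [X in _ + X]big1 ?addr0.
  apply: eq_bigr => i iA; rewrite JtE !mxE iA mulrA mulVf ?mul1r //.
  by apply/eqP=> di; apply: nz_d; exists i.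
by move=> i iA; rewrite mxE (negPf iA) mul0r.
Qed.

End Irreducible.

(** * Polynomial conditions on the Jacobian *)

Section CurvePoly.
Variables (R : realType) (n : nat).
Implicit Types (J : 'M[R]_n) (F : 'M[R]_n -> R -> R).

Lemma curve_poly_entry i j : curve_poly (fun J (s : R) => J i j).
Proof. by move=> J s; exists (J i j) => t; rewrite mxE. Qed.

Lemma curve_poly_scalar : curve_poly (fun (J : 'M[R]_n) s => s).
Proof. by move=> J s; exists s. Qed.

Lemma curve_poly_cofactor i j : curve_poly (fun J (s : R) => cofactor J i j).
Proof. by move=> J s; exists (cofactor J i j) => t; rewrite cofactor_map_mx. Qed.

Lemma curve_poly_eval (P : mpoly.mpoly (n * n + 1) R) : curve_poly (eval_partials P).
Proof.
move=> J s; exists (\sum_(m <- mpoly.msupp P) (mpoly.mcoeff m P)%:P *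
  \prod_i (row_mx (mxvec J) s%:M 0 i) ^+ mpoly.fun_of_multinom m i) => t.
rewrite /eval_partials mpoly.mevalE horner_sum; apply: eq_bigr => m _.
rewrite hornerM hornerC horner_prod; congr (_ * _); apply: eq_bigr => i _.
rewrite horner_exp; congr (_ ^+ _).
have -> : row_mx (mxvec (map_mx (horner_eval t) J)) s.[t]%:M =
    map_mx (horner_eval t) (row_mx (mxvec J) s%:M).
  by rewrite map_row_mx map_mxvec map_scalar_mx.
by rewrite [LHS]mxE.
Qed.

(** A polynomial in the entries of [J] that vanishes exactly when [J] has two
    opposite complex eigenvalues, see [resultant_neq0P]. *)
Definition opposite_eigenvalues_resultant J := resultant (char_poly J) (char_poly (- J)).

Lemma curve_poly_resultant : curve_poly (fun J (s : R) => opposite_eigenvalues_resultant J).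
Proof.
move=> J s; exists (resultant (char_poly J) (char_poly (- J))) => t.
rewrite -[RHS]/(horner_eval t _) map_resultant ?(monicP (char_poly_monic _)) ?rmorph1 ?oner_neq0 //.
by rewrite !map_char_poly map_mxN.
Qed.

Local Notation RC := (real_complex R).

Lemma resultant_neq0P J : opposite_eigenvalues_resultant J != 0 <->
  forall z, ~ (eigenvalue (map_mx RC J) z /\ eigenvalue (map_mx RC (- J)) z).
Proof.
have g0 : gcdp (char_poly J) (char_poly (- J)) != 0.
  by rewrite gcdp_eq0 negb_and monic_neq0 ?char_poly_monic.
have -> : (opposite_eigenvalues_resultant J != 0) = coprimep (char_poly J) (char_poly (- J)).
  rewrite /opposite_eigenvalues_resultant resultant_eq0 /coprimep -leqNgt.
  by rewrite eqn_leq [X in _ && X]lt0n size_poly_eq0 g0 andbT.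
rewrite -(coprimep_map RC) !map_char_poly; split.
  move=> cop z [zJ zN]; rewrite !eigenvalue_root_char in zJ zN.
  by have := coprimep_root cop zJ; rewrite -[_ == 0]/(root _ z) zN.
move=> h; apply/Pdiv.ClosedField.coprimepP => z zJ; apply/negP=> zN.
rewrite -rootE in zN; rewrite -!eigenvalue_root_char in zJ zN.
exact: (h z (conj zJ zN)).
Qed.

Lemma eigenvalue_conj J z : eigenvalue (map_mx RC J) z -> eigenvalue (map_mx RC J) z^*%C.
Proof.
rewrite !eigenvalue_root_char -!map_char_poly -complex_root_conj => zJ.
rewrite (_ : map_poly _ (map_poly _ _) = map_poly RC (char_poly J)) //.
apply/polyP=> i; rewrite !coef_map /=; by congr (_ +i* _)%C; rewrite oppr0.
Qed.

(** A purely imaginary eigenvalue of a real matrix comes with its opposite. *)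
Lemma resultant_hyperbolic J : opposite_eigenvalues_resultant J != 0 ->
  forall z, eigenvalue (map_mx RC J) z -> complex.Re z != 0.
Proof.
move=> /resultant_neq0P h z zJ; apply/negP=> /eqP rez; apply: (h z (conj zJ _)).
have /eigenvalueP[v vJ v0] := eigenvalue_conj zJ; apply/eigenvalueP; exists v; last exact: v0.
rewrite map_mxN mulmxN vJ -scaleNr; congr (_ *: _).
by case: z rez {zJ vJ} => a b /= ->; simpc.
Qed.

End CurvePoly.

(** * A singular matrix without opposite eigenvalues *)

Section CycleMatrix.
Variable n : nat.
Implicit Types (z : 'I_n) (p : seq 'I_n).

(** Without the additional diagonal entry at [last z p], the eigenvalues of a
    cycle of even length would come in opposite pairs. *)
Definition cycle_mx (L : pzSemiRingType) z p : 'M[L]_n :=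
  \matrix_(i, j) ((j == prev (z :: p) i)%:R + ((i == last z p) && (j == last z p))%:R).

Lemma map_cycle_mx (L L' : pzSemiRingType) (f : {rmorphism L -> L'}) z p :
  map_mx f (cycle_mx L z p) = cycle_mx L' z p.
Proof. by apply/matrixP=> i j; rewrite !mxE rmorphD !rmorph_nat. Qed.

(** Following the eigenvector along the cycle. *)
Lemma cycle_mx_eigenvector (L : fieldType) z p (l : L) (v : 'rV[L]_n) : uniq (z :: p) ->
  v != 0 -> v *m cycle_mx L z p = l *: v -> l = 1 \/ l ^+ size p * (l - 1) = 1.
Proof.
move=> up v0 vJ; pose c0 := last z p.
have eq i : v 0 i + (prev (z :: p) i == c0)%:R * v 0 c0 = l * v 0 (prev (z :: p) i).
  have E := congr1 (fun w : 'rV[L]_n => w 0 (prev (z :: p) i)) vJ; rewrite mxE [RHS]mxE in E.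
  rewrite -{}E.
  have entry k : cycle_mx L z p k (prev (z :: p) i) =
      (k == i)%:R + ((k == c0) && (prev (z :: p) i == c0))%:R.
    by rewrite !mxE (inj_eq (can_inj (next_prev up))) eq_sym.
  rewrite (eq_bigr (fun k => v 0 k * (k == i)%:R +
    v 0 k * ((k == c0) && (prev (z :: p) i == c0))%:R)); last by move=> k _; rewrite entry mulrDr.
  rewrite big_split (bigD1 i) //= eqxx mulr1 big1 ?addr0; last first.
    by move=> k /negPf->; rewrite mulr0.
  rewrite [X in _ = _ + X](bigD1 c0) //= eqxx /= big1 ?addr0; first by rewrite [X in _ = _ + X]mulrC.
  by move=> k /negPf->; rewrite mulr0.
have step x q : path (fun a b => a == prev (z :: p) b) x q -> uniq (x :: q) -> last x q = c0 ->
    v 0 c0 = l ^+ size q * v 0 x /\ (v 0 x = 0 -> forall y, y \in x :: q -> v 0 y = 0).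
  elim: q x => [|a q IH] x /=.
    by move=> _ _ ->; rewrite expr0 mul1r; split=> // xv y; rewrite inE => /eqP->.
  case/andP=> /eqP xa pq /andP[xq uq] lq; have {}xa : x = prev (z :: p) a by [].
  have xc : (x == c0) = false.
    by apply: contraNF xq => /eqP ->; rewrite -lq mem_last.
  have := eq a; rewrite -xa xc mul0r addr0 => va.
  have [c0E zero] := IH a pq uq lq; split; first by rewrite c0E va mulrA exprSr.
  move=> vx y; rewrite inE => /predU1P[->//|]; apply: zero.
  by rewrite va vx mulr0.
have pz : path (fun a b => a == prev (z :: p) b) z p.
  by have := cycle_prev up; rewrite /path.cycle rcons_path => /andP[].
have [c0E zero] := step z p pz up erefl.
have zE := eq z; rewrite prev_head // -/c0 eqxx mul1r in zE.
have vzE : v 0 z = (l ^+ size p * (l - 1)) * v 0 z.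
  have E : v 0 z = (l - 1) * v 0 c0 by rewrite mulrBl mul1r -zE addrK.
  by rewrite {1}E c0E; ring.
have [vz|vz] := eqVneq (v 0 z) 0; last first.
  by right; apply: (mulIf vz); rewrite mul1r -vzE.
left; have [i vi] := rV0Pn _ v0.
have ip : i \notin z :: p by apply: contra vi => ip; rewrite (zero vz i ip).
have := eq i; rewrite prev_notin // (_ : (i == c0) = false); last first.
  by apply: contraNF ip => /eqP ->; rewrite mem_last.
by rewrite mul0r addr0 -{1}[v 0 i]mul1r => /(mulIf vi).
Qed.

Lemma cycle_mx_no_opposite (C : numFieldType) z p (l : C) (v w : 'rV[C]_n) :
  uniq (z :: p) -> (0 < size p)%N -> v != 0 -> w != 0 ->
  v *m cycle_mx C z p = l *: v -> w *m cycle_mx C z p = (- l) *: w -> False.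
Proof.
move=> up p0 v0 w0 vJ wJ.
have := cycle_mx_eigenvector up v0 vJ; have := cycle_mx_eigenvector up w0 wJ.
have two : (1 + 1 : C) != 0 by rewrite -[1 + 1]/(2%:R) pnatr_eq0.
have three : (1 + (1 + 1) : C) != 0 by rewrite -[1 + (1 + 1)]/(3%:R) pnatr_eq0.
have sgn : (-1 : C) ^+ size p = 1 \/ (-1 : C) ^+ size p = -1.
  by rewrite -signr_odd; case: odd; [right; rewrite expr1 | left; rewrite expr0].
have no2 : (-1) ^+ size p * (-1 - 1) = 1 :> C -> False.
  case: sgn => ->; rewrite ?mul1r ?mulN1r => E.
    by case/eqP: three; rewrite -{3}E; ring.
  case/eqP: (oner_neq0 C); have -> : (1 : C) = 1 + 1 - 1 by ring.
  by rewrite -{3}E; ring.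
rewrite exprNn => -[E1|E1] [E2|E2].
- by case/eqP: two; rewrite -{1}E1 E2 addNr.
- by apply: no2; have lE : l = -1 by [rewrite -E1 opprK]; rewrite lE in E2.
- by apply: no2; rewrite E2 expr1n mulr1 in E1.
have [x xE] : exists x, l ^+ size p = x by exists (l ^+ size p).
rewrite xE in E1 E2; case: sgn E1 => ->; rewrite ?mul1r ?mulN1r => E1.
  have x1 : x = -1.
    apply/eqP; rewrite -subr_eq0 opprK -(mulrI_eq0 _ (mulfI two)); apply/eqP.
    have -> : (1 + 1) * (x + 1) = 1 + 1 - (x * (- l - 1) + x * (l - 1)) by ring.
    by rewrite E1 E2 subrr.
  have l0 : l = 0.
    by rewrite x1 in E2; have -> : l = 1 - (-1 * (l - 1)) by [ring]; rewrite E2 subrr.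
  by move: xE; rewrite l0 expr0n; case: (size p) p0 => //= m _ /eqP; rewrite x1 eq_sym oppr_eq0 oner_eq0.
have x0 : x = 0.
  apply: (mulfI two); rewrite mulr0.
  have -> : (1 + 1) * x = - x * (- l - 1) - x * (l - 1) by ring.
  by rewrite E1 E2 subrr.
by move: E2; rewrite x0 mul0r => /eqP; rewrite eq_sym oner_eq0.
Qed.

Lemma cycle_mx_resultant (R : realType) z p : uniq (z :: p) -> (0 < size p)%N ->
  opposite_eigenvalues_resultant (cycle_mx R z p) != 0.
Proof.
move=> up p0; apply/resultant_neq0P=> l [/eigenvalueP[v vJ v0] /eigenvalueP[w wJ w0]].
rewrite map_cycle_mx in vJ; rewrite map_mxN map_cycle_mx mulmxN in wJ.
apply: (cycle_mx_no_opposite up p0 v0 w0 vJ).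
by rewrite scaleNr -wJ opprK.
Qed.

End CycleMatrix.

Section CycleWitness.
Variables (R : realType) (n : nat) (G : io_network 'I_n).
Local Notation e := (arrow G).
Hypothesis coreG : core G.
Variable A : {set 'I_n}.
Hypothesis hA : appendage_subnetwork G A.

(** The node given by [exit_entry_separator] is reached from an exit of [A] and
    leads to an entry. *)
Lemma appendage_cycle_exists : exists z p,
  [/\ path.cycle e (z :: p), uniq (z :: p), z \in A & last z p \notin A].
Proof.
have [s0 en] := entry_exists coreG hA; have [s1 ex] := exit_exists coreG hA.
have [x sep] := exit_entry_separator coreG hA en ex.
have [s0S [z0 [t0 [es0 z0t t0A]]]] := en; have [s1S [z1 [t1 [t1A tz1 es1]]]] := ex.
have [U [_ [is0 _ _ sU _]]] := simple_split s0S.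
have [_ [W [_ s1o _ _ sW]]] := simple_split s1S.
have nl1 : ~~ linked e (simple_nodes G :\ x) s1 (onode G).
  by apply: sep; rewrite !inE eqxx ?orbT.
have nl0 : ~~ linked e (simple_nodes G :\ x) (inode G) s0.
  by apply: sep; rewrite !inE eqxx ?orbT.
have [U1 [_ [s1x _ _ _ _]]] := linked_split (linkedS sW s1o) nl1.
have [_ [W1 [_ xs0 _ _ _]]] := linked_split (linkedS sU is0) nl0.
have full D y y' : linked e D y y' -> linked e setT y y' by apply: linkedS => a _; rewrite in_setT.
have s1A : s1 \notin A by apply/negP=> /(appendage_subnetwork_sub hA); rewrite inE s1S.
have t1s1 : linked e setT t1 s1 by apply: linked_rstep (full _ _ _ tz1) es1 _; rewrite in_setT.
have s1t1 : linked e setT s1 t1.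
  apply: linked_trans (full _ _ _ s1x) (linked_trans (full _ _ _ xs0) _).
  apply: linked_step es0 _ _; first by rewrite in_setT.
  by apply: linked_trans (full _ _ _ z0t) (full _ _ _ (appendage_subnetwork_linked hA t0A t1A)).
have [z [p [cz uz _ zA lA]]] := crossing_cycle t1A s1A t1s1 s1t1.
by exists z, p.
Qed.

Lemma hyperbolic_witness : exists J : 'M[R]_n,
  singular_point G A J /\ opposite_eigenvalues_resultant J != 0.
Proof.
have [z [p [cz uz zA lA]]] := appendage_cycle_exists.
have zl : last z p != z by apply: contraNneq lA => ->.
exists (cycle_mx R z p); split; last first.
  by apply: cycle_mx_resultant => //; case: p zl {cz uz lA} => //=; rewrite eqxx.
split=> [j l njl|].
  rewrite mxE (_ : (l == prev (z :: p) j) = false); last first.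
    apply: contraNF njl => /eqP ->; rewrite /coupled.
    have [jc|jc] := boolP (j \in z :: p); last by rewrite prev_notin // eqxx.
    by rewrite (prev_cycle cz jc) orbT.
  have [jE|_] := eqVneq j (last z p); rewrite ?add0r //=.
  by case: eqP => // lE; move: njl; rewrite /coupled jE lE eqxx.
exists (delta_mx 0 z); split.
- by apply/rV0Pn; exists z; rewrite mxE !eqxx oner_neq0.
- move=> i iA; rewrite mxE; case: (i =P z) => [E|_]; last by rewrite andbF.
  by rewrite E zA in iA.
move=> k kA; rewrite -rowE !mxE prev_head // (eq_sym z) (negPf zl) addr0.
by case: eqP => // kE; rewrite kE (negPf lA) in kA.
Qed.

End CycleWitness.

Lemma linear_continuous_differentiable (R : numFieldType) (V W : normedModType R)
  (f : V -> W) x : linear f -> continuous f -> differentiable f x.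
Proof.
move=> lin cont; pose m := GRing.isLinear.Build _ _ _ _ _ lin.
pose g : {linear V -> W} := HB.pack f m.
exact: (@linear_differentiable _ _ _ g).
Qed.

(** * Linear admissible systems *)

Section LinearSystem.
Variables (R : realType) (n : nat) (G : io_network 'I_n).
Local Notation inp := (inode G).
Variables (J : 'M[R]_n) (s : R).

Definition linear_system (j : 'I_n) (p : 'rV[R]_n * R) : R :=
  \sum_l J j l * p.1 0 l + (j == inp)%:R * s * p.2.

Lemma linear_system_linear j (h : R) v a :
  linear_system j (h *: v + a) = h * linear_system j v + linear_system j a.
Proof.
rewrite /linear_system [in RHS]mulrDr [in RHS]mulr_sumr addrACA -big_split /=; congr (_ + _).
  by apply: eq_bigr => l _; rewrite !mxE; ring.
by rewrite /GRing.scale /=; ring.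
Qed.

Lemma linear_system_differentiable j p : differentiable (linear_system j) p.
Proof.
have dcoord l : differentiable (fun p : 'rV[R]_n * R => p.1 0 l) p.
  apply: (@differentiable_comp _ _ _ _ (fun q : 'rV[R]_n * R => q.1) (fun v : 'rV[R]_n => v 0 l)).
    by apply: linear_continuous_differentiable => // q; apply: cvg_fst.
  exact: differentiable_coord.
have -> : linear_system j =
    \sum_(l < n) (J j l *: (fun p : 'rV[R]_n * R => p.1 0 l)) + ((j == inp)%:R * s) *: (fun p => p.2).
  rewrite funeqE => q; rewrite /linear_system fctE /= fct_sumE; congr (_ + _).
apply: differentiableD.
  by apply: differentiable_sum => l; apply: differentiableZ.
by apply: differentiableZ; apply: linear_continuous_differentiable => // q; apply: cvg_snd.
Qed.

Lemma linear_system_derive j v p : 'D_v (linear_system j) p = linear_system j v.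
Proof.
rewrite /derive; apply: cvg_lim => //.
apply: (@cvg_trans _ ((fun=> linear_system j v) @ 0^')%classic); last exact: cvg_cst.
apply: near_eq_cvg; near=> h.
have h0 : h != 0 by near: h; apply: nbhs_dnbhs_neq.
by rewrite /= linear_system_linear addrK /GRing.scale /= mulrA mulVf // mul1r.
Unshelve. all: by end_near.
Qed.

Lemma differentiable_n_cst (V W : normedModType R) (c : W) k :
  differentiable_n k (fun _ : V => c).
Proof.
elim: k c => [//|k IH] c; split=> [x|v]; first exact: differentiable_cst.
have -> : (fun x => 'D_v (fun _ : V => c) x) = (fun=> 0) by rewrite funeqE => x; apply: derive_cst.
exact: IH.
Qed.

Lemma linear_system_smooth j : smooth (linear_system j).
Proof.
case=> [//|k]; split=> [x|v]; first exact: linear_system_differentiable.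
have -> : (fun x => 'D_v (linear_system j) x) = (fun=> linear_system j v).
  by rewrite funeqE => x; apply: linear_system_derive.
exact: differentiable_n_cst.
Qed.

Lemma linear_system_jacobian X I : jacobian_mx linear_system X I = J.
Proof.
apply/matrixP=> j l; rewrite mxE linear_system_derive /linear_system /= mulr0 addr0.
rewrite (bigD1 l) //= mxE !eqxx mulr1 big1 ?addr0 // => l' /negPf l'l.
by rewrite mxE l'l andbF mulr0.
Qed.

Lemma linear_system_input X I : input_derivative G linear_system X I = s.
Proof.
rewrite /input_derivative linear_system_derive /linear_system eqxx mul1r mulr1 big1 ?add0r //.
by move=> l _; rewrite mxE mulr0.
Qed.

Lemma linear_system_admissible : network_mx G J ->
  (forall j l, j != l -> arrow G l j -> J j l != 0) -> admissible G linear_system.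
Proof.
move=> nJ nz; split.
- exact: linear_system_smooth.
- by move=> j /eqP/negPf ji X I I'; rewrite /linear_system ji !mul0r.
- move=> j X Y I XY; rewrite /linear_system; congr (_ + _); apply: eq_bigr => l _ /=.
  have [/XY-> //|/nJ->] := boolP (coupled G j l); by rewrite !mul0r.
- move=> j l /eqP jl; split=> [h|h X I].
    apply/negP=> lj; have := nz j l jl lj.
    by rewrite -(linear_system_jacobian 0 0) h eqxx.
  by rewrite linear_system_jacobian nJ // /coupled negb_or jl.
Qed.

Lemma hyperbolic_det (M : 'M[R]_n) :
  (forall z, eigenvalue (map_mx (real_complex R) M) z -> complex.Re z != 0) -> \det M != 0.
Proof.
move=> h; apply/negP=> d0; have := h 0; rewrite /= eqxx => h0.
suff : false by []; apply: h0.
have : \det (map_mx (real_complex R) M) == 0 by rewrite det_map_mx (eqP d0) rmorph0.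
case/det0P=> v v0 vM; apply/eigenvalueP; exists v => //.
by rewrite vM scale0r.
Qed.

(** The equilibria form the line spanned by [- s] times the column of the inverse
    of [J] at the input node, whose entry at [k] is a multiple of the cofactor. *)
Lemma linear_system_homeostatic k : \det J != 0 ->
  homeostatic linear_system 0 0 k -> s * cofactor J inp k = 0.
Proof.
move=> d0 hom; have uJ : J \in unitmx by rewrite unitmxE unitfE.
pose b : 'cV[R]_n := delta_mx inp 0.
pose v : 'rV[R]_n := (- s) *: (invmx J *m b)^T.
have vk : v 0 k = - (s * cofactor J inp k / \det J).
  rewrite !mxE (bigD1 inp) //= big1 ?addr0; last first.
    by move=> i /negPf ii; rewrite !mxE ii mulr0.
  rewrite /b mxE !eqxx mulr1 /invmx uJ !mxE; ring.
have fam : equilibrium_family linear_system 0 0 (fun I => I *: v).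
  split; first by rewrite scale0r.
    exact: scalel_continuous.
  near=> I => j; rewrite /linear_system /=.
  have -> : \sum_l J j l * (I *: v) 0 l = - (I * s) * (J *m (invmx J *m b)) j 0.
    rewrite [X in _ = _ * X]mxE mulr_sumr; apply: eq_bigr => l _.
    by rewrite !mxE; ring.
  by rewrite mulKVmx // mxE andbT; ring.
have D := hom _ fam.
have D' : 'D_1 (fun I : R => (I *: v) 0 k) 0 = v 0 k.
  rewrite /derive; apply: cvg_lim => //.
  apply: (@cvg_trans _ ((fun=> v 0 k) @ 0^')%classic); last exact: cvg_cst.
  apply: near_eq_cvg; near=> h.
  have h0 : h != 0 by near: h; apply: nbhs_dnbhs_neq.
  by rewrite /= addr0 !mxE mul0r subr0 /GRing.scale /= mulr1 mulrA mulVf // mul1r.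
have /eqP := @derive_val _ _ _ _ _ _ _ D.
rewrite D' vk oppr_eq0 mulf_eq0 invr_eq0 (negPf d0) orbF => /eqP //.
Unshelve. all: by end_near.
Qed.

End LinearSystem.

(** * Derivative of a family of equilibria *)

Section EquilibriumFamily.
Variables (R : realType) (n : nat) (G : io_network 'I_n).
Local Notation inp := (inode G).

Lemma norm_le_coord (v : 'rV[R]_n) c : 0 <= c -> (forall i, `|v 0 i| <= c) -> `|v| <= c.
Proof.
move=> c0 h; rewrite [leLHS]/Num.norm /= mx_normrE; apply/bigmax_leP; split=> // -[a b] _ /=.
by rewrite ord1.
Qed.

Variables (f : 'I_n -> 'rV[R]_n * R -> R) (X0 : 'rV[R]_n) (I0 : R).
Hypotheses (adm : admissible G f) (hyp : hyperbolic_equilibrium f X0 I0).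
Let J := jacobian_mx f X0 I0.
Let s := input_derivative G f X0 I0.

Lemma admissible_diff j (v : 'rV[R]_n) k :
  'd (f j) (X0, I0) (v, k) = \sum_l J j l * v 0 l + (j == inp)%:R * s * k.
Proof.
have [sm indep _ _] := adm; have df : differentiable (f j) (X0, I0) by case: (sm j 1%N).
have pairD (a b : 'rV[R]_n) (c d : R) : (a + b, c + d) = (a, c) + (b, d) by [].
have pairZ (a : R) (b : 'rV[R]_n) (c : R) : (a *: b, a * c) = a *: (b, c) by [].
have additive0 : {morph (fun a : 'rV[R]_n => 'd (f j) (X0, I0) (a, 0)) : x y / x + y >-> x + y}.
  by move=> a b; rewrite -linearD -pairD addr0.
have zero0 : 'd (f j) (X0, I0) (0, 0) = 0 by rewrite -[(0, 0)]/(0 : 'rV[R]_n * R) linear0.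
rewrite -[in LHS](addr0 v) -[in LHS](add0r k) pairD linearD; congr (_ + _).
  rewrite [in LHS](row_sum_delta v) (big_morph _ additive0 zero0); apply: eq_bigr => l _.
  have -> : (v 0 l *: delta_mx 0 l, 0) = v 0 l *: (delta_mx 0 l, 0) :> 'rV[R]_n * R.
    by rewrite -pairZ mulr0.
  by rewrite linearZ mxE -deriveE // mulrC.
have -> : (0, k) = k *: (0, 1) :> 'rV[R]_n * R by rewrite -pairZ scaler0 mulr1.
rewrite linearZ -deriveE //.
have [->|ji] := eqVneq j inp; first by rewrite mul1r mulrC.
rewrite !mul0r; have -> : 'D_(0, 1) (f j) (X0, I0) = 0; last exact: mulr0.
rewrite /derive; apply: cvg_lim => //.
apply: (@cvg_trans _ ((fun=> 0) @ 0^')%classic); last exact: cvg_cst.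
apply: near_eq_cvg; near=> h => /=.
have -> : h *: (0, 1) + (X0, I0) = (X0, h + I0) :> 'rV[R]_n * R.
  by rewrite -pairZ -pairD scaler0 add0r mulr1.
by rewrite (indep j _ _ _ I0) ?subrr ?scaler0 //; apply/eqP.
Unshelve. all: by end_near.
Qed.

Lemma equilibrium_family_expansion Xf : equilibrium_family f X0 I0 Xf ->
  forall eps : R, 0 < eps -> \forall I \near I0, forall j,
    `|\sum_l J j l * (Xf I - X0) 0 l + (j == inp)%:R * s * (I - I0)| <=
      eps * (`|Xf I - X0| + `|I - I0|).
Proof.
case=> X0E cont eq eps e0; have [sm _ _ _] := adm.
have cX : ((fun I => Xf I - X0) @ I0 --> (0 : 'rV[R]_n))%classic.
  by rewrite -(subrr X0); apply: cvgB; [rewrite -X0E; apply: cont | apply: cvg_cst].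
have cI : ((fun I : R => I - I0) @ I0 --> (0 : R))%classic.
  by rewrite -(subrr I0); apply: cvgB; [apply: cvg_id | apply: cvg_cst].
have cvg : ((fun I => (Xf I - X0, I - I0)) @ I0 --> (0 : 'rV[R]_n * R))%classic.
  apply/cvgr0Pnorm_le => e e_gt0; near=> I.
  rewrite prod_normE ge_max /=; apply/andP; split.
    by near: I; move: e e_gt0; apply/cvgr0Pnorm_le.
  by near: I; move: e e_gt0; apply/cvgr0Pnorm_le.
have expand j : \forall I \near I0, `|f j (Xf I, I) - (f j (X0, I0) +
    'd (f j) (X0, I0) (Xf I - X0, I - I0))| <= eps * `|(Xf I - X0, I - I0)|.
  have df : differentiable (f j) (X0, I0) by case: (sm j 1%N).
  have [_ /eqaddoP/(_ eps e0) h] := (diff_locallyP _ _).1 df.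
  have {}h : \forall I \near I0, `|(f j \o shift (X0, I0) - (cst (f j (X0, I0)) + 'd (f j) (X0, I0)))
      (Xf I - X0, I - I0)| <= eps * `|(Xf I - X0, I - I0)| := cvg _ h.
  near=> I; have : `|(f j \o shift (X0, I0) - (cst (f j (X0, I0)) + 'd (f j) (X0, I0)))
      (Xf I - X0, I - I0)| <= eps * `|(Xf I - X0, I - I0)| by near: I.
  rewrite !fctE /= (_ : (Xf I - X0, I - I0) + (X0, I0) = (Xf I, I)) //.
  by congr pair; apply: subrK.
have all_expand := filter_forall _ expand.
near=> I => j.
have fI : forall j, f j (Xf I, I) = 0 by near: I.
have f0 : f j (X0, I0) = 0 by case: hyp.
have : `|f j (Xf I, I) - (f j (X0, I0) +
    'd (f j) (X0, I0) (Xf I - X0, I - I0))| <= eps * `|(Xf I - X0, I - I0)|.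
  by move: j {f0}; near: I; exact: all_expand.
rewrite fI f0 !add0r normrN admissible_diff => /le_trans; apply.
rewrite ler_pM2l // prod_normE ge_max /=; apply/andP; split.
  by rewrite lerDl.
by rewrite lerDr.
Unshelve. all: by end_near.
Qed.

(** Since the Jacobian is invertible, [equilibrium_family_expansion] shows first
    that the family is Lipschitz at [I0], and then that its derivative there is
    [- s] times the column of the inverse Jacobian at the input node. *)
Lemma homeostatic_of_cofactor k : cofactor J inp k = 0 -> homeostatic f X0 I0 k.
Proof.
move=> cof0 Xf fam; have d0 : \det J != 0 by apply: hyperbolic_det; case: hyp.
have uJ : J \in unitmx by rewrite unitmxE unitfE.
have Jk : invmx J k inp = 0 by rewrite /invmx uJ !mxE cof0 mulr0.
pose C := \sum_i \sum_j `|invmx J i j| + 1.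
have C_gt0 : 0 < C.
  by rewrite ltr_wpDl // sumr_ge0 // => i _; apply: sumr_ge0.
have rowC i : \sum_j `|invmx J i j| <= C.
  rewrite /C [X in _ <= X + 1](bigD1 i) //= -addrA lerDl addr_ge0 // sumr_ge0 // => i' _; exact: sumr_ge0.
have entryC i j : `|invmx J i j| <= C.
  by apply: le_trans (rowC i); rewrite (bigD1 j) //= lerDl sumr_ge0.
have solve (y : 'rV[R]_n) (t e N : R) : (forall j, `|\sum_l J j l * y 0 l + (j == inp)%:R * s * t| <= e * N) ->
    forall i, `|y 0 i + invmx J i inp * s * t| <= C * (e * N).
  move=> h i.
  have -> : y 0 i + invmx J i inp * s * t =
      \sum_j invmx J i j * (\sum_l J j l * y 0 l + (j == inp)%:R * s * t).
    have -> : y 0 i = (invmx J *m (J *m y^T)) i 0 by rewrite mulKmx // mxE.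
    have Jy j : \sum_l J j l * y 0 l = (J *m y^T) j 0.
      by rewrite [RHS]mxE; apply: eq_bigr => l _; rewrite [X in _ = _ * X]mxE.
    rewrite (eq_bigr (fun j => invmx J i j * (J *m y^T) j 0 + invmx J i j * ((j == inp)%:R * s * t)));
      last by move=> j _; rewrite mulrDr Jy.
    rewrite big_split [X in X + _ = _]mxE /=; congr (_ + _).
    rewrite (bigD1 inp) //= eqxx big1 ?addr0; first by rewrite mul1r mulrA.
    by move=> j /negPf->; rewrite !mul0r mulr0.
  apply: le_trans (ler_norm_sum _ _ _) _.
  apply: (@le_trans _ _ (\sum_j `|invmx J i j| * (e * N))).
    by apply: ler_sum => j _; rewrite normrM ler_wpM2l.
  rewrite -mulr_suml ler_wpM2r ?rowC //.
  exact: le_trans (normr_ge0 _) (h k).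
have bound (delta : R) : 0 < delta -> \forall I \near I0, `|(Xf I - X0) 0 k| <= delta * `|I - I0|.
  move=> delta0; pose L := 2 * C * `|s| + 2.
  have L_gt0 : 0 < L by rewrite ltr_wpDl // !mulr_ge0 // ltW.
  pose eps := Num.min (2 * C)^-1 (delta / (C * L)).
  have eps0 : 0 < eps by rewrite lt_min invr_gt0 divr_gt0 ?mulr_gt0.
  have e1 : C * eps <= 2^-1.
    have : eps <= (2 * C)^-1 by rewrite ge_min lexx.
    by rewrite invfM ler_pdivlMr // mulrC.
  have e2 : C * eps * L <= delta.
    have : eps <= delta / (C * L) by rewrite ge_min lexx orbT.
    by rewrite ler_pdivlMr ?mulr_gt0 // => h; apply: le_trans h; rewrite mulrA [eps * C]mulrC.
  have := equilibrium_family_expansion fam eps0; apply: filterS => I exp.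
  set y := Xf I - X0 in exp *; set t := I - I0 in exp *.
  have sol := solve y t eps _ exp.
  have ynorm : `|y| <= C * `|s| * `|t| + C * (eps * (`|y| + `|t|)).
    have N0 : 0 <= `|y| + `|t| by rewrite addr_ge0.
    have C0 := ltW C_gt0; have ep0 := ltW eps0.
    apply: norm_le_coord => [|i]; first by apply: addr_ge0; rewrite !mulr_ge0.
    rewrite -[y 0 i](addrK (invmx J i inp * s * t)); apply: le_trans (ler_normB _ _) _.
    rewrite addrC; apply: lerD; last exact: sol.
    by rewrite !normrM -!mulrA ler_wpM2r // mulr_ge0.
  have yt : `|y| + `|t| <= L * `|t|.
    have t0 := normr_ge0 t; have y0 := normr_ge0 y.
    have : C * (eps * (`|y| + `|t|)) <= 2^-1 * (`|y| + `|t|).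
      by rewrite mulrA ler_wpM2r // addr_ge0.
    rewrite /L; move: ynorm; rewrite -[C * `|s| * `|t|]mulrA.
    move: (C * (eps * _)) => z ynorm zle.
    have -> : (2 * C * `|s| + 2) * `|t| = 2 * (C * (`|s| * `|t|)) + 2 * `|t| by ring.
    move: (C * (_ * _)) ynorm => w ynorm; lra.
  have := sol k; rewrite Jk !mul0r addr0 => /le_trans; apply.
  rewrite mulrA; apply: (@le_trans _ _ (C * eps * (L * `|t|))).
    by rewrite ler_wpM2l // mulr_ge0 // ltW.
  by rewrite mulrA ler_wpM2r.
have quot : ((fun h : R => h^-1 *: (((fun I => Xf I 0 k) \o shift I0) (h *: 1) - Xf I0 0 k)) @ 0^' --> (0 : R))%classic.
  apply/cvgr0Pnorm_le => delta delta0.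
  have : \forall h \near (0 : R), `|(Xf (h + I0) - X0) 0 k| <= delta * `|h + I0 - I0|.
    have := bound _ delta0; rewrite (near_shift 0) subr0; exact.
  move=> near0; near=> h.
  have h0 : h != 0 by near: h; apply: nbhs_dnbhs_neq.
  have hb : `|(Xf (h + I0) - X0) 0 k| <= delta * `|h + I0 - I0| by near: h; apply: nbhs_dnbhs.
  have X0E : Xf I0 = X0 by case: fam.
  rewrite /= X0E normrZ normfV ler_pdivrMl ?normr_gt0 // mulrC [h *: 1]mulr1.
  by move: hb; rewrite addrK !mxE.
apply: DeriveDef; first by apply: cvgP quot.
exact: cvg_lim quot.
Unshelve. all: by end_near.
Qed.

End EquilibriumFamily.

(** * Induction and configurations *)

Section Induction.
Variables (R : realType) (n : nat) (G : io_network 'I_n).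
Hypothesis coreG : core G.
Variable A : {set 'I_n}.
Hypothesis hA : appendage_subnetwork G A.
Local Notation inp := (inode G).
Local Notation e := (arrow G).
Implicit Types (J : 'M[R]_n) (k : 'I_n).

Lemma homeostasis_inducing_singular J :
  homeostasis_inducing G (full_subnetwork G A) J <-> singular_on A J.
Proof.
split=> [[b [hb Eb db]]|sJ].
  have [rb cb] := homeostasis_block_labels hA hb Eb.
  exact/(det_block_singular J rb cb).
have [b [hb rb cb]] := appendage_block_exists coreG hA.
have rb' : perm_eq (brow b) (enum A) by rewrite rb.
have cb' : perm_eq (bcol b) (enum A) by rewrite cb.
exists b; split=> //; first exact: appendage_block_subnetwork.
exact/(det_block_singular J rb' cb').
Qed.

Lemma invariant_induces k : config_invariant G A k -> induces R G (full_subnetwork G A) k.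
Proof.
move=> inv; exists (mpoly.mpolyC (n * n + 1) (1 : R)); split.
  exists 0, 0; split; first by move=> j l _; rewrite mxE.
    apply/homeostasis_inducing_singular; have [t tA] := appendage_subnetwork_neq0 hA.
    exists (delta_mx 0 t); split; last by move=> l _; rewrite mulmx0 mxE.
      by apply/rV0Pn; exists t; rewrite mxE !eqxx oner_neq0.
    move=> i iA; rewrite mxE; case: (i =P t) => [E|_]; last by rewrite andbF.
    by rewrite E tA in iA.
  by rewrite /eval_partials mpoly.mevalC oner_neq0.
move=> f X0 I0 adm hyp /homeostasis_inducing_singular sJ _.
apply: (homeostatic_of_cofactor adm hyp).
apply: invariant_cofactor0 inv sJ; first exact: appendage_subnetwork_inp coreG _ hA.
move=> j l; rewrite /coupled negb_or => /andP[/eqP jl njl].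
by case: adm => _ _ _ /(_ j l jl) [_ h]; apply: h.
Qed.

(** By irreducibility there is a singular matrix at which none of the following
    vanish: the exceptional polynomial [P], the resultant that ensures
    hyperbolicity, the cofactor, the input derivative and the entries of the
    arrows.  The linear system with this Jacobian contradicts induction. *)
Lemma induces_invariant k : induces R G (full_subnetwork G A) k -> config_invariant G A k.
Proof.
case=> P [[J0 [s0 [nJ0 iJ0 P0]]] hP] s conf j jA; apply: contraT => sjA; exfalso.
have iA := appendage_subnetwork_inp coreG hA.
have strong := appendage_subnetwork_linked hA.
pose Z J := singular_point G A J.
pose generic F := curve_poly F /\ exists J s, Z J /\ F J s != 0.
have gen0 : generic (eval_partials P).
  split; first exact: curve_poly_eval.
  by exists J0, s0; split=> //; split=> //; apply/homeostasis_inducing_singular.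
have genM F F' : generic F -> generic F' -> generic (fun J s => F J s * F' J s).
  move=> [cF zF] [cF' zF']; split; first exact: curve_polyM.
  exact: (singular_points_irreducible strong cF cF' zF zF').
have gen_res : generic (fun J s => opposite_eigenvalues_resultant J).
  split; first exact: curve_poly_resultant.
  by have [J [ZJ rJ]] := hyperbolic_witness R coreG hA; exists J, 0.
have gen_cof : generic (fun J s => cofactor J inp k).
  split; first exact: curve_poly_cofactor.
  have [J [nJ sJ cJ]] := configuration_witness R iA conf jA sjA.
  by exists J, 0.
have ZE (J : 'M[R]_n) t : t \in A -> network_mx G J -> (forall l, l \in A -> J t l = 0) -> Z J.
  move=> tA nJ Jt; split=> //; exists (delta_mx 0 t); split.
  - by apply/rV0Pn; exists t; rewrite mxE !eqxx oner_neq0.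
  - move=> i iA'; rewrite mxE; case: (i =P t) => [E|_]; last by rewrite andbF.
    by rewrite E tA in iA'.
  - by move=> l lA; rewrite -rowE mxE Jt.
have gen_s : generic (fun J s => s).
  split; first exact: curve_poly_scalar.
  exists 0, 1; split; last exact: oner_neq0.
  by apply: (ZE _ _ jA) => [? ? _|l _]; rewrite mxE.
have gen_entry (a : 'I_n * 'I_n) : a.1 != a.2 -> e a.2 a.1 -> generic (fun J s => J a.1 a.2).
  move=> a12 ea; split; first exact: curve_poly_entry.
  exists (delta_mx a.1 a.2), 0; split; last by rewrite mxE !eqxx oner_neq0.
  have nd : network_mx G (delta_mx a.1 a.2 : 'M[R]_n).
    move=> i l; rewrite mxE; case: (i =P a.1) => [->|] //=; case: (l =P a.2) => [->|] //=.
    by rewrite /coupled ea orbT.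
  have [a2A|a2A] := boolP (a.2 \in A).
    by apply: (ZE _ _ a2A) => // l _; rewrite mxE eq_sym (negPf a12).
  apply: (ZE _ _ jA) => // l lA; rewrite mxE; case: (l =P a.2) => [E|_]; last by rewrite andbF.
  by rewrite -E lA in a2A.
have gen_entries (r : seq ('I_n * 'I_n)) : exists F, generic F /\ forall J s, F J s != 0 ->
    forall a, a \in r -> a.1 != a.2 -> e a.2 a.1 -> J a.1 a.2 != 0.
  elim: r => [|a r [F [gF FP]]]; first by exists (fun J s => s); split.
  have [/andP[a12 ea]|na] := boolP ((a.1 != a.2) && e a.2 a.1); last first.
    exists F; split=> // J t nz b; rewrite inE => /predU1P[->|br]; last exact: FP nz b br.
    by move=> a12 ea; rewrite a12 ea in na.
  exists (fun J t => J a.1 a.2 * F J t); split; first by apply: genM => //; apply: gen_entry.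
  move=> J t; rewrite mulf_eq0 negb_or => /andP[Ja nz] b; rewrite inE => /predU1P[->//|br].
  exact: FP nz b br.
have [F [gF FP]] := gen_entries (enum {: 'I_n * 'I_n}).
have [_ [J [t [[nJ sJ]]]]] := genM _ _ (genM _ _ gen0 gen_res) (genM _ _ (genM _ _ gen_cof gen_s) gF).
rewrite mulf_eq0 negb_or => /andP[+ +]; rewrite mulf_eq0 negb_or => /andP[PJ rJ].
rewrite mulf_eq0 negb_or => /andP[+ FJ]; rewrite mulf_eq0 negb_or => /andP[cJ t0].
have adm : admissible G (linear_system G J t).
  apply: linear_system_admissible => // i l il eil.
  by apply: (FP J t FJ (i, l)); rewrite ?mem_enum.
have hypJ := resultant_hyperbolic rJ.
have hyp : hyperbolic_equilibrium (linear_system G J t) 0 0.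
  split; last by rewrite linear_system_jacobian.
  move=> i; rewrite /linear_system mulr0 addr0 big1 // => l _; by rewrite mxE mulr0.
have hom : homeostatic (linear_system G J t) 0 0 k.
  apply: (hP _ _ _ adm hyp); rewrite linear_system_jacobian ?linear_system_input //.
  exact/homeostasis_inducing_singular.
have := linear_system_homeostatic (hyperbolic_det hypJ) hom => /eqP.
by rewrite mulf_eq0 (negPf t0) (negPf cJ).
Qed.

End Induction.

Theorem theorem2p20 (R : realType) (n : nat) (G : io_network 'I_n)
  (coreG : core G) (Ai Aj : {set 'I_n})
  (hAi : appendage_subnetwork G Ai) (hAj : appendage_subnetwork G Aj) :
  component_induces R G Ai Aj <->
  strictly_upstream G (AppendageComponent Ai) (AppendageComponent Aj) /\
  (forall p : seq (pattern_node 'I_n {set 'I_n}),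
     pattern_path G (AppendageComponent Ai) (AppendageComponent Aj) p ->
     exists rho Vmax Vmin,
       [/\ super_simple G rho,
           SuperSimple rho \in AppendageComponent Ai :: p,
           is_Vmax G Ai Vmax, is_Vmin G Aj Vmin
         & chain_le G Vmax (SuperSimple rho) &&
           chain_le G (SuperSimple rho) Vmin]).
Proof.
rewrite -(invariant_iff_pattern coreG hAi hAj); split=> h k kA.
  exact: induces_invariant (h k kA).
exact: invariant_induces (h k kA).
Qed.
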